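(* Assume (cc1)–(cc6) with $\mathfrak g\in C^{0,2}(\Omega\times\mathbb R,\mathbb R)$ and $\lambda_-<\lambda^+$, and let $\lambda_1<\lambda_2$ in $(\lambda_-,\lambda^+)$. (i) If $\mathfrak l_{\lambda_2}$ and $\mathfrak r^-_{\lambda_1}$ are jointly included in the strict d-concavity band $\mathcal D^*_{\mathfrak g}$, then the family $x'=\mathfrak c(\omega\cdot t)+\mathfrak d(\omega\cdot t)x+\mathfrak g(\omega\cdot t,x)+\lambda$ exhibits a local saddle-node bifurcation as $\lambda\uparrow\xi^+$ for some $\xi^+\ge\lambda^+$. (ii) If $\mathfrak r^+_{\lambda_2}$ and $\mathfrak u_{\lambda_1}$ are jointly included in $\mathcal D^*_{\mathfrak g}$, then the family exhibits a local saddle-node bifurcation as $\lambda\downarrow\xi_-$ for some $\xi_-\le\lambda_-$.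
   Context: $(\Omega,\sigma)$ is a continuous global flow on a compact metric space, $\omega\cdot t:=\sigma(t,\omega)$; $\mathfrak M_{\rm erg}$ is the set of $\sigma$-ergodic invariant Borel probability measures; $C^{0,2}$ denotes continuous maps with continuous $x$-derivatives up to order 2. Hypotheses (cc1)–(cc6) on $\mathfrak c,\mathfrak d,\mathfrak g$: (cc1) $\mathfrak c,\mathfrak d\in C(\Omega,\mathbb R)$, $\mathfrak g$ continuous with continuous $\mathfrak g_x$; (cc2) $\int_\Omega\mathfrak d\,dm>0$ for all $m$; (cc3) $\lim_{x\to\pm\infty}(\mathfrak d(\omega)x+\mathfrak g(\omega,x))=\mp\infty$ uniformly; (cc4) $\mathfrak g(\omega,0)=\mathfrak g_x(\omega,0)=0$, $\mathfrak g\le0$ on $\Omega\times[0,\infty)$, $\mathfrak g\ge0$ on $\Omega\times(-\infty,0]$, $m(\{\omega:\mathfrak g(\omega,x)<0\ \forall x>0,\ \mathfrak g(\omega,x)>0\ \forall x<0\})=1$ for all $m$; (cc5) $m(\{\omega:\mathfrak g(\omega,\cdot)\text{ concave on }[0,\infty)\text{, convex on }(-\infty,0]\})=1$ for all $m$; (cc6) $m(\{\omega:\mathfrak g_x(\omega,\cdot)\text{ strictly decreasing on }\mathcal J\text{, strictly increasing on }-\mathcal J\})>0$ for all compact intervals $\mathcal J\subset[0,\infty)$ and all $m$. $\tau_\lambda$ is the flow of $x'=\mathfrak c(\omega\cdot t)+\mathfrak d(\omega\cdot t)x+\mathfrak g(\omega\cdot t,x)+\lambda$, with global attractor $\bigcup_\omega\{\omega\}\times[\mathfrak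 l_\lambda(\omega),\mathfrak u_\lambda(\omega)]$. With $\mathfrak g^\mp:=\min/\max(0,\mathfrak g)$ and $\tau^\mp_\lambda$ the flows with $\mathfrak g$ replaced by $\mathfrak g^\mp$: $\lambda_-$ is such that $\tau^-_\lambda$ has an attractor–repeller pair of hyperbolic copies of the base $(\mathfrak a^-_\lambda,\mathfrak r^-_\lambda)$, $\mathfrak r^-_\lambda<\mathfrak a^-_\lambda$, exactly for $\lambda>\lambda_-$; $\lambda^+$ is such that $\tau^+_\lambda$ has an attractor–repeller pair $(\mathfrak a^+_\lambda,\mathfrak r^+_\lambda)$, $\mathfrak a^+_\lambda<\mathfrak r^+_\lambda$, exactly for $\lambda<\lambda^+$. Strict d-concavity band: $\alpha^*(\omega):=\inf\{x<0:\mathfrak g_x(\omega,\cdot)\text{ strictly concave on }[x,0]\}$ ($0$ if empty), $\beta^*(\omega):=\sup\{x>0:\mathfrak g_x(\omega,\cdot)\text{ strictly concave on }[0,x]\}$ ($0$ if empty), $\mathcal D^*_{\mathfrak g}:=\{(\omega,x):\alpha^*(\omega)\le x\le\beta^*(\omega)\}$; $\alpha,\beta,\mathcal D_{\mathfrak g}$ are defined identically with ''concave'' instead of ''strictly concave''. Continuous $\mathfrak b_1<\mathfrak b_2$ are jointly included in $\mathcal D^*_{\mathfrak g}$ if $m(\{\omega:[\mathfrak b_1(\omega),\mathfrak b_2(\omega)]\subseteq(\mathcal D_{\mathfrak g})_\omega\})=1$ and $m(\{\omega:[\mathfrak b_1(\omega),\mathfrak b_2(\omega)]\subseteq(\mathcal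 D^*_{\mathfrak g})_\omega\})>0$ for all $m\in\mathfrak M_{\rm erg}$ ($(\mathcal C)_\omega$ = $\omega$-fiber). Local saddle-node bifurcation as $\lambda\uparrow\xi$: there is $\delta>0$ such that for $\lambda\in(\xi-\delta,\xi)$ there are an attractive hyperbolic $\tau_\lambda$-copy of the base $\{\mathfrak a_\lambda\}$ and a repulsive one $\{\mathfrak r_\lambda\}$ with $\mathfrak a_\lambda<\mathfrak r_\lambda$, $\lambda\mapsto\mathfrak a_\lambda,-\mathfrak r_\lambda$ continuous (sup norm) and strictly increasing, whose pointwise limits as $\lambda\uparrow\xi$ are $\tau_\xi$-equilibria with $\inf_\omega(\mathfrak r_\xi-\mathfrak a_\xi)=0$; as $\lambda\downarrow\xi$: same for $\lambda\in(\xi,\xi+\delta)$ with $\mathfrak r_\lambda<\mathfrak a_\lambda$, $\lambda\mapsto\mathfrak a_\lambda,-\mathfrak r_\lambda$ strictly increasing, limits as $\lambda\downarrow\xi$ with $\inf_\omega(\mathfrak a_\xi-\mathfrak r_\xi)=0$. Hyperbolic copies of the base are graphs of continuous equilibria, uniformly exponentially attracting forward (attractive) or backward (repulsive) in a uniform neighborhood. *)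

(* Defs.v *)
From HB Require Import structures.
From mathcomp Require Import all_boot all_order all_algebra.
From mathcomp Require Import all_classical all_reals all_analysis.
Set Implicit Arguments. Unset Strict Implicit. Unset Printing Implicit Defensive.
Import Order.TTheory GRing.Theory Num.Theory.
Import numFieldNormedType.Exports.
Local Open Scope classical_set_scope.
Local Open Scope ring_scope.

Section Defs.
Context {R : realType} {Om : pseudoPMetricType R}.

Definition Borel (T : ptopologicalType) := g_sigma_algebraType (@open T).

Variable sigma : R -> Om -> Om.  (* omega . t = sigma t omega *)

Definition is_cont_flow : Prop :=
  continuous (fun p : R * Om => sigma p.1 p.2) /\
  (forall w, sigma 0 w = w) /\
  (forall s t w, sigma (s + t) w = sigma t (sigma s w)).

Definition ergodic (m : probability (Borel Om) R) : Prop :=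
  (forall (t : R) (A : set (Borel Om)), measurable A ->
      m (sigma t @^-1` A) = m A) /\
  (forall A : set (Borel Om), measurable A ->
      (forall t, sigma t @^-1` A = A) -> m A = 0%E \/ m A = 1%E).

(* m(S) > 0 (inner formulation, S need not be given as measurable) *)
Definition pos_meas (m : probability (Borel Om) R) (S : set Om) : Prop :=
  exists A : set (Borel Om), [/\ measurable A, A `<=` S & (0 < m A)%E].

Definition full_meas (m : probability (Borel Om) R) (S : set Om) : Prop :=
  {ae m, forall w : Borel Om, S w}.

Definition vf (c d : Om -> R) (G : Om -> R -> R) (lam : R) : Om -> R -> R :=
  fun w x => c w + d w * x + G w x + lam.

Definition is_sol (F : Om -> R -> R) (w : Om) (I : set R) (y : R -> R) :=
  forall t, I t -> is_derive t 1 y (F (sigma t w) (y t)).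

Definition equilibrium (F : Om -> R -> R) (b : Om -> R) : Prop :=
  forall w, is_sol F w setT (fun t => b (sigma t w)).

Definition attr_hyp_copy (F : Om -> R -> R) (b : Om -> R) : Prop :=
  continuous b /\ equilibrium F b /\
  exists k beta del : R, [/\ 1 <= k, 0 < beta, 0 < del &
    forall w x, `|x - b w| < del ->
      exists y : R -> R, [/\ y 0 = x,
        (exists eps, 0 < eps /\ is_sol F w [set t | - eps < t] y) &
        forall t, 0 <= t ->
          `|y t - b (sigma t w)| <= k * expR (- (beta * t)) * `|x - b w| ]].

Definition rep_hyp_copy (F : Om -> R -> R) (b : Om -> R) : Prop :=
  continuous b /\ equilibrium F b /\
  exists k beta del : R, [/\ 1 <= k, 0 < beta, 0 < del &
    forall w x, `|x - b w| < del ->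
      exists y : R -> R, [/\ y 0 = x,
        (exists eps, 0 < eps /\ is_sol F w [set t | t < eps] y) &
        forall t, t <= 0 ->
          `|y t - b (sigma t w)| <= k * expR (beta * t) * `|x - b w| ]].

Definition bdd_entire (F : Om -> R -> R) (w : Om) (x : R) : Prop :=
  exists y : R -> R, [/\ y 0 = x, is_sol F w setT y & exists M, forall t, `|y t| <= M].

(* fibers of the global attractor: [l(w), u(w)] *)
Definition att_low (F : Om -> R -> R) (w : Om) : R := inf [set x | bdd_entire F w x].
Definition att_up (F : Om -> R -> R) (w : Om) : R := sup [set x | bdd_entire F w x].

Definition saddle_node_up (F : R -> Om -> R -> R) (xi : R) : Prop :=
  exists del : R, 0 < del /\ exists a r : R -> Om -> R,
  [/\ (forall lam, xi - del < lam < xi ->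
         [/\ attr_hyp_copy (F lam) (a lam), rep_hyp_copy (F lam) (r lam)
           & forall w, a lam w < r lam w]),
      (forall lam0, xi - del < lam0 < xi -> forall e, 0 < e -> exists eta, 0 < eta /\
         forall lam, xi - del < lam < xi -> `|lam - lam0| < eta ->
           forall w, `|a lam w - a lam0 w| <= e /\ `|r lam w - r lam0 w| <= e),
      (forall l1 l2, xi - del < l1 -> l1 < l2 -> l2 < xi ->
         forall w, a l1 w < a l2 w /\ r l2 w < r l1 w) &
      exists axi rxi : Om -> R,
        [/\ forall w, (fun l => a l w) @ xi^'- --> axi w /\ (fun l => r l w) @ xi^'- --> rxi w,
            equilibrium (F xi) axi, equilibrium (F xi) rxi,
            (forall w, axi w <= rxi w) &
            (forall e, 0 < e -> exists w, rxi w - axi w < e)]].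

Definition saddle_node_down (F : R -> Om -> R -> R) (xi : R) : Prop :=
  exists del : R, 0 < del /\ exists a r : R -> Om -> R,
  [/\ (forall lam, xi < lam < xi + del ->
         [/\ attr_hyp_copy (F lam) (a lam), rep_hyp_copy (F lam) (r lam)
           & forall w, r lam w < a lam w]),
      (forall lam0, xi < lam0 < xi + del -> forall e, 0 < e -> exists eta, 0 < eta /\
         forall lam, xi < lam < xi + del -> `|lam - lam0| < eta ->
           forall w, `|a lam w - a lam0 w| <= e /\ `|r lam w - r lam0 w| <= e),
      (forall l1 l2, xi < l1 -> l1 < l2 -> l2 < xi + del ->
         forall w, a l1 w < a l2 w /\ r l2 w < r l1 w) &
      exists axi rxi : Om -> R,
        [/\ forall w, (fun l => a l w) @ xi^'+ --> axi w /\ (fun l => r l w) @ xi^'+ --> rxi w,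
            equilibrium (F xi) axi, equilibrium (F xi) rxi,
            (forall w, rxi w <= axi w) &
            (forall e, 0 < e -> exists w, axi w - rxi w < e)]].

End Defs.

Section Concavity.
Context {R : realType}.

Definition concave_on (f : R -> R) (I : set R) : Prop :=
  forall x y t, I x -> I y -> 0 <= t <= 1 ->
    t * f x + (1 - t) * f y <= f (t * x + (1 - t) * y).
Definition convex_on (f : R -> R) (I : set R) : Prop :=
  forall x y t, I x -> I y -> 0 <= t <= 1 ->
    f (t * x + (1 - t) * y) <= t * f x + (1 - t) * f y.
Definition strictly_concave_on (f : R -> R) (I : set R) : Prop :=
  forall x y t, I x -> I y -> x != y -> 0 < t < 1 ->
    t * f x + (1 - t) * f y < f (t * x + (1 - t) * y).
Definition strictly_decreasing_on (f : R -> R) (I : set R) : Prop :=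
  forall x y, I x -> I y -> x < y -> f y < f x.
Definition strictly_increasing_on (f : R -> R) (I : set R) : Prop :=
  forall x y, I x -> I y -> x < y -> f x < f y.

Definition cc (a b : R) : set R := [set x | a <= x <= b].

Definition gx {Om : Type} (g : Om -> R -> R) (w : Om) : R -> R := derive1 (g w).

Definition gminus {Om : Type} (g : Om -> R -> R) : Om -> R -> R :=
  fun w x => Num.min 0 (g w x).
Definition gplus {Om : Type} (g : Om -> R -> R) : Om -> R -> R :=
  fun w x => Num.max 0 (g w x).

(* left/right end of the (strict) d-concavity band, with value 0 if the
   defining set is empty; possibly -oo / +oo *)
Definition alpha_gen (P : (R -> R) -> set R -> Prop) {Om : Type}
    (g : Om -> R -> R) (w : Om) : \bar R :=
  let S := [set x | x < 0 /\ P (gx g w) (cc x 0)] in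
  if pselect (S = set0) then 0%E else ereal_inf (EFin @` S).
Definition beta_gen (P : (R -> R) -> set R -> Prop) {Om : Type}
    (g : Om -> R -> R) (w : Om) : \bar R :=
  let S := [set x | 0 < x /\ P (gx g w) (cc 0 x)] in
  if pselect (S = set0) then 0%E else ereal_sup (EFin @` S).

Definition alpha_star {Om : Type} := @alpha_gen strictly_concave_on Om.
Definition beta_star {Om : Type} := @beta_gen strictly_concave_on Om.
Definition alpha {Om : Type} := @alpha_gen concave_on Om.
Definition beta {Om : Type} := @beta_gen concave_on Om.

Definition Dg_fiber {Om : Type} (g : Om -> R -> R) (w : Om) : set R :=
  [set x | (alpha g w <= x%:E <= beta g w)%E].
Definition Dgstar_fiber {Om : Type} (g : Om -> R -> R) (w : Om) : set R :=
  [set x | (alpha_star g w <= x%:E <= beta_star g w)%E].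
End Concavity.

Definition jointly_included {R : realType} {Om : pseudoPMetricType R} (sigma : R -> Om -> Om)
    (g : Om -> R -> R) (b1 b2 : Om -> R) : Prop :=
  (forall w, b1 w < b2 w) /\
  forall m : probability (Borel Om) R, ergodic sigma m ->
    full_meas m [set w | cc (b1 w) (b2 w) `<=` Dg_fiber g w] /\
    pos_meas m [set w | cc (b1 w) (b2 w) `<=` Dgstar_fiber g w].

(* Main.v *)
Require Import Defs.
From HB Require Import structures.
From mathcomp Require Import all_boot all_order all_algebra.
From mathcomp Require Import all_classical all_reals all_analysis.
From mathcomp Require Import ring lra.
Set Implicit Arguments. Unset Strict Implicit. Unset Printing Implicit Defensive.
Import Order.TTheory GRing.Theory Num.Theory.
Import numFieldNormedType.Exports.
Local Open Scope classical_set_scope.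
Local Open Scope ring_scope.

Section Calculus.
Context {R : realType}.
Implicit Types (f g h y z df dg dz : R -> R) (t a b c e L T C eta : R).

Lemma derD f g t a b : is_derive t 1 f a -> is_derive t 1 g b ->
  is_derive t 1 (fun s => f s + g s) (a + b).
Proof. by move=> Hf Hg; apply: is_deriveD. Qed.

Lemma derB f g t a b : is_derive t 1 f a -> is_derive t 1 g b ->
  is_derive t 1 (fun s => f s - g s) (a - b).
Proof. by move=> Hf Hg; apply: is_deriveB. Qed.

Lemma derM f g t a b : is_derive t 1 f a -> is_derive t 1 g b ->
  is_derive t 1 (fun s => f s * g s) (a * g t + f t * b).
Proof.
move=> Hf Hg; apply: (is_derive_eq (is_deriveM Hf Hg)).
by rewrite /GRing.scale /= addrC; congr (_ + _); rewrite mulrC.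
Qed.

Lemma der_cst c t : is_derive t 1 (fun _ : R => c) (0 : R).
Proof. exact: is_derive_cst. Qed.

Lemma der_id t : is_derive t 1 (fun s : R => s) (1 : R).
Proof. exact: is_derive_id. Qed.

Lemma derMl f t c a : is_derive t 1 f a -> is_derive t 1 (fun s => c * f s) (c * a).
Proof.
move=> Hf; apply: (is_derive_eq (derM (der_cst c t) Hf)).
by rewrite mul0r add0r.
Qed.

Lemma der_comp f g t a b : is_derive (g t) 1 f a -> is_derive t 1 g b ->
  is_derive t 1 (fun s => f (g s)) (a * b).
Proof. exact: is_derive1_comp. Qed.

Lemma der_shift f t c a : is_derive (t + c) 1 f a -> is_derive t 1 (fun s => f (s + c)) a.
Proof.
move=> Hf; have Hg : is_derive t 1 (fun s : R => s + c) (1 + 0 : R).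
  exact: (derD (der_id t) (der_cst c t)).
by apply: (is_derive_eq (@der_comp f _ t _ _ Hf Hg)); rewrite addr0 mulr1.
Qed.

Lemma der_opp f t a : is_derive (- t) 1 f a -> is_derive t 1 (fun s => f (- s)) (- a).
Proof.
move=> Hf; have Hg : is_derive t 1 (fun s : R => - s) (-1 : R).
  by apply: is_derive_eq.
by apply: (is_derive_eq (@der_comp f _ t _ _ Hf Hg)); rewrite mulrN1.
Qed.

Lemma der_expM c t : is_derive t 1 (fun s => expR (c * s)) (c * expR (c * t)).
Proof.
have Hc := derMl c (der_id t).
by apply: (is_derive_eq (der_comp (is_derive_expR _) Hc)); rewrite mulr1 mulrC.
Qed.

Lemma der_ln f t a : 0 < f t -> is_derive t 1 f a ->
  is_derive t 1 (fun s => ln (f s)) (a / f t).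
Proof.
move=> f0 Hf; apply: (is_derive_eq (der_comp (is_derive1_ln f0) Hf)).
by rewrite mulrC.
Qed.

Lemma der_lnsqr f t a : f t != 0 -> is_derive t 1 f a ->
  is_derive t 1 (fun s => ln (f s * f s)) (2 * (a / f t)).
Proof.
move=> f0 Hf; have ff : 0 < f t * f t by rewrite -expr2 exprn_even_gt0.
by apply: (is_derive_eq (@der_ln (fun s => f s * f s) t _ ff (derM Hf Hf))); field.
Qed.

Lemma der_cont f t a : is_derive t 1 f a -> {for t, continuous f}.
Proof. by move=> [Hf _]; apply/differentiable_continuous/derivable1_diffP. Qed.

Lemma der_contT f df : (forall t, is_derive t 1 f (df t)) -> continuous f.
Proof. by move=> Hf t; exact: der_cont (Hf t). Qed.

Lemma der_near f g t a : (\forall s \near t, f s = g s) -> is_derive t 1 f a ->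
  is_derive t 1 g a.
Proof. exact: near_eq_is_derive. Qed.

Lemma der_derive1 f t : derivable f t 1 -> is_derive t 1 f (derive1 f t).
Proof. by move=> Hf; rewrite derive1E; exact: derivableP. Qed.

Lemma MVT_der f df a b : a <= b ->
  (forall t, a <= t <= b -> is_derive t 1 f (df t)) ->
  exists2 c, a <= c <= b & f b - f a = df c * (b - a).
Proof.
move=> ab Hf; have [|//|c cab e] := @MVT_segment R f df a b ab.
- by move=> x /[!in_itv]/= /andP[/ltW ? /ltW ?]; apply: Hf; apply/andP.
- apply: derivable_within_continuous => x /[!in_itv]/= xab.
  by have [] := Hf _ xab.
- by exists c => //; move: cab; rewrite in_itv.
Qed.

Lemma der_nondecr f df a b : a <= b ->
  (forall t, a <= t <= b -> is_derive t 1 f (df t)) ->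
  (forall t, a <= t <= b -> 0 <= df t) -> f a <= f b.
Proof.
move=> ab Hf H0; have [c cab e] := MVT_der ab Hf.
by rewrite -subr_ge0 e mulr_ge0 ?subr_ge0 ?H0.
Qed.

Lemma der_le f df g dg a b : a <= b ->
  (forall t, a <= t <= b -> is_derive t 1 f (df t)) ->
  (forall t, a <= t <= b -> is_derive t 1 g (dg t)) ->
  (forall t, a <= t <= b -> df t <= dg t) -> f b - f a <= g b - g a.
Proof.
move=> ab Hf Hg H0.
have := @der_nondecr (fun t => g t - f t) (fun t => dg t - df t) a b ab.
have H1 t : a <= t <= b -> is_derive t 1 (fun t0 => g t0 - f t0) (dg t - df t).
  by move=> tab; exact: (derB (Hg _ tab) (Hf _ tab)).
have H2 t : a <= t <= b -> 0 <= dg t - df t by move=> tab; rewrite subr_ge0 H0.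
by move=> /(_ H1 H2); lra.
Qed.

Lemma der_bound f df a b C : a <= b ->
  (forall t, a <= t <= b -> is_derive t 1 f (df t)) ->
  (forall t, a <= t <= b -> `|df t| <= C) -> `|f b - f a| <= C * (b - a).
Proof.
move=> ab Hf H0; have [c cab ->] := MVT_der ab Hf.
by rewrite normrM (ger0_norm (_ : 0 <= b - a)) ?subr_ge0// ler_wpM2r ?subr_ge0 ?H0.
Qed.

Lemma der_bound_abs f df a b C : 
  (forall t, is_derive t 1 f (df t)) ->
  (forall t, `|df t| <= C) -> `|f b - f a| <= C * `|b - a|.
Proof.
move=> Hf H0; wlog ab : a b / a <= b => [H|].
  by case: (leP a b) => [/H//|/ltW/H]; rewrite distrC (distrC a).
have -> : `|b - a| = b - a by rewrite ger0_norm ?subr_ge0.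
exact: (@der_bound f df a b C ab).
Qed.

Lemma gronwall_sqr z dz L e T : 0 <= L -> 0 <= T ->
  (forall t, 0 <= t <= T -> is_derive t 1 z (dz t)) ->
  (forall t, 0 <= t <= T -> `|dz t| <= L * `|z t| + e) ->
  z T * z T <= (z 0 * z 0 + e * e * T) * expR ((2 * L + 1) * T).
Proof.
move=> L0 T0 Hz Hb; set c := 2 * L + 1.
have c0 : 0 <= c by rewrite /c; lra.
pose v t := z t * z t * expR (- c * t) - e * e * t.
pose dv t := (dz t * z t + z t * dz t) * expR (- c * t)
   + z t * z t * (- c * expR (- c * t)) - e * e * 1.
have Hv t : 0 <= t <= T -> is_derive t 1 v (dv t).
  move=> tT; have Hzt := Hz t tT.
  exact: (derB (derM (derM Hzt Hzt) (der_expM _ _)) (derMl _ (der_id t))).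
have := @der_nondecr (fun t => - v t) (fun t => - dv t) 0 T T0.
have H1 t : 0 <= t <= T -> is_derive t 1 (fun s => - v s) (- dv t).
  by move=> tT; apply: is_deriveN; exact: Hv.
move=> /(_ H1).
have Hd : forall t, 0 <= t <= T -> 0 <= - dv t.
  move=> t tT; rewrite /dv.
  have E0 : 0 < expR (- c * t) by exact: expR_gt0.
  have E1 : expR (- c * t) <= 1.
    by rewrite -expR0 ler_expR; case/andP: tT => ? _; rewrite mulNr oppr_le0 mulr_ge0.
  have {}Hb := Hb t tT.
  have H2 : dz t * z t <= L * (z t * z t) + e * `|z t|.
    apply: (le_trans (ler_norm _)); rewrite normrM.
    apply: (le_trans (ler_wpM2r (normr_ge0 _) Hb)).
    by rewrite mulrDl -mulrA -normrM (ger0_norm (_ : 0 <= z t * z t)) // -expr2 sqr_ge0.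
  have H3 : 2 * (e * `|z t|) <= z t * z t + e * e.
    have -> : z t * z t = `|z t| * `|z t|.
      by rewrite -normrM ger0_norm // -expr2 sqr_ge0.
    have := sqr_ge0 (`|z t| - e); nra.
  have H4 : (dz t * z t + z t * dz t) - c * (z t * z t) <= e * e.
    by rewrite /c; lra.
  have H5 : ((dz t * z t + z t * dz t) - c * (z t * z t)) * expR (- c * t) <= e * e.
    apply: (le_trans (ler_wpM2r (ltW E0) H4)).
    by rewrite ler_piMr // -expr2 sqr_ge0.
  lra.
move=> /(_ Hd); rewrite /v !mulr0 expR0 subr0 mulr1 => H.
have H6 : z T * z T * expR (- c * T) <= z 0 * z 0 + e * e * T by lra.
have E0 : 0 < expR (c * T) by exact: expR_gt0.
have := ler_wpM2r (ltW E0) H6.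
by rewrite -[X in X <= _ -> _]mulrA -expRD mulNr addNr expR0 mulr1.
Qed.

(* The last zero before a negative value, where the differential inequality becomes linear. *)
Lemma nonneg_invariant z dz L T : 0 <= L -> 0 <= T ->
  (forall t, 0 <= t <= T -> is_derive t 1 z (dz t)) ->
  (forall t, 0 <= t <= T -> - L * `|z t| <= dz t) -> 0 <= z 0 -> 0 <= z T.
Proof.
move=> L0 T0 Hz Hb z0; rewrite leNgt; apply/negP => zT.
pose S := [set t | 0 <= t <= T /\ 0 <= z t].
have S0 : S 0 by split => //; rewrite lexx T0.
have SupS : has_sup S by split; [exists 0|exists T => t [/andP[]]].
set s := sup S.
have s0 : 0 <= s by apply: ub_le_sup => //; case: SupS.
have sT : s <= T by apply: ge_sup; [exists 0|move=> t [/andP[]]].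
have zcont t : 0 <= t <= T -> {for t, continuous z}.
  by move=> tT; exact: der_cont (Hz _ tT).
have zneg t : s < t -> t <= T -> z t < 0.
  move=> st tT; rewrite ltNge; apply/negP => zt.
  have : S t by split => //; rewrite tT (le_trans s0 (ltW st)).
  by move=> /(ub_le_sup (proj2 SupS)); rewrite leNgt st.
have zs : 0 <= z s.
  rewrite leNgt; apply/negP => zs.
  have sT' : 0 <= s <= T by rewrite s0 sT.
  have : \forall t \near s, z t < 0.
    by have := zcont s sT'; move=> /cvgr_lt; exact.
  move=> /nbhs_ballP[e /= e0 He].
  have [t St] := sup_adherent e0 SupS.
  have ts : t <= s by apply: ub_le_sup => //; case: SupS.
  move=> ets; have /= : z t < 0.
    by apply: He; rewrite /ball /= ger0_norm ?subr_ge0//; move: ets; rewrite -/s; lra.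
  by case: St => _; rewrite leNgt => /negbTE ->.
have sT2 : s < T.
  by rewrite lt_neqAle sT andbT; apply: contraTN zT => /eqP <-; rewrite -leNgt.
pose v t := z t * expR (- L * t).
pose dv t := dz t * expR (- L * t) + z t * (- L * expR (- L * t)).
have := @der_nondecr v dv s T sT.
have H1 t : s <= t <= T -> 0 <= t <= T.
  by move=> /andP[a1 a2]; rewrite a2 (le_trans s0 a1).
have H2 t : s <= t <= T -> is_derive t 1 v (dv t).
  by move=> /H1 tT; exact: (derM (Hz t tT) (der_expM _ _)).
move=> /(_ H2).
have Hd : forall t, s <= t <= T -> 0 <= dv t.
  move=> t /[dup] tsT /H1 tT.
  have -> : dv t = (dz t - L * z t) * expR (- L * t) by rewrite /dv; ring.
  rewrite mulr_ge0 ?expR_ge0 // subr_ge0.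
  have := Hb t tT.
  suff zt : z t <= 0 by rewrite (ler0_norm zt); lra.
  case/andP: tsT => st tT'; move: st; rewrite le_eqVlt => /orP[/eqP <-|st]; last exact/ltW/zneg.
  rewrite leNgt; apply/negP => zs'.
  have sT' : 0 <= s <= T by rewrite s0 sT.
  have := zcont s sT'; move=> /cvgr_gt/(_ _ zs').
  move=> /nbhs_ballP[e /= e0 He].
  have m0 : 0 < Num.min (e / 2) (T - s) by rewrite lt_min divr_gt0 //= subr_gt0.
  have m1 : Num.min (e / 2) (T - s) <= e / 2 by rewrite ge_min lexx.
  have m2 : Num.min (e / 2) (T - s) <= T - s by rewrite ge_min lexx orbT.
  set q := Num.min _ _ in m0 m1 m2.
  have : 0 < z (s + q).
    by apply: He; rewrite /ball /= opprD addrA subrr sub0r normrN gtr0_norm //; lra.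
  by rewrite ltNge ltW // zneg; lra.
move=> /(_ Hd); rewrite /v => H.
have : z T * expR (- L * T) < 0 by rewrite pmulr_llt0 ?expR_gt0.
have : 0 <= z s * expR (- L * s) by rewrite mulr_ge0 ?expR_ge0.
by lra.
Qed.

Lemma gain_forward z dz L eta T : 0 <= L -> 0 <= T -> 0 <= eta ->
  (forall t, 0 <= t <= T -> is_derive t 1 z (dz t)) ->
  (forall t, 0 <= t <= T -> - L * `|z t| + eta <= dz t) -> 0 <= z 0 ->
  eta * (T * expR (- L * T)) <= z T.
Proof.
move=> L0 T0 eta0 Hz Hb z0; rewrite -subr_ge0.
pose c t := eta * (t * expR (- L * t)).
pose dc t := eta * (1 * expR (- L * t) + t * (- L * expR (- L * t))).
have Hc t : is_derive t 1 c (dc t).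
  exact: (derMl _ (derM (der_id t) (der_expM _ _))).
apply: (@nonneg_invariant (fun t => z t - c t) (fun t => dz t - dc t) L T) => //.
- by move=> t tT; exact: (derB (Hz _ tT) (Hc _)).
- move=> t tT; have := Hb t tT.
  have c0 : 0 <= c t.
    by case/andP: tT => t0 _; rewrite /c !mulr_ge0 ?expR_ge0.
  have -> : dc t = eta * expR (- L * t) - L * c t by rewrite /dc /c; ring.
  have E1 : expR (- L * t) <= 1.
    by rewrite -expR0 ler_expR; case/andP: tT => ? _; rewrite mulNr oppr_le0 mulr_ge0.
  have : eta * expR (- L * t) <= eta by rewrite ler_piMr.
  have : `|z t| <= `|z t - c t| + c t.
    by have := ler_normD (z t - c t) (c t); rewrite subrK (ger0_norm c0).
  by nra.
- by rewrite /c mul0r mulr0 subr0.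
Qed.

End Calculus.

Section Primitive.
Context {R : realType}.

Lemma integral_der (h : R -> R) (a x : R) : continuous h -> a < x ->
  is_derive x 1 (fun u => \int[lebesgue_measure]_(t in `[a, u]) h t)%R (h x).
Proof.
move=> ch ax.
have xu : x < x + 1 by rewrite ltrDl.
have hI : lebesgue_measure.-integrable `[a, x + 1] (EFin \o h).
  apply: continuous_compact_integrable; first exact: segment_compact.
  by apply: continuous_subspaceT.
have [|H1 H2] := continuous_FTC1_closed xu hI ax; first exact: ch.
by split; [exact: H1|rewrite -derive1E; exact: H2].
Qed.

Lemma eq_primitive (f g h : R -> R) (a b x : R) : a <= 0 -> 0 <= b -> a <= x <= b ->
  (forall t, a <= t <= b -> is_derive t 1 f (h t)) ->
  (forall t, a <= t <= b -> is_derive t 1 g (h t)) -> f 0 = g 0 -> f x = g x.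
Proof.
move=> a0 b0 /andP[ax xb] Hf Hg e.
have Hd (t : R) : a <= t <= b -> is_derive t 1 (fun s => f s - g s) 0.
  by move=> tab; apply: (is_derive_eq (derB (Hf t tab) (Hg t tab))); rewrite subrr.
apply/eqP; rewrite -subr_eq0; apply/eqP.
case: (leP 0 x) => x0.
  have [|c _] := @MVT_der R (fun s => f s - g s) (fun=> 0) 0 x x0.
    by move=> t /andP[t0 tx]; apply: Hd; apply/andP; split; [exact: le_trans t0|exact: le_trans xb].
  by rewrite e mul0r subrr subr0.
have [|c _] := @MVT_der R (fun s => f s - g s) (fun=> 0) x 0 (ltW x0).
  by move=> t /andP[t0 tx]; apply: Hd; apply/andP; split; [exact: le_trans t0|exact: le_trans b0].
by rewrite e mul0r subrr sub0r => /eqP; rewrite oppr_eq0 => /eqP.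
Qed.

Lemma primitive_exists (h : R -> R) : continuous h ->
  exists P : R -> R, P 0 = 0 /\ forall t : R, is_derive t 1 P (h t).
Proof.
move=> ch.
pose F a u := (\int[lebesgue_measure]_(t in `[a, u]) h t)%R.
pose Q a u := F a u - F a 0.
have Qd (a x : R) : a < x -> is_derive x 1 (Q a) (h x).
  move=> ax; apply: (is_derive_eq (derB (integral_der ch ax) (der_cst (F a 0) x))).
  by rewrite subr0.
have QE (a a' x : R) : a < 0 -> a' < 0 -> a < x -> a' < x -> Q a x = Q a' x.
  move=> a0 a'0 ax a'x.
  have b1 : Num.min 0 x <= 0 by rewrite ge_min lexx.
  have b2 : 0 <= Num.max 0 x by rewrite le_max lexx.
  apply: (@eq_primitive (Q a) (Q a') h (Num.min 0 x) (Num.max 0 x) x) => //.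
  - by rewrite ge_min le_max lexx !orbT.
  - by move=> t /andP[+ _] => mt; apply: Qd; apply: lt_le_trans mt; rewrite lt_min a0.
  - by move=> t /andP[+ _] => mt; apply: Qd; apply: lt_le_trans mt; rewrite lt_min a'0.
  - by rewrite /Q !subrr.
exists (fun t => Q (- `|t| - 1) t); split; first by rewrite /Q subrr.
move=> t; pose a : R := - `|t| - 2.
have n0 (s : R) := normr_ge0 s.
have ns (s : R) : - `|s| <= s by rewrite lerNl -normrN ler_norm.
have aN : a < t by rewrite /a; have := ns t; lra.
apply: (der_near _ (Qd a t aN)); near=> s.
have st : `|t - s| < 1 by near: s; exists 1 => //=.
have := n0 s; have := ns s; have := n0 t => *.
have : `|s| <= `|t| + `|t - s| by rewrite distrC -[X in `|X|](subrK t) addrC; exact: ler_normD.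
move=> ?; apply: QE; rewrite /a; lra.
Unshelve. all: by end_near. Qed.

Definition prim (h : R -> R) : R -> R :=
  if pselect (continuous h) is left ch then sval (cid (primitive_exists ch)) else (fun=> 0).

Lemma prim0 h : continuous h -> prim h 0 = 0.
Proof. by rewrite /prim; case: pselect => // c _; case: cid => P []. Qed.

Lemma prim_der h (t : R) : continuous h -> is_derive t 1 (prim h) (h t).
Proof. by rewrite /prim; case: pselect => // c _; case: cid => P []. Qed.

End Primitive.

Section Picard.
Context {R : realType}.

Lemma ler_half_pow (a b C : R) : (forall n, a <= b + C * (2^-1) ^+ n) -> a <= b.
Proof.
move=> H; rewrite leNgt; apply/negP => ba.
have C0 : 0 < C by have := H 0%N; rewrite expr0 mulr1; lra.
have : \forall n \near \oo, `|(2^-1 : R) ^+ n| < (a - b) / C.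
  have /cvgr0_norm_lt := @cvg_expr R 2^-1 (ltac:(rewrite ger0_norm; lra)).
  by apply; rewrite divr_gt0 // subr_gt0.
case=> n _ /(_ n (leqnn _)) /=; rewrite ger0_norm ?exprn_ge0 // ltr_pdivlMr //.
by have := H n; lra.
Qed.

Lemma half_cauchy (x : nat -> R) (C : R) : 
  (forall n, `|x n.+1 - x n| <= C * (2^-1) ^+ n) ->
  exists l, forall n, `|l - x n| <= 2 * C * (2^-1) ^+ n.
Proof.
move=> H; pose r n : R := 2 * C * (2^-1) ^+ n.
have rS n : r n = r n.+1 + C * (2^-1) ^+ n by rewrite /r exprS; lra.
have incr n m : x n - r n <= x (n + m)%N - r (n + m)%N.
  elim: m => [|m IH]; first by rewrite addn0.
  apply: (le_trans IH); rewrite addnS; have := H (n + m)%N; rewrite ler_norml rS.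
  by move=> /andP[]; lra.
have decr n m : x (n + m)%N + r (n + m)%N <= x n + r n.
  elim: m => [|m IH]; first by rewrite addn0.
  apply: le_trans IH; rewrite addnS; have := H (n + m)%N; rewrite ler_norml (rS (n+m)%N).
  by move=> /andP[]; lra.
have C0 : 0 <= C by have := H 0%N; rewrite expr0 mulr1; apply: le_trans.
have r0 n : 0 <= r n by rewrite /r !mulr_ge0 // exprn_ge0.
have cross n m : x n - r n <= x m + r m.
  apply: (le_trans (incr n m)); apply: le_trans (decr m n); rewrite addnC.
  by have := r0 (m + n)%N; lra.
exists (sup [set x n - r n | n in setT]) => n.
have hs : has_sup [set x n - r n | n in setT].
  by split; [exists (x 0%N - r 0%N); exists 0%N|exists (x 0%N + r 0%N) => _ [k _ <-]].
have h1 : x n - r n <= sup [set x n - r n | n in setT].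
  by apply: ub_le_sup; [case: hs|exists n].
have h2 : sup [set x n - r n | n in setT] <= x n + r n.
  by apply: ge_sup; [case: hs|move=> _ [k _ <-]].
by rewrite ler_norml; apply/andP; split; move: h1 h2; rewrite /r; lra.
Qed.

Lemma exp_growth (u du : R -> R) (c C : R) : 0 <= C ->
  (forall t : R, is_derive t 1 u (du t)) -> u 0 = 0 ->
  (forall t, `|du t| <= c * C * expR (c * `|t|)) -> forall t, `|u t| <= C * expR (c * `|t|).
Proof.
move=> C0.
suff H : forall u du : R -> R, (forall t : R, is_derive t 1 u (du t)) -> u 0 = 0 ->
  (forall t, `|du t| <= c * C * expR (c * `|t|)) ->
  forall t, 0 <= t -> `|u t| <= C * expR (c * `|t|).
  move=> Hu u0 Hb t; case: (leP 0 t) => t0; first exact: (H u du).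
  have := H (fun s => u (- s)) (fun s => - du (- s)) (fun s => der_opp (Hu (- s))).
  rewrite oppr0 => /(_ u0) /(_ _ (- t)); rewrite opprK normrN; apply.
    by move=> s; rewrite normrN -(normrN s).
  by rewrite oppr_ge0 ltW.
move=> {}u {}du Hu u0 Hb t t0.
have Hg (s : R) : is_derive s 1 (fun s => C * expR (c * s)) (C * (c * expR (c * s))).
  exact: derMl _ (der_expM _ _).
have H1 : u t - u 0 <= C * expR (c * t) - C * expR (c * 0).
  apply: (@der_le R u du _ (fun s => C * (c * expR (c * s))) 0 t t0) => //.
  move=> s /andP[s0 _]; apply: (le_trans (ler_norm _)); apply: (le_trans (Hb s)).
  by rewrite ger0_norm // le_eqVlt; apply/orP; left; apply/eqP; ring.
have H2 : - u t - - u 0 <= C * expR (c * t) - C * expR (c * 0).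
  apply: (@der_le R (fun s => - u s) (fun s => - du s) _ (fun s => C * (c * expR (c * s))) 0 t t0) => //.
  move=> s /andP[s0 _]; apply: (le_trans (ler_norm _)); rewrite normrN; apply: (le_trans (Hb s)).
  by rewrite ger0_norm // le_eqVlt; apply/orP; left; apply/eqP; ring.
move: H1 H2; rewrite mulr0 expR0 u0 (ger0_norm t0) ler_norml => H1 H2.
by apply/andP; split; lra.
Qed.

Variables (H : R -> R -> R) (B L : R).
Hypothesis Hcont : forall y : R -> R, continuous y -> continuous (fun t => H t (y t)).
Hypothesis HB : forall t x, `|H t x| <= B.
Hypothesis L1 : 1 <= L.
Hypothesis HL : forall t x y, `|H t x - H t y| <= L * `|x - y|.

Fixpoint picard (x0 : R) (n : nat) : R -> R :=
  if n is m.+1 then fun t => x0 + prim (fun s => H s (picard x0 m s)) t else fun=> x0.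

Lemma picard_cont x0 n : continuous (picard x0 n).
Proof.
elim: n => [|n IH] /=; first by move=> t; exact: cvg_cst.
by apply: (@der_contT R _ (fun t => 0 + H t (picard x0 n t))) => t;
  exact: (derD (der_cst x0 t) (prim_der t (Hcont IH))).
Qed.

Lemma picard_der x0 n (t : R) : is_derive t 1 (picard x0 n.+1) (H t (picard x0 n t)).
Proof.
apply: (is_derive_eq (derD (der_cst x0 t) (prim_der t (Hcont (@picard_cont x0 n))))).
by rewrite add0r.
Qed.

Lemma picard0 x0 n : picard x0 n 0 = x0.
Proof. by case: n => //= n; rewrite prim0 ?addr0 //; exact/Hcont/picard_cont. Qed.

Lemma bound_ge0 : 0 <= B.
Proof. exact: le_trans (HB 0 0). Qed.

Lemma picard_lip x0 n s t : `|picard x0 n s - picard x0 n t| <= B * `|s - t|.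
Proof.
case: n => [|n]; first by rewrite /= subrr normr0 mulr_ge0 // bound_ge0.
exact: (@der_bound_abs R _ _ t s B (@picard_der x0 n) (fun t => HB t _)).
Qed.

Lemma picard_step x0 n t :
  `|picard x0 n.+1 t - picard x0 n t| <= B * expR (2 * L * `|t|) * (2^-1) ^+ n.
Proof.
elim: n t => [|n IH] t.
  have -> : picard x0 0 t = picard x0 1 0 by rewrite picard0.
  rewrite expr0 mulr1; apply: (le_trans (picard_lip _ _ _ _)); rewrite subr0.
  apply: ler_wpM2l; first exact: bound_ge0.
  have := expR_ge1Dx (2 * L * `|t|); have : `|t| <= L * `|t| by rewrite ler_peMl.
  by have := normr_ge0 t; lra.
rewrite mulrAC.
apply: (@exp_growth (fun t => picard x0 n.+2 t - picard x0 n.+1 t)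
  (fun t => H t (picard x0 n.+1 t) - H t (picard x0 n t)) (2 * L) (B * 2^-1 ^+ n.+1)).
- by rewrite mulr_ge0 ?bound_ge0 ?exprn_ge0.
- by move=> s; exact: (derB (picard_der _ _ _) (picard_der _ _ _)).
- by rewrite !picard0 subrr.
- move=> s; apply: (le_trans (HL _ _ _)).
  have := ler_wpM2l (le_trans ler01 L1) (IH s) => {}IH; apply: (le_trans IH).
  by rewrite exprS le_eqVlt; apply/orP; left; apply/eqP; field.
Qed.

Lemma picard_exists x0 : exists y : R -> R, y 0 = x0 /\
  forall t : R, is_derive t 1 y (H t (y t)).
Proof.
have /choice[y Hy] : forall t, exists l, forall n,
   `|l - picard x0 n t| <= 2 * (B * expR (2 * L * `|t|)) * (2^-1) ^+ n.
  by move=> t; exact: half_cauchy (fun n => picard_step x0 n t).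
have ylip s t : `|y s - y t| <= B * `|s - t|.
  apply: (@ler_half_pow _ _ (2 * (B * expR (2 * L * `|s|)) + 2 * (B * expR (2 * L * `|t|)))).
  move=> n; have := Hy s n; have := Hy t n; have := picard_lip x0 n s t.
  have := ler_distD (picard x0 n s) (y s) (y t).
  have := ler_distD (picard x0 n t) (picard x0 n s) (y t).
  by rewrite (distrC (picard x0 n t) (y t)) mulrDl; lra.
have ycont : continuous y.
  move=> t; apply/cvgrPdist_le => /= e e0.
  have B1 : 0 < B + 1 by have := bound_ge0; lra.
  near=> s; apply: (le_trans (ylip _ _)).
  have : `|t - s| <= e / (B + 1) by near: s; apply: cvgr_dist_le => //; rewrite divr_gt0.
  rewrite ler_pdivlMr //; have := normr_ge0 (t - s); lra.
pose P t := x0 + prim (fun s => H s (y s)) t.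
have Pd (t : R) : is_derive t 1 P (H t (y t)).
  apply: (is_derive_eq (derD (der_cst x0 t) (prim_der t (Hcont ycont)))).
  by rewrite add0r.
have P0 : P 0 = x0 by rewrite /P prim0 ?addr0 //; exact: Hcont.
have PE n t : `|P t - picard x0 n.+1 t| <= B * (2^-1) ^+ n * expR (2 * L * `|t|).
  apply: (@exp_growth (fun t => P t - picard x0 n.+1 t) (fun t => H t (y t) - H t (picard x0 n t))).
  - by rewrite mulr_ge0 ?bound_ge0 ?exprn_ge0.
  - by move=> s; exact: (derB (Pd _) (picard_der _ _ _)).
  - by rewrite picard0 P0 subrr.
  - move=> s; apply: (le_trans (HL _ _ _)).
    have := ler_wpM2l (le_trans ler01 L1) (Hy s n) => {}IH; apply: (le_trans IH).
    by rewrite le_eqVlt; apply/orP; left; apply/eqP; ring.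
have yP t : y t = P t.
  apply/eqP; rewrite -subr_eq0 -normr_le0.
  apply: (@ler_half_pow _ _ (3 * (B * expR (2 * L * `|t|)))) => n; rewrite add0r.
  have := ler_distD (picard x0 n.+1 t) (y t) (P t); rewrite (distrC (picard x0 n.+1 t)).
  have := Hy t n.+1; have := PE n t.
  set E := B * expR _; have -> : B * 2^-1 ^+ n * expR (2 * L * `|t|) = E * 2^-1 ^+ n by rewrite /E; ring.
  rewrite exprS; have : 0 <= E * 2^-1 ^+ n.
    by rewrite !mulr_ge0 ?expR_ge0 ?bound_ge0 ?exprn_ge0.
  by set p := 2^-1 ^+ n; rewrite (_ : 2 * E * (2^-1 * p) = E * p); [lra|field].
exists P; split => // t; rewrite -yP; exact: Pd.
Unshelve. all: by end_near. Qed.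

Lemma ode_unique (y1 y2 : R -> R) :
  (forall t : R, is_derive t 1 y1 (H t (y1 t))) -> (forall t : R, is_derive t 1 y2 (H t (y2 t))) ->
  y1 0 = y2 0 -> forall t, y1 t = y2 t.
Proof.
move=> H1 H2 e t; apply/eqP; rewrite -subr_eq0 -sqrf_eq0 eq_le sqr_ge0 andbT expr2.
have L0 : 0 <= L := le_trans ler01 L1.
case: (leP 0 t) => t0.
  have := @gronwall_sqr R (fun s => y1 s - y2 s) (fun s => H s (y1 s) - H s (y2 s)) L 0 t L0 t0
    (fun s _ => derB (H1 s) (H2 s)).
  have Hb : forall s, 0 <= s <= t -> `|H s (y1 s) - H s (y2 s)| <= L * `|y1 s - y2 s| + 0.
    by move=> s _; rewrite addr0.
  by move=> /(_ Hb); rewrite e subrr !mul0r addr0 mul0r.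
have nt0 : 0 <= - t by rewrite oppr_ge0 ltW.
have := @gronwall_sqr R (fun s => y1 (- s) - y2 (- s)) (fun s => - (H (- s) (y1 (- s))) - - H (- s) (y2 (- s))) L 0 (- t) L0 nt0
    (fun s _ => derB (der_opp (H1 (- s))) (der_opp (H2 (- s)))).
have Hb : forall s, 0 <= s <= - t -> `|- (H (- s) (y1 (- s))) - - H (- s) (y2 (- s))| <= L * `|y1 (- s) - y2 (- s)| + 0.
  by move=> s _; rewrite addr0 -opprD normrN.
by move=> /(_ Hb); rewrite opprK oppr0 e subrr !mul0r addr0 mul0r.
Qed.

End Picard.

Section Uniformity.
Context {R : realType}.

Lemma near_uniform (X Y : topologicalType) (G : X * Y -> R) (K : set Y) (x0 : X) (e : R) :
  compact K -> continuous G -> 0 < e ->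
  \forall x \near x0, forall y, K y -> `|G (x, y) - G (x0, y)| <= e.
Proof.
move=> cK cG e0.
have e2 : 0 < e / 2 by rewrite divr_gt0.
have /compact_near_coveringP/(_ X (nbhs x0) (fun x y => `|G (x, y) - G (x0, y)| <= e)) := cK.
apply.
move=> y Ky.
have := cG (x0, y) => /cvgrPdist_lt/(_ _ e2).
case=> -[U V] /= [nU nV] UV.
exists (V, U) => //= -[y' x] /= [Vy' Ux].
have H1 := UV (x, y') (conj Ux Vy').
have H2 := UV (x0, y') (conj (nbhs_singleton nU) Vy').
rewrite /= in H1 H2.
have := ler_distD (G (x0, y)) (G (x, y')) (G (x0, y')).
rewrite (distrC (G (x, y')) (G (x0, y))); lra.
Qed.

Lemma compact_bounded (X : topologicalType) (f : X -> R) : compact [set: X] -> continuous f ->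
  exists C, 0 <= C /\ forall x, `|f x| <= C.
Proof.
move=> cX cf.
case: (pselect (exists x : X, True)) => [[x0 _]|nX]; last first.
  by exists 0; split=> // x; exfalso; apply: nX; exists x.
have cn : continuous (fun x => `|f x|).
  by move=> x; apply: cvg_norm; exact: cf.
have [|||c _ Hc] := @compact_EVT_max X R (fun x => `|f x|) setT.
- by exists x0.
- exact: cX.
- exact: continuous_subspaceT.
- by exists `|f c|; split=> // x; apply: Hc; rewrite inE.
Qed.

Lemma compact_bounded2 (X : topologicalType) (f : X * R -> R) (K : R) :
  compact [set: X] -> continuous f ->
  exists C, 0 <= C /\ forall x y, - K <= y <= K -> `|f (x, y)| <= C.
Proof.
move=> cX cf.
case: (pselect (exists p : X * R, ([set: X] `*` `[- K, K]%classic) p)) => [ne|nX]; last first.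
  exists 0; split=> // x y yK; exfalso; apply: nX; exists (x, y).
  by split=> //; rewrite /= in_itv.
have cn : continuous (fun x => `|f x|).
  by move=> x; apply: cvg_norm; exact: cf.
have [|||c _ Hc] := @compact_EVT_max _ R (fun x => `|f x|) ([set: X] `*` `[- K, K]%classic).
- by case: ne => p; exists p.
- by apply: compact_setX => //; exact: segment_compact.
- exact: continuous_subspaceT.
- exists `|f c|; split=> // x y yK; apply: Hc; rewrite inE.
  by split=> //; rewrite /= in_itv.
Qed.

Lemma gronwall_abs (z dz : R -> R) (L e T : R) : 0 <= L -> 0 <= T -> 0 <= e ->
  (forall t : R, is_derive t 1 z (dz t)) ->
  (forall t : R, `|t| <= T -> `|dz t| <= L * `|z t| + e) -> `|z 0| <= e ->
  forall t, `|t| <= T -> `|z t| <= e * ((1 + T) * expR ((2 * L + 1) * T)).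
Proof.
move=> L0 T0 e0.
suff H : forall z dz : R -> R, (forall t : R, is_derive t 1 z (dz t)) ->
  (forall t : R, `|t| <= T -> `|dz t| <= L * `|z t| + e) -> `|z 0| <= e ->
  forall t, 0 <= t <= T -> `|z t| <= e * ((1 + T) * expR ((2 * L + 1) * T)).
  move=> Hz Hd z0 t tT; case: (leP 0 t) => t0.
    by apply: (H z dz) => //; rewrite t0 -(ger0_norm t0).
  have := H (fun s => z (- s)) (fun s => - dz (- s)) (fun s => der_opp (Hz (- s))).
  rewrite oppr0 => /(_ _ z0 (- t)); rewrite opprK; apply.
    by move=> s sT; rewrite normrN; apply: Hd; rewrite normrN.
  by move: tT; rewrite ltr0_norm // oppr_ge0 (ltW t0) => ->.
move=> {}z {}dz Hz Hd z0 t /andP[t0 tT].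
set C := (1 + T) * _.
have E1 s : 0 <= s -> 1 <= expR ((2 * L + 1) * s).
  by move=> s0; rewrite -[X in X <= _]expR0 ler_expR mulr_ge0 //; lra.
have C1 : 1 <= C by have := E1 T T0; rewrite /C; nra.
have G : z t * z t <= (z 0 * z 0 + e * e * t) * expR ((2 * L + 1) * t).
  apply: (@gronwall_sqr R z dz L e t L0 t0) => s /andP[s0 st].
  by apply: Hd; rewrite ger0_norm // (le_trans st).
rewrite -(@ler_pXn2r R 2) ?nnegrE // ?mulr_ge0 //; last by lra.
have -> : `|z t| ^+ 2 = z t * z t by rewrite real_normK ?num_real // expr2.
apply: (le_trans G).
have Z0 : z 0 * z 0 <= e * e.
  have -> : z 0 * z 0 = `|z 0| * `|z 0| by rewrite -normrM ger0_norm // -expr2 sqr_ge0.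
  by apply: ler_pM.
have Et : expR ((2 * L + 1) * t) <= expR ((2 * L + 1) * T).
  by rewrite ler_expR; apply: ler_wpM2l => //; lra.
have ee : 0 <= e * e by rewrite mulr_ge0.
have S1 : z 0 * z 0 + e * e * t <= e * e * (1 + T) by nra.
have S2 : (z 0 * z 0 + e * e * t) * expR ((2 * L + 1) * t) <= e * e * C.
  rewrite /C mulrA; apply: ler_pM; [|exact: expR_ge0|exact: S1|exact: Et].
  by have := sqr_ge0 (z 0); rewrite expr2; nra.
apply: (le_trans S2); rewrite expr2.
have : e * e * C <= e * e * (C * C) by apply: ler_wpM2l => //; nra.
by move=> H; apply: (le_trans H); rewrite le_eqVlt; apply/orP; left; apply/eqP; ring.
Qed.

End Uniformity.

Section Flow.
Context {R : realType} {Om : pseudoPMetricType R}.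
Variables (sigma : R -> Om -> Om) (N : Om -> R -> R) (B L : R).

Definition nice_field : Prop :=
  [/\ continuous (fun p : Om * R => N p.1 p.2), forall w x, `|N w x| <= B, 1 <= L &
      forall w x y, `|N w x - N w y| <= L * `|x - y|].

Definition is_orbit (lam : R) (w : Om) (y : R -> R) : Prop :=
  forall t : R, is_derive t 1 y (N (sigma t w) (y t) + lam).

Definition phi (lam : R) (w : Om) (x : R) : R -> R :=
  xget (fun=> 0) [set y : R -> R | y 0 = x /\ is_orbit lam w y].

Hypothesis hsigma : is_cont_flow sigma.

Lemma sigma0 w : sigma 0 w = w.
Proof. by case: hsigma => _ []. Qed.

Lemma sigmaD s t w : sigma (s + t) w = sigma t (sigma s w).
Proof. by case: hsigma => _ []. Qed.

Lemma sigmaNK t w : sigma t (sigma (- t) w) = w.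
Proof. by rewrite -sigmaD addNr sigma0. Qed.

Lemma sigmaKN t w : sigma (- t) (sigma t w) = w.
Proof. by rewrite -sigmaD addrN sigma0. Qed.

Lemma sigma_cont (X : topologicalType) (u : X -> R) (v : X -> Om) :
  continuous u -> continuous v -> continuous (fun x => sigma (u x) (v x)).
Proof.
move=> cu cv x; case: hsigma => cs _.
apply: (@continuous_comp X (R * Om)%type Om (fun x => (u x, v x)) (fun p => sigma p.1 p.2)).
  exact: (cvg_pair (cu x) (cv x)).
exact: cs.
Qed.

Lemma sigma_cont_pt t : continuous (sigma t).
Proof.
by apply: sigma_cont => x; [exact: cvg_cst|exact: cvg_id].
Qed.

Lemma sigma_cont_time w : continuous (fun t => sigma t w).
Proof.
by apply: sigma_cont => x; [exact: cvg_id|exact: cvg_cst].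
Qed.

Lemma cont_comp2 (X : topologicalType) (G : Om -> R -> R) (v : X -> Om) (y : X -> R) :
  continuous (fun p : Om * R => G p.1 p.2) ->
  continuous v -> continuous y -> continuous (fun x => G (v x) (y x)).
Proof.
move=> cG cv cy x.
apply: (@continuous_comp X (Om * R)%type R (fun x => (v x, y x)) (fun p => G p.1 p.2)).
  exact: (cvg_pair (cv x) (cy x)).
exact: cG.
Qed.

Hypothesis HN : nice_field.

Lemma field_L0 : 0 <= L.
Proof. by case: HN => _ _ L1 _; exact: le_trans L1. Qed.

Let Hf lam w (t x : R) := N (sigma t w) x + lam.

Let Hf_cont lam w (y : R -> R) : continuous y -> continuous (fun t => Hf lam w t (y t)).
Proof.
case: HN => cN _ _ _ cy t; apply: cvgD; last exact: cvg_cst.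
exact: (cont_comp2 cN (@sigma_cont_time w) cy).
Qed.

Let Hf_B lam w t x : `|Hf lam w t x| <= B + `|lam|.
Proof. by case: HN => _ NB _ _; apply: (le_trans (ler_normD _ _)); rewrite lerD2r. Qed.

Let Hf_L lam w t x y : `|Hf lam w t x - Hf lam w t y| <= L * `|x - y|.
Proof. by case: HN => _ _ _ NL; rewrite /Hf opprD addrACA subrr addr0. Qed.

Lemma phiP lam w x : phi lam w x 0 = x /\ is_orbit lam w (phi lam w x).
Proof.
case: HN => _ _ L1 _.
have [y Hy] := @picard_exists R (Hf lam w) (B + `|lam|) L (@Hf_cont lam w) (@Hf_B lam w) L1 (@Hf_L lam w) x.
by rewrite /phi; case: xgetP => [z -> []//|] /(_ y).
Qed.

Lemma phi0 lam w x : phi lam w x 0 = x.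
Proof. by have [] := phiP lam w x. Qed.

Lemma phi_der lam w x (t : R) :
  is_derive t 1 (phi lam w x) (N (sigma t w) (phi lam w x t) + lam).
Proof. by have [_] := phiP lam w x; exact. Qed.

Lemma orbit_phi lam w y : is_orbit lam w y -> forall t, y t = phi lam w (y 0) t.
Proof.
move=> Hy; case: HN => _ _ L1 _; apply: (@ode_unique R (Hf lam w) L L1 (@Hf_L lam w)).
- by move=> t; exact: Hy.
- by move=> t; exact: phi_der.
- by rewrite phi0.
Qed.

Lemma phiD lam w x s t : phi lam w x (s + t) = phi lam (sigma s w) (phi lam w x s) t.
Proof.
have /orbit_phi : is_orbit lam (sigma s w) (fun t => phi lam w x (t + s)).
  by move=> u; apply: der_shift; rewrite -sigmaD (addrC s); exact: phi_der.
by move/(_ t); rewrite add0r addrC.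
Qed.

Lemma phiK lam w x t : phi lam (sigma t w) (phi lam w x t) (- t) = x.
Proof. by rewrite -phiD addrN phi0. Qed.

Lemma phiNK lam w x t : phi lam (sigma (- t) w) (phi lam w x (- t)) t = x.
Proof. by rewrite -phiD addNr phi0. Qed.

Lemma compare_fwd (w : Om) (y1 d1 y2 d2 : R -> R) (eta T : R) : 0 <= T -> 0 <= eta ->
  (forall t : R, is_derive t 1 y1 (d1 t)) -> (forall t : R, is_derive t 1 y2 (d2 t)) ->
  (forall t, 0 <= t <= T ->
     d1 t - N (sigma t w) (y1 t) + eta <= d2 t - N (sigma t w) (y2 t)) ->
  y1 0 <= y2 0 -> y1 T + eta * (T * expR (- L * T)) <= y2 T.
Proof.
move=> T0 eta0 H1 H2 Hd H0.
have := @gain_forward R (fun t => y2 t - y1 t) (fun t => d2 t - d1 t) L eta T field_L0 T0 eta0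
  (fun t _ => derB (H2 t) (H1 t)).
have Hb t : 0 <= t <= T -> - L * `|y2 t - y1 t| + eta <= d2 t - d1 t.
  move=> tT; have := Hd t tT; case: HN => _ _ _ /(_ (sigma t w) (y2 t) (y1 t)).
  by rewrite ler_norml => /andP[]; lra.
by move=> /(_ Hb); rewrite subr_ge0 => /(_ H0); lra.
Qed.

Lemma compare_bwd (w : Om) (y1 d1 y2 d2 : R -> R) (eta T : R) : 0 <= T -> 0 <= eta ->
  (forall t : R, is_derive t 1 y1 (d1 t)) -> (forall t : R, is_derive t 1 y2 (d2 t)) ->
  (forall t, - T <= t <= 0 ->
     d2 t - N (sigma t w) (y2 t) + eta <= d1 t - N (sigma t w) (y1 t)) ->
  y1 0 <= y2 0 -> y1 (- T) + eta * (T * expR (- L * T)) <= y2 (- T).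
Proof.
move=> T0 eta0 H1 H2 Hd H0.
have := @gain_forward R (fun t => y2 (- t) - y1 (- t)) (fun t => - d2 (- t) - - d1 (- t)) L eta T field_L0 T0 eta0
  (fun t _ => derB (der_opp (H2 (- t))) (der_opp (H1 (- t)))).
have Hb t : 0 <= t <= T -> - L * `|y2 (- t) - y1 (- t)| + eta <= - d2 (- t) - - d1 (- t).
  move=> /andP[t0 tT]; have : - T <= - t <= 0 by rewrite lerN2 tT oppr_le0.
  move=> /Hd; case: HN => _ _ _ /(_ (sigma (- t) w) (y2 (- t)) (y1 (- t))).
  by rewrite ler_norml => /andP[]; lra.
by move=> /(_ Hb); rewrite !oppr0 subr_ge0 => /(_ H0); lra.
Qed.

Lemma phi_le_fwd lam mu w x x' t : 0 <= t -> x <= x' -> lam <= mu ->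
  phi lam w x t <= phi mu w x' t.
Proof.
move=> t0 xx' lm.
have := @compare_fwd w _ _ _ _ 0 t t0 (lexx _) (@phi_der lam w x) (@phi_der mu w x').
have Hd s : 0 <= s <= t -> N (sigma s w) (phi lam w x s) + lam - N (sigma s w) (phi lam w x s) + 0
    <= N (sigma s w) (phi mu w x' s) + mu - N (sigma s w) (phi mu w x' s) by move=> _; lra.
by move=> /(_ Hd); rewrite !phi0 mul0r addr0; exact.
Qed.

Lemma phi_le_bwd lam mu w x x' t : t <= 0 -> x <= x' -> mu <= lam ->
  phi lam w x t <= phi mu w x' t.
Proof.
move=> t0 xx' lm; have nt0 : 0 <= - t by rewrite oppr_ge0.
have := @compare_bwd w _ _ _ _ 0 (- t) nt0 (lexx _) (@phi_der lam w x) (@phi_der mu w x').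
have Hd s : - - t <= s <= 0 -> N (sigma s w) (phi mu w x' s) + mu - N (sigma s w) (phi mu w x' s) + 0
    <= N (sigma s w) (phi lam w x s) + lam - N (sigma s w) (phi lam w x s) by move=> _; lra.
by move=> /(_ Hd); rewrite !phi0 mul0r addr0 opprK; exact.
Qed.

Lemma phi_le lam w x x' t : x <= x' -> phi lam w x t <= phi lam w x' t.
Proof.
by move=> xx'; case: (leP 0 t) => t0; [exact: phi_le_fwd|apply: phi_le_bwd => //; exact: ltW].
Qed.

Lemma phi_inj lam w x x' t : phi lam w x t = phi lam w x' t -> x = x'.
Proof. by move=> e; rewrite -(phiK lam w x t) e phiK. Qed.

Lemma phi_lt lam w x x' t : x < x' -> phi lam w x t < phi lam w x' t.
Proof.
move=> xx'; rewrite lt_neqAle phi_le ?ltW // andbT.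
by apply/eqP => /phi_inj e; move: xx'; rewrite e ltxx.
Qed.

Lemma phi_cont_unif T e : 0 <= T -> 0 < e -> exists del, 0 < del /\
  forall lam mu w x x' t, `|t| <= T -> `|x - x'| <= del -> `|lam - mu| <= del ->
  `|phi lam w x t - phi mu w x' t| <= e.
Proof.
move=> T0 e0; pose C := (1 + T) * expR ((2 * L + 1) * T).
have C0 : 0 < C by rewrite /C mulr_gt0 ?expR_gt0 //; lra.
exists (e / C); split; first by rewrite divr_gt0.
move=> lam mu w x x' t tT xx' lm.
have -> : e = e / C * C by rewrite divfK // gt_eqF.
have d0 : 0 <= e / C by rewrite divr_ge0 ?ltW.
apply: (@gronwall_abs R (fun t => phi lam w x t - phi mu w x' t)
  (fun t => (N (sigma t w) (phi lam w x t) + lam) - (N (sigma t w) (phi mu w x' t) + mu))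
  L (e / C) T field_L0 T0 d0) => //.
- by move=> s; exact: (derB (phi_der _ _ _ _) (phi_der _ _ _ _)).
- move=> s _; rewrite opprD addrACA; apply: (le_trans (ler_normD _ _)).
  by apply: lerD => //; case: HN => _ _ _ NL; exact: NL.
- by rewrite !phi0.
Qed.

Lemma phi_cont_init lam t : continuous (fun p : Om * R => phi lam p.1 p.2 t).
Proof.
move=> -[w0 x0]; apply/cvgrPdist_le => /= e e0.
pose T := `|t|; have T0 : 0 <= T := normr_ge0 t.
pose C := (1 + T) * expR ((2 * L + 1) * T).
have C0 : 0 < C by rewrite /C mulr_gt0 ?expR_gt0 //; lra.
pose del := e / C; have d0 : 0 < del by rewrite divr_gt0.
case: (HN) => cN _ _ NL.
pose G (p : Om * R) := N (sigma p.2 p.1) (phi lam w0 x0 p.2).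
have cG : continuous G.
  apply: (cont_comp2 cN).
    by apply: sigma_cont => p; [exact: cvg_snd|exact: cvg_fst].
  move=> p; apply: (@continuous_comp (Om * R)%type R R snd (phi lam w0 x0)); first exact: cvg_snd.
  exact: (der_contT (phi_der lam w0 x0)).
pose U := [set w | forall s, `[- T, T]%classic s -> `|G (w, s) - G (w0, s)| <= del].
pose V := [set x : R | `|x - x0| <= del].
have nU : nbhs w0 U by apply: near_uniform => //; exact: segment_compact.
have nV : nbhs x0 V.
  by rewrite /V; near=> x; rewrite /= distrC; near: x; exact: cvgr_dist_le.
have H1 : \forall p \near (w0, x0), U p.1 /\ V p.2 by exists (U, V).
near=> p.
have [K1 K2] : U p.1 /\ V p.2 by near: p.
rewrite distrC.
have -> : e = del * C by rewrite /del divfK // gt_eqF.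
apply: (@gronwall_abs R (fun t => phi lam p.1 p.2 t - phi lam w0 x0 t)
  (fun t => (N (sigma t p.1) (phi lam p.1 p.2 t) + lam) - (N (sigma t w0) (phi lam w0 x0 t) + lam))
  L del T field_L0 T0 (ltW d0)) => //.
- by move=> s; exact: (derB (phi_der _ _ _ _) (phi_der _ _ _ _)).
- move=> s sT; rewrite opprD addrACA subrr addr0.
  apply: (le_trans (ler_distD (N (sigma s p.1) (phi lam w0 x0 s)) _ _)).
  apply: lerD; first exact: NL.
  by apply: (K1 s); rewrite /= in_itv /= -ler_norml.
- by rewrite !phi0.
Unshelve. all: by end_near. Qed.

Lemma phi_cont_along lam s t (b : Om -> R) : continuous b ->
  continuous (fun w => phi lam (sigma s w) (b (sigma s w)) t).
Proof.
move=> cb; apply: (@cont_comp2 _ (fun w x => phi lam w x t) (sigma s) (fun w => b (sigma s w))).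
- exact: phi_cont_init.
- exact: sigma_cont_pt.
- by move=> w; apply: continuous_comp; [exact: sigma_cont_pt|exact: cb].
Qed.

End Flow.

Section Functionals.
Context {R : realType} {Om : pseudoPMetricType R}.
Variables (sigma : R -> Om -> Om).
Hypothesis hsigma : is_cont_flow sigma.
Hypothesis hcpt : compact [set: Om].
Implicit Types (f h : Om -> R) (q L : (Om -> R) -> R) (ts : seq R).

Definition fadd f h : Om -> R := fun w => f w + h w.
Definition fscale (a : R) f : Om -> R := fun w => a * f w.

Lemma cont_fadd f h : continuous f -> continuous h -> continuous (fadd f h).
Proof. by move=> cf ch w; apply: cvgD; [exact: cf|exact: ch]. Qed.

Lemma cont_fscale a f : continuous f -> continuous (fscale a f).
Proof. by move=> cf w; apply: cvgM; [exact: cvg_cst|exact: cf]. Qed.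
Arguments cont_fscale a {f} _.

Lemma cont_shift s f : continuous f -> continuous (fun w => f (sigma s w)).
Proof.
by move=> cf w; apply: continuous_comp; [exact: (sigma_cont_pt hsigma)|exact: cf].
Qed.

Lemma cont_cst (a : R) : continuous (fun _ : Om => a).
Proof. by move=> w; exact: cvg_cst. Qed.

Definition functional_le q q' := forall f, continuous f -> q f <= q' f.

Definition sublinear q :=
  (forall f h, continuous f -> continuous h -> q (fadd f h) <= q f + q h) /\
  (forall a f, 0 < a -> continuous f -> q (fscale a f) <= a * q f).

Definition linear_functional L :=
  (forall f h, continuous f -> continuous h -> L (fadd f h) = L f + L h) /\
  (forall a f, continuous f -> L (fscale a f) = a * L f).

Definition avg ts f (w : Om) : R := (size ts)%:R^-1 * \sum_(t <- ts) f (sigma t w).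

(* The least upper bound, over all invariant means, of the mean of [f]. *)
Definition upper_mean f : R :=
  inf [set M | exists ts, (0 < size ts)%N /\ forall w, avg ts f w <= M].

Lemma avg_le ts f (M : R) w : (0 < size ts)%N -> (forall w, f w <= M) -> avg ts f w <= M.
Proof.
move=> ts0 fM; rewrite /avg mulrC ler_pdivrMr ?ltr0n //.
apply: (@le_trans _ _ (\sum_(t <- ts) M)); first by apply: ler_sum.
by rewrite big_const_seq count_predT iter_addr_0 mulr_natr.
Qed.

Lemma avg_ge ts f (M : R) w : (0 < size ts)%N -> (forall w, M <= f w) -> M <= avg ts f w.
Proof.
move=> ts0 fM; have := @avg_le ts (fun w => - f w) (- M) w ts0.
rewrite /avg sumrN mulrN lerN2; apply => v; by rewrite lerN2.
Qed.

Lemma upper_mean_has_inf f : continuous f ->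
  has_inf [set M | exists ts, (0 < size ts)%N /\ forall w, avg ts f w <= M].
Proof.
move=> cf; have [C [C0 fC]] := compact_bounded hcpt cf; split.
  exists C; exists [:: 0]; split => // w; apply: avg_le => // v.
  exact: le_trans (ler_norm _) (fC v).
exists (- C) => M [ts [ts0 H]]; apply: le_trans (H point).
by apply: avg_ge => // v; have := fC v; rewrite ler_norml => /andP[].
Qed.

Lemma upper_mean_le f (M : R) ts : continuous f -> (0 < size ts)%N ->
  (forall w, avg ts f w <= M) -> upper_mean f <= M.
Proof.
move=> cf ts0 H; apply: ge_inf; last by exists ts.
by case: (upper_mean_has_inf cf).
Qed.

Lemma upper_mean_ub f (M : R) : continuous f -> (forall w, f w <= M) -> upper_mean f <= M.
Proof. by move=> cf fM; apply: (@upper_mean_le f M [:: 0]) => // w; exact: avg_le. Qed.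

Lemma avg_avg ts us f w : (0 < size ts)%N -> (0 < size us)%N ->
  avg [seq t + u | t <- ts, u <- us] f w = avg ts (avg us f) w.
Proof.
move=> ts0 us0; rewrite /avg size_allpairs natrM big_allpairs_dep /= invfM -mulrA.
congr (_ * _); rewrite mulr_sumr; apply: eq_bigr => t _; congr (_ * _).
by apply: eq_bigr => u _; rewrite sigmaD.
Qed.

Lemma avg_comm ts us f w :
  avg [seq t + u | t <- ts, u <- us] f w = avg [seq u + t | u <- us, t <- ts] f w.
Proof.
rewrite /avg !size_allpairs mulnC; congr (_ * _).
rewrite !big_allpairs_dep /= exchange_big /=; apply: eq_bigr => u _.
by apply: eq_bigr => t _; rewrite addrC.
Qed.

Lemma avgD ts f h w : avg ts (fadd f h) w = avg ts f w + avg ts h w.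
Proof. by rewrite /avg -mulrDr -big_split. Qed.

Lemma avgZ ts a f w : avg ts (fscale a f) w = a * avg ts f w.
Proof. by rewrite /avg -mulr_sumr mulrCA. Qed.

Lemma sublinear_upper_mean : sublinear upper_mean.
Proof.
split=> [f h cf ch|a f a0 cf].
  rewrite -lerBlDr; apply: lb_le_inf; first by case: (upper_mean_has_inf cf).
  move=> M [ts [ts0 HM]]; rewrite lerBlDr -lerBlDl.
  apply: lb_le_inf; first by case: (upper_mean_has_inf ch).
  move=> M' [us [us0 HM']]; rewrite lerBlDl.
  apply: (@upper_mean_le _ _ [seq t + u | t <- ts, u <- us]); first exact: cont_fadd.
    by rewrite size_allpairs muln_gt0 ts0.
  move=> w; rewrite avgD; apply: lerD.
    by rewrite avg_comm avg_avg //; apply: avg_le.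
  by rewrite avg_avg //; apply: avg_le.
rewrite -ler_pdivrMl //; apply: lb_le_inf; first by case: (upper_mean_has_inf cf).
move=> M [ts [ts0 HM]]; rewrite ler_pdivrMl //.
apply: (@upper_mean_le _ _ ts) => //; first exact: cont_fscale.
by move=> w; rewrite avgZ ler_pM2l.
Qed.

Lemma sublinear_homog q a f : sublinear q -> 0 < a -> continuous f ->
  q (fscale a f) = a * q f.
Proof.
move=> [_ qZ] a0 cf; apply/eqP; rewrite eq_le qZ //=.
have := @qZ a^-1 (fscale a f); rewrite invr_gt0 => /(_ a0 (cont_fscale a cf)).
have -> : fscale a^-1 (fscale a f) = f.
  by apply/funext => w; rewrite /fscale mulKf // gt_eqF.
by rewrite ler_pdivlMl.
Qed.

Definition fzero : Om -> R := fun=> 0.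

Lemma sublinear0 q : sublinear q -> q fzero = 0.
Proof.
move=> sq; have := @sublinear_homog q 2 fzero sq (ltr0Sn R 1) (@cont_cst 0).
have -> : fscale 2 fzero = fzero by apply/funext => w; rewrite /fscale /fzero mulr0.
lra.
Qed.

Lemma sublinear_neg q f : sublinear q -> continuous f -> - q (fscale (-1) f) <= q f.
Proof.
move=> sq cf; have := sublinear0 sq; case: (sq) => qD _.
have := qD f (fscale (-1) f) cf (cont_fscale _ cf).
have -> : fadd f (fscale (-1) f) = fzero.
  by apply/funext => w; rewrite /fadd /fscale /fzero mulN1r subrr.
lra.
Qed.

Definition dominated_face q := forall L1 L2 (t : R), 0 < t < 1 ->
  linear_functional L1 -> linear_functional L2 ->
  functional_le L1 upper_mean -> functional_le L2 upper_mean ->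
  functional_le (fun f => t * L1 f + (1 - t) * L2 f) q ->
  functional_le L1 q /\ functional_le L2 q.

Definition tilt h q : (Om -> R) -> R := fun f =>
  inf [set x | exists2 t, 0 <= t & x = q (fadd f (fscale t h)) - t * q h].

Lemma tilt_has_inf h q f : sublinear q -> continuous f -> continuous h ->
  has_inf [set x | exists2 t, 0 <= t & x = q (fadd f (fscale t h)) - t * q h].
Proof.
move=> sq cf ch; split; first by exists (q (fadd f (fscale 0 h)) - 0 * q h); exists 0.
exists (- q (fscale (-1) f)) => _ [t t0 ->].
case: (sq) => qD _.
have H : q (fscale t h) = t * q h.
  case: (ltgtP t 0) => [|t1|->]; first by rewrite ltNge t0.
    exact: sublinear_homog.
  rewrite mul0r -[RHS](sublinear0 sq); congr q.
  by apply/funext => w; rewrite /fscale mul0r.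
have := qD _ _ (cont_fadd cf (cont_fscale t ch)) (cont_fscale (-1) cf).
have -> : fadd (fadd f (fscale t h)) (fscale (-1) f) = fscale t h.
  by apply/funext => w; rewrite /fadd /fscale; ring.
rewrite H; lra.
Qed.

Lemma tilt_le h q f t : sublinear q -> continuous f -> continuous h -> 0 <= t ->
  tilt h q f <= q (fadd f (fscale t h)) - t * q h.
Proof.
move=> sq cf ch t0; apply: ge_inf; last by exists t.
by case: (tilt_has_inf sq cf ch).
Qed.

Lemma tilt_le_id h q : sublinear q -> continuous h -> functional_le (tilt h q) q.
Proof.
move=> sq ch f cf; have := tilt_le sq cf ch (lexx 0); rewrite mul0r subr0.
by congr (_ <= q _); apply/funext => w; rewrite /fadd /fscale mul0r addr0.
Qed.

Lemma tilt_opp h q : sublinear q -> continuous h -> tilt h q (fscale (-1) h) <= - q h.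
Proof.
move=> sq ch; have := tilt_le sq (cont_fscale (-1) ch) ch ler01.
have -> : fadd (fscale (-1) h) (fscale 1 h) = fzero.
  by apply/funext => w; rewrite /fadd /fscale /fzero; ring.
by rewrite sublinear0 // mul1r sub0r.
Qed.

Lemma sublinear_tilt h q : sublinear q -> continuous h -> sublinear (tilt h q).
Proof.
move=> sq ch; split=> [f f' cf cf'|a f a0 cf].
  rewrite -lerBlDr; apply: lb_le_inf; first by case: (tilt_has_inf sq cf ch).
  move=> _ [t t0 ->]; rewrite lerBlDr -lerBlDl.
  apply: lb_le_inf; first by case: (tilt_has_inf sq cf' ch).
  move=> _ [s s0 ->]; rewrite lerBlDl.
  apply: (le_trans (tilt_le sq (cont_fadd cf cf') ch (addr_ge0 t0 s0))).
  case: (sq) => qD _.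
  have := qD _ _ (cont_fadd cf (cont_fscale t ch)) (cont_fadd cf' (cont_fscale s ch)).
  have -> : fadd (fadd f (fscale t h)) (fadd f' (fscale s h)) = fadd (fadd f f') (fscale (t + s) h).
    by apply/funext => w; rewrite /fadd /fscale; ring.
  lra.
rewrite -ler_pdivrMl //; apply: lb_le_inf; first by case: (tilt_has_inf sq cf ch).
move=> _ [t t0 ->]; rewrite ler_pdivrMl //.
apply: (le_trans (tilt_le sq (cont_fscale a cf) ch (mulr_ge0 (ltW a0) t0))).
case: (sq) => _ qZ; have := qZ a _ a0 (cont_fadd cf (cont_fscale t ch)).
have -> : fscale a (fadd f (fscale t h)) = fadd (fscale a f) (fscale (a * t) h).
  by apply/funext => w; rewrite /fadd /fscale; ring.
rewrite mulrBr; lra.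
Qed.

Lemma face_tilt h q : sublinear q -> continuous h -> functional_le q upper_mean ->
  dominated_face q -> dominated_face (tilt h q).
Proof.
move=> sq ch qp fq L1 L2 t /[dup] t01 /andP[t0 t1] l1 l2 L1p L2p Hq.
have [L1q L2q] : functional_le L1 q /\ functional_le L2 q.
  apply: (fq L1 L2 t) => // f cf; apply: (le_trans (Hq f cf)); exact: tilt_le_id.
have := Hq _ (cont_fscale (-1) ch); have := tilt_opp sq ch.
case: (l1) => L1D L1Z; case: (l2) => L2D L2Z; rewrite L1Z // L2Z // => H1 H2.
have H1h := L1q _ ch; have H2h := L2q _ ch.
have E1 : L1 h = q h by apply/eqP; rewrite eq_le H1h /=; nra.
have E2 : L2 h = q h by apply/eqP; rewrite eq_le H2h /=; nra.
split=> f cf; (apply: lb_le_inf; first by case: (tilt_has_inf sq cf ch)) => _ [s s0 ->].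
  have := L1q _ (cont_fadd cf (cont_fscale s ch)).
  rewrite L1D ?L1Z // ?E1; [lra|exact: cont_fscale].
have := L2q _ (cont_fadd cf (cont_fscale s ch)).
rewrite L2D ?L2Z // ?E2; [lra|exact: cont_fscale].
Qed.

Record face_functional := FaceFunctional {
  ff_val :> (Om -> R) -> R;
  ff_sub : sublinear ff_val;
  ff_le : functional_le ff_val upper_mean;
  ff_face : dominated_face ff_val }.

Lemma chain_inf (A : set face_functional) (a0 : face_functional) : A a0 ->
  (forall a b, A a -> A b -> functional_le a b \/ functional_le b a) ->
  exists q : face_functional, forall a, A a -> functional_le q a.
Proof.
move=> Aa0 tot; pose S f := [set x | exists2 a, A a & x = ff_val a f].
have Sinf f : continuous f -> has_inf (S f).
  move=> cf; split; first by exists (a0 f); exists a0.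
  exists (- upper_mean (fscale (-1) f)) => _ [a Aa ->].
  have := sublinear_neg (ff_sub a) cf.
  have := ff_le a (cont_fscale (-1) cf); lra.
pose q f := inf (S f).
have qle a : A a -> functional_le q a.
  by move=> Aa f cf; apply: ge_inf; [case: (Sinf f cf)|exists a].
have sq : sublinear q.
  split=> [f h cf ch|c f c0 cf].
    rewrite -lerBlDr; apply: lb_le_inf; first by case: (Sinf f cf).
    move=> _ [a Aa ->]; rewrite lerBlDr -lerBlDl.
    apply: lb_le_inf; first by case: (Sinf h ch).
    move=> _ [b Ab ->]; rewrite lerBlDl.
    have [ab|ba] := tot a b Aa Ab.
      apply: (le_trans (qle a Aa _ (cont_fadd cf ch))).
      by case: (ff_sub a) => aD _; have := aD f h cf ch; have := ab h ch; lra.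
    apply: (le_trans (qle b Ab _ (cont_fadd cf ch))).
    by case: (ff_sub b) => bD _; have := bD f h cf ch; have := ba f cf; lra.
  rewrite -ler_pdivrMl //; apply: lb_le_inf; first by case: (Sinf f cf).
  move=> _ [a Aa ->]; rewrite ler_pdivrMl //.
  apply: (le_trans (qle a Aa _ (cont_fscale c cf))).
  by case: (ff_sub a) => _ aZ; exact: aZ.
have qp : functional_le q upper_mean.
  by move=> f cf; apply: (le_trans (qle a0 Aa0 f cf)); exact: ff_le.
have fq : dominated_face q.
  move=> L1 L2 t t01 l1 l2 L1p L2p Hq.
  have HH a : A a -> functional_le L1 a /\ functional_le L2 a.
    move=> Aa; apply: (@ff_face a L1 L2 t t01 l1 l2 L1p L2p) => f cf.
    by apply: (le_trans (Hq f cf)); exact: qle.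
  split=> f cf; (apply: lb_le_inf; first by case: (Sinf f cf)) => _ [a Aa ->].
    by have [H _] := HH a Aa; exact: H.
  by have [_ H] := HH a Aa; exact: H.
by exists (FaceFunctional sq qp fq).
Qed.

Lemma extreme_functional h : continuous h -> exists L,
  [/\ linear_functional L, functional_le L upper_mean, dominated_face L & upper_mean h <= L h].
Proof.
move=> ch.
have ps := sublinear_upper_mean.
have pface : dominated_face upper_mean by move=> L1 L2 t _ _ _ H1 H2 _.
pose t0 := FaceFunctional (sublinear_tilt ps ch) (tilt_le_id ps ch)
  (face_tilt ps ch (fun f _ => lexx _) pface).
pose T := {q : face_functional | functional_le q t0}.
pose base : T := exist _ t0 (fun f _ => lexx _).
pose Rel (a b : T) : bool := `[< functional_le (sval b) (sval a) >].
have [||A tot|[q qt0] qmin] := @ZL_preorder T base Rel.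
- by move=> a; apply/asboolP => f cf.
- move=> a b c /asboolP ab /asboolP bc; apply/asboolP => f cf.
  exact: le_trans (bc f cf) (ab f cf).
- case: (pselect (exists a, A a)) => [[a Aa]|nA]; last first.
    by exists base => s As; exfalso; apply: nA; exists s.
  have [||q Hq] := @chain_inf (sval @` A) (sval a); first by exists a.
    move=> _ _ [x Ax <-] [y Ay <-].
    by have [/asboolP|/asboolP] := tot x y Ax Ay; [right|left].
  have qt0 : functional_le q t0.
    move=> f cf; apply: (@le_trans _ _ (sval a f)); first by apply: Hq => //; exists a.
    exact: (svalP a).
  by exists (exist _ q qt0) => s As; apply/asboolP; apply: Hq; exists s.
- pose L := ff_val q; exists L.
  have sL := ff_sub q.
  have odd f : continuous f -> L (fscale (-1) f) = - L f.
    move=> cf.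
    pose q' := FaceFunctional (sublinear_tilt sL cf)
      (fun u cu => le_trans (tilt_le_id sL cf cu) (ff_le q cu))
      (face_tilt sL cf (@ff_le q) (@ff_face q)).
    have q'q : functional_le q' q by exact: tilt_le_id.
    have q't : functional_le q' t0.
      by move=> u cu; exact: le_trans (q'q u cu) (qt0 u cu).
    have /asboolP H := qmin (exist _ q' q't) (introT (asboolP _) q'q).
    have /= := H _ (cont_fscale (-1) cf); have := tilt_opp sL cf.
    have := sublinear_neg sL cf; rewrite -/L => *.
    by apply/eqP; rewrite eq_le; apply/andP; split; lra.
  have LD f u : continuous f -> continuous u -> L (fadd f u) = L f + L u.
    move=> cf cu; case: (sL) => LD _; apply/eqP; rewrite eq_le LD //=.
    have := LD _ _ (cont_fscale (-1) cf) (cont_fscale (-1) cu).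
    have -> : fadd (fscale (-1) f) (fscale (-1) u) = fscale (-1) (fadd f u).
      by apply/funext => w; rewrite /fadd /fscale; ring.
    rewrite -/L !odd //; [lra|exact: cont_fadd].
  split.
  + split=> // a f cf; case: (ltgtP a 0) => [a0|a0|->].
    * have -> : fscale a f = fscale (-1) (fscale (- a) f).
        by apply/funext => w; rewrite /fscale; ring.
      rewrite odd; last exact: cont_fscale.
      by rewrite /L (sublinear_homog sL) ?oppr_gt0 //; ring.
    * exact: sublinear_homog.
    * have -> : fscale 0 f = fzero by apply/funext => w; rewrite /fscale mul0r.
      by rewrite /L sublinear0 // mul0r.
  + exact: ff_le.
  + exact: ff_face.
  + have := qt0 _ (cont_fscale (-1) ch); rewrite -/L odd // => H.
    have /= := tilt_opp ps ch; move: H => /=; lra.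
Qed.

End Functionals.
Arguments cont_fscale {R Om} a {f} _.
Arguments cont_shift {R Om sigma} _ s {f} _.

Section Riesz.
Context {R : realType} {Om : pseudoPMetricType R}.
Hypothesis hsep : hausdorff_space Om.
Hypothesis hcpt : compact [set: Om].
Variable L : (Om -> R) -> R.
Hypothesis Llin : linear_functional L.
Implicit Types (f h : Om -> R) (K U V A : set Om) (e x : R).
Hypothesis Lpos : forall f, continuous f -> (forall w, 0 <= f w) -> 0 <= L f.
Hypothesis Lone : L (fun=> 1) = 1.

Lemma functional_mono f h : continuous f -> continuous h -> (forall w, f w <= h w) -> L f <= L h.
Proof.
move=> cf ch fh; case: Llin => LD LZ.
have := Lpos (cont_fadd ch (cont_fscale (-1) cf)).
rewrite LD ?LZ //; last exact: cont_fscale.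
have H : forall w, 0 <= fadd h (fscale (-1) f) w.
  by move=> w; rewrite /fadd /fscale mulN1r subr_ge0.
by move/(_ H); lra.
Qed.

Definition kappa (K : set Om) : R :=
  inf [set x | exists f, [/\ continuous f, forall w, 0 <= f w, forall w, K w -> 1 <= f w & x = L f]].

Lemma kappa_has_inf K : has_inf
  [set x | exists f, [/\ continuous f, forall w, 0 <= f w, forall w, K w -> 1 <= f w & x = L f]].
Proof.
split; first by exists 1; exists (fun=> 1); split=> // w; exact: cvg_cst.
by exists 0 => _ [f [cf f0 _ ->]]; exact: Lpos.
Qed.

Lemma kappa_le K f : continuous f -> (forall w, 0 <= f w) -> (forall w, K w -> 1 <= f w) ->
  kappa K <= L f.
Proof. by move=> cf f0 f1; apply: ge_inf; [case: (kappa_has_inf K)|exists f]. Qed.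

Lemma kappa_lb K x :
  (forall f, continuous f -> (forall w, 0 <= f w) -> (forall w, K w -> 1 <= f w) -> x <= L f) ->
  x <= kappa K.
Proof.
move=> H; apply: lb_le_inf; first by case: (kappa_has_inf K).
by move=> _ [f [cf f0 f1 ->]]; exact: H.
Qed.

Lemma kappa_ge0 K : 0 <= kappa K.
Proof. by apply: kappa_lb => f cf f0 _; exact: Lpos. Qed.

Lemma kappa_le1 K : kappa K <= 1.
Proof. by rewrite -Lone; apply: kappa_le => // w; exact: cvg_cst. Qed.

Lemma kappa_mono K K' : K `<=` K' -> kappa K <= kappa K'.
Proof. by move=> KK'; apply: kappa_lb => f cf f0 f1; apply: kappa_le => // w /KK'; exact: f1. Qed.

Lemma kappaU K K' : kappa (K `|` K') <= kappa K + kappa K'.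
Proof.
rewrite -lerBlDr; apply: kappa_lb => f cf f0 f1; rewrite lerBlDr -lerBlDl.
apply: kappa_lb => h ch h0 h1; rewrite lerBlDl.
case: Llin => LD _; rewrite -LD //; apply: kappa_le; first exact: cont_fadd.
  by move=> w; rewrite addr_ge0.
move=> w [Kw|Kw]; rewrite /fadd.
  by have := f1 w Kw; have := h0 w; lra.
by have := f0 w; have := h1 w Kw; lra.
Qed.

Lemma urysohn_closed (A B : set Om) : closed A -> closed B -> (forall w, A w -> B w -> False) ->
  exists u : Om -> R, [/\ continuous u, forall w, 0 <= u w <= 1,
    forall w, A w -> u w = 0 & forall w, B w -> u w = 1].
Proof.
move=> cA cB AB.
have dAB : A `&` B = set0 by apply/seteqP; split=> // w [/AB].
have us := normal_uniform_separator (compact_normal hsep hcpt) cA cB dAB.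
exists (Urysohn A B); split.
- exact: Urysohn_continuous.
- move=> w; have := @Urysohn_range _ R A B (Urysohn A B w).
  by rewrite /= in_itv /=; apply; exists w.
- by move=> w Aw; apply: (Urysohn_sub0 us); exists w.
- by move=> w Bw; apply: (Urysohn_sub1 us); exists w.
Qed.

Lemma kappaU_disj K K' : closed K -> closed K' -> (forall w, K w -> K' w -> False) ->
  kappa K + kappa K' <= kappa (K `|` K').
Proof.
move=> cK cK' dK; have [u [cu u01 u0 u1]] := urysohn_closed cK cK' dK.
apply: kappa_lb => f cf f0 f1; case: (Llin) => LD LZ.
pose f1' w := f w * u w; pose f0' w := f w * (1 - u w).
have c1 : continuous f1' by move=> w; apply: cvgM; [exact: cf|exact: cu].
have c0 : continuous f0'.
  by move=> w; apply: cvgM; [exact: cf|apply: cvgB; [exact: cvg_cst|exact: cu]].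
have -> : f = fadd f0' f1' by apply/funext => w; rewrite /fadd /f0' /f1'; ring.
rewrite LD //; apply: lerD; apply: kappa_le => //.
- by move=> w; rewrite mulr_ge0 // subr_ge0; case/andP: (u01 w).
- by move=> w Kw; rewrite /f0' u0 // subr0 mulr1; apply: f1; left.
- by move=> w; rewrite mulr_ge0 //; case/andP: (u01 w).
- by move=> w Kw; rewrite /f1' u1 // mulr1; apply: f1; right.
Qed.

Definition inner_kappa (U : set Om) : R := sup [set x | exists K, [/\ closed K, K `<=` U & x = kappa K]].

Lemma inner_has_sup U : has_sup [set x | exists K, [/\ closed K, K `<=` U & x = kappa K]].
Proof.
split; first by exists (kappa set0); exists set0; split => //; exact: closed0.
by exists 1 => _ [K [_ _ ->]]; exact: kappa_le1.
Qed.

Lemma kappa_inner K U : closed K -> K `<=` U -> kappa K <= inner_kappa U.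
Proof. by move=> cK KU; apply: ub_le_sup; [case: (inner_has_sup U)|exists K]. Qed.

Lemma inner_ub U x : (forall K, closed K -> K `<=` U -> kappa K <= x) -> inner_kappa U <= x.
Proof.
move=> H; apply: ge_sup; first by case: (inner_has_sup U).
by move=> _ [K [cK KU ->]]; exact: H.
Qed.

Lemma inner_ge0 U : 0 <= inner_kappa U.
Proof. by apply: (le_trans (kappa_ge0 set0)); apply: kappa_inner => //; exact: closed0. Qed.

Lemma inner_mono U V : U `<=` V -> inner_kappa U <= inner_kappa V.
Proof.
by move=> UV; apply: inner_ub => K cK KU; apply: kappa_inner => //; exact: subset_trans UV.
Qed.

Lemma closed_split (K U V : set Om) : closed K -> open U -> open V -> K `<=` U `|` V ->
  exists K1 K2, [/\ closed K1, closed K2, K1 `<=` U, K2 `<=` V & K `<=` K1 `|` K2].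
Proof.
move=> cK oU oV KUV.
have cA : closed (K `&` ~` V) by apply: closedI => //; exact: open_closedC.
have cB : closed (K `&` ~` U) by apply: closedI => //; exact: open_closedC.
have [|u [cu u01 u0 u1]] := urysohn_closed cA cB.
  by move=> w [Kw nV] [_ nU]; case: (KUV w Kw).
exists (K `&` [set w | u w <= 1 / 2]), (K `&` [set w | 1 / 2 <= u w]); split.
- apply: closedI => //; have -> : [set w | u w <= 1 / 2] = u @^-1` [set x | x <= 1 / 2] by [].
  by apply: closed_comp => [w _|]; [exact: cu|exact: closed_le].
- apply: closedI => //; have -> : [set w | 1 / 2 <= u w] = u @^-1` [set x | 1 / 2 <= x] by [].
  by apply: closed_comp => [w _|]; [exact: cu|exact: closed_ge].
- move=> w [Kw /= uw]; apply: contrapT => nU; have := u1 w (conj Kw nU); lra.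
- move=> w [Kw /= uw]; apply: contrapT => nV; have := u0 w (conj Kw nV); lra.
- by move=> w Kw; case: (leP (u w) (1 / 2)) => [?|/ltW ?]; [left|right].
Qed.

Lemma kappa_finite_cover (U : nat -> set Om) n K : closed K -> (forall i, open (U i)) ->
  (forall w, K w -> exists i, (i < n)%N /\ U i w) -> kappa K <= \sum_(i < n) inner_kappa (U i).
Proof.
move=> + oU; elim: n K => [|n IH] K cK KU.
  rewrite big_ord0; apply: (@le_trans _ _ (L (fun=> 0))).
    by apply: kappa_le => // [w|w /KU[i []]]; first exact: cvg_cst.
  case: Llin => _ LZ; have := LZ 0 (fun=> 1) (@cont_cst R Om 1).
  have -> : fscale 0 (fun _ : Om => 1) = (fun=> 0) by apply/funext => w; rewrite /fscale mul0r.
  by rewrite mul0r => ->.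
have oV : open (\bigcup_(i in [set i | (i < n)%N]) U i) by apply: bigcup_open => i _.
have [|K1 [K2 [c1 c2 K1U K2U KK]]] := closed_split cK oV (oU n).
  move=> w Kw; have [i [+ Ui]] := KU w Kw; rewrite ltnS leq_eqVlt => /orP[/eqP <-|ni].
    by right.
  by left; exists i.
apply: (le_trans (kappa_mono KK)); apply: (le_trans (kappaU _ _)).
rewrite big_ord_recr /=; apply: lerD; last exact: kappa_inner.
by apply: IH => // w /K1U[i ? ?]; exists i.
Qed.

Lemma kappa_countable_cover (U : nat -> set Om) K : closed K -> (forall i, open (U i)) ->
  K `<=` \bigcup_i U i -> exists n, kappa K <= \sum_(i < n) inner_kappa (U i).
Proof.
move=> cK oU KU.
have /compact_near_coveringP/(_ nat \oo (fun n w => exists i, (i < n)%N /\ U i w)) :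
  compact K by exact: (subclosed_compact cK hcpt).
case.
  move=> w Kw; have [i _ Ui] := KU w Kw.
  exists (U i, [set n | (i < n)%N]) => /=.
    split; first by apply: open_nbhs_nbhs; split; [exact: oU|].
    by exists i.+1.
  by move=> [w' n] [/= Uw' ni]; exists i.
move=> n _ /(_ n (leqnn n)) H; exists n.
by apply: kappa_finite_cover => // w /H.
Qed.

Definition riesz_outer (A : set Om) : R :=
  inf [set x | exists U, [/\ open U, A `<=` U & x = inner_kappa U]].

Lemma outer_has_inf A : has_inf [set x | exists U, [/\ open U, A `<=` U & x = inner_kappa U]].
Proof.
split; first by exists (inner_kappa setT); exists setT; split => //; exact: openT.
by exists 0 => _ [U [_ _ ->]]; exact: inner_ge0.
Qed.

Lemma outer_le A U : open U -> A `<=` U -> riesz_outer A <= inner_kappa U.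
Proof. by move=> oU AU; apply: ge_inf; [case: (outer_has_inf A)|exists U]. Qed.

Lemma outer_lb A x : (forall U, open U -> A `<=` U -> x <= inner_kappa U) -> x <= riesz_outer A.
Proof.
move=> H; apply: lb_le_inf; first by case: (outer_has_inf A).
by move=> _ [U [oU AU ->]]; exact: H.
Qed.

Lemma outer_approx A e : 0 < e -> exists U, [/\ open U, A `<=` U & inner_kappa U <= riesz_outer A + e].
Proof.
move=> e0; have [_ [U [oU AU ->]] H] := inf_adherent e0 (outer_has_inf A).
by exists U; split => //; exact: ltW.
Qed.

Lemma outer_ge0 A : 0 <= riesz_outer A.
Proof. by apply: outer_lb => U _ _; exact: inner_ge0. Qed.

Lemma outer_open U : open U -> riesz_outer U = inner_kappa U.
Proof.
move=> oU; apply/eqP; rewrite eq_le outer_le //=.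
by apply: outer_lb => V oV; exact: inner_mono.
Qed.

Lemma outer_set0 : riesz_outer set0 = 0.
Proof.
apply/eqP; rewrite eq_le outer_ge0 andbT.
apply: (le_trans (outer_le open0 (@subset_refl _ set0))).
apply: inner_ub => K _ K0.
apply: (le_trans (kappa_mono K0)).
by have := @kappa_finite_cover (fun=> set0) 0%N set0 closed0 (fun=> open0); rewrite big_ord0; apply.
Qed.

Lemma outer_mono A B : A `<=` B -> riesz_outer A <= riesz_outer B.
Proof. by move=> AB; apply: outer_lb => U oU BU; apply: outer_le => //; exact: subset_trans BU. Qed.

Lemma outer_closed K : closed K -> riesz_outer K = kappa K.
Proof.
move=> cK; apply/eqP; rewrite eq_le; apply/andP; split; last first.
  by apply: outer_lb => U oU; exact: kappa_inner.
apply: kappa_lb => f cf f0 f1.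
apply/ler_addgt0Pr => e e0.
pose a := 1 + L f; have La : 0 <= L f by exact: Lpos.
pose t := e / (e + a); have ea : 0 < e + a by rewrite /a; lra.
have t0 : 0 < t by rewrite divr_gt0.
have t1 : t < 1 by rewrite ltr_pdivrMr //; rewrite /a; lra.
pose U := [set w | 1 - t < f w].
have oU : open U.
  have -> : U = f @^-1` [set x | 1 - t < x] by [].
  by apply: open_comp => [w _|]; [exact: cf|exact: open_gt].
apply: (@le_trans _ _ (inner_kappa U)).
  by apply: outer_le => // w Kw; rewrite /U /=; have := f1 w Kw; lra.
apply: inner_ub => K' cK' K'U.
have s0 : 0 < 1 - t by lra.
have : kappa K' <= L (fscale (1 - t)^-1 f).
  apply: kappa_le; first exact: cont_fscale.
    by move=> w; rewrite mulr_ge0 // invr_ge0 ltW.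
  by move=> w /K'U; rewrite /U /= /fscale ler_pdivlMl // mulr1 => /ltW.
case: Llin => _ LZ; rewrite LZ // => H; apply: (le_trans H).
rewrite ler_pdivrMl //.
have -> : 1 - t = a / (e + a).
  by rewrite /t; field; rewrite gt_eqF.
rewrite mulrAC ler_pdivlMr // /a; nra.
Qed.

Lemma inner_sigma_subadditive (U : nat -> set Om) : (forall i, open (U i)) ->
  ((inner_kappa (\bigcup_i U i))%:E <= \sum_(i <oo) (inner_kappa (U i))%:E)%E.
Proof.
move=> oU; set S := (\sum_(i <oo) _)%E.
have H K : closed K -> K `<=` \bigcup_i U i -> ((kappa K)%:E <= S)%E.
  move=> cK KU; have [n Hn] := kappa_countable_cover cK oU KU.
  apply: (@le_trans _ _ (\sum_(i < n) (inner_kappa (U i))%:E)%E).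
    by rewrite sumEFin lee_fin.
  rewrite -(big_mkord xpredT (fun i => (inner_kappa (U i))%:E)).
  by apply: nneseries_lim_ge => i _ _; rewrite lee_fin inner_ge0.
move: H; case: S => [s| |] H.
- by rewrite lee_fin; apply: inner_ub => K cK KU; have := H K cK KU; rewrite lee_fin.
- by rewrite leey.
- by have := H set0 closed0 (sub0set _).
Qed.

Definition riesz_outerE (A : set Om) : \bar R := (riesz_outer A)%:E.

Lemma outer_sigma_subadditive : sigma_subadditive riesz_outerE.
Proof.
move=> F; apply/lee_addgt0Pr => e e0.
have /choice[U HU] : forall i, exists U, [/\ open U, F i `<=` U &
   inner_kappa U <= riesz_outer (F i) + e / (2 ^ i.+1)%:R].
  by move=> i; apply: outer_approx; rewrite divr_gt0 // ltr0n expn_gt0.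
have oU i : open (U i) by case: (HU i).
apply: (@le_trans _ _ (inner_kappa (\bigcup_i U i))%:E).
  rewrite lee_fin; apply: outer_le; first by apply: bigcup_open => i _.
  by move=> w [i _ Fi]; exists i => //; case: (HU i) => _ + _; exact.
apply: (le_trans (inner_sigma_subadditive oU)).
have := @epsilon_trick R (fun i => riesz_outerE (F i)) e xpredT.
have H0 : forall n, (0 <= riesz_outerE (F n))%E by move=> n; rewrite lee_fin outer_ge0.
move=> /(_ H0 (ltW e0)); apply: le_trans.
apply: lee_nneseries => i _; first by move=> _; rewrite lee_fin inner_ge0.
by rewrite /riesz_outerE -EFinD lee_fin; case: (HU i).
Qed.

HB.instance Definition _ := isOuterMeasure.Build R Om riesz_outerE
  (congr1 EFin outer_set0) (fun A => outer_ge0 A) (fun A B AB => outer_mono AB)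
  outer_sigma_subadditive.

Lemma open_caratheodory U : open U -> caratheodory_measurable riesz_outerE U.
Proof.
move=> oU; apply: le_caratheodory_measurable => E /=.
rewrite /riesz_outerE -EFinD lee_fin; apply/ler_addgt0Pr => e e0.
have e3 : 0 < e / 3 by rewrite divr_gt0.
have [V [oV EV HV]] := outer_approx E e3.
have oVU : open (V `&` U) by exact: openI.
have [_ [K [cK KVU ->]] HK] := sup_adherent e3 (inner_has_sup (V `&` U)).
have oVK : open (V `&` ~` K) by apply: openI => //; exact: closed_openC.
have [_ [K' [cK' KVK ->]] HK'] := sup_adherent e3 (inner_has_sup (V `&` ~` K)).
have h1 : riesz_outer (E `&` U) <= inner_kappa (V `&` U).
  by apply: outer_le => // w [Ew Uw]; split => //; exact: EV.
have h2 : riesz_outer (E `&` ~` U) <= inner_kappa (V `&` ~` K).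
  apply: outer_le => // w [Ew Uw]; split => //; first exact: EV.
  by move=> Kw; apply: Uw; case: (KVU w Kw).
have h3 : kappa K + kappa K' <= inner_kappa V.
  apply: (le_trans (kappaU_disj cK cK' _)).
    by move=> w Kw K'w; case: (KVK w K'w).
  apply: kappa_inner; first exact: closedU.
  by move=> w [/KVU[]|/KVK[]].
move: HK HK'; rewrite -!/(inner_kappa _); lra.
Qed.

Lemma borel_caratheodory (A : set (Borel Om)) : measurable A -> caratheodory_measurable riesz_outerE A.
Proof.
apply: smallest_sub; last by move=> U; exact: open_caratheodory.
exact: (@sigma_algebra_measurable _ (caratheodory_type riesz_outerE)).
Qed.

Definition riesz_measure (A : set (Borel Om)) : \bar R := riesz_outerE A.

Lemma riesz_sigma_additive : semi_sigma_additive riesz_measure.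
Proof.
move=> F mF tF mU.
apply: (@caratheodory_measure_sigma_additive R Om riesz_outerE F) => //.
  by move=> i; exact: borel_caratheodory.
exact: borel_caratheodory.
Qed.

HB.instance Definition _ := isMeasure.Build _ (Borel Om) R riesz_measure
  (congr1 EFin outer_set0) (fun A => outer_ge0 A) riesz_sigma_additive.

Lemma riesz_setT : riesz_measure setT = 1%E.
Proof.
rewrite /riesz_measure /riesz_outerE outer_closed; last exact: closedT.
congr EFin; apply/eqP; rewrite eq_le kappa_le1 /=; apply: kappa_lb => f cf f0 f1.
by rewrite -Lone; apply: functional_mono => // [w|w]; [exact: cvg_cst|exact: f1].
Qed.

HB.instance Definition _ := Measure_isProbability.Build _ (Borel Om) R riesz_measure riesz_setT.

Definition riesz_probability : probability (Borel Om) R := riesz_measure.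

End Riesz.

Section LayerCake.
Context {R : realType} {Om : pseudoPMetricType R}.
Hypothesis hcpt : compact [set: Om].
Implicit Types (f h : Om -> R) (K : set Om).

Definition clamp01 (y : R) : R := Num.min 1 (Num.max 0 y).

Lemma clamp01_itv y : 0 <= clamp01 y <= 1.
Proof. by rewrite /clamp01 le_min ge_min lexx ler01 le_max lexx. Qed.

Lemma clamp01_le0 y : y <= 0 -> clamp01 y = 0.
Proof. by move=> y0; rewrite /clamp01 max_l // min_r. Qed.

Lemma clamp01_ge1 y : 1 <= y -> clamp01 y = 1.
Proof. by move=> y1; rewrite /clamp01 max_r ?min_l //; lra. Qed.

Lemma clamp01_id y : 0 <= y <= 1 -> clamp01 y = y.
Proof. by move=> /andP[y0 y1]; rewrite /clamp01 max_r // min_r. Qed.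

Lemma sum_clamp01 y n : 0 <= y -> \sum_(i < n) clamp01 (y - i%:R) = Num.min y n%:R.
Proof.
move=> y0; elim: n => [|n IH]; first by rewrite big_ord0 min_r.
rewrite big_ord_recr /= IH -natr1; case: (leP y n%:R) => yn.
  by rewrite clamp01_le0 ?subr_le0 // addr0 min_l //; lra.
case: (leP y (n%:R + 1)) => yn1.
  by rewrite clamp01_id; [|apply/andP; split]; lra.
by rewrite clamp01_ge1; lra.
Qed.

Lemma cont_clamp01 f (a b : R) : continuous f -> continuous (fun w => clamp01 (a * f w - b)).
Proof.
move=> cf w; rewrite /clamp01.
apply: (@continuous_comp Om R R (fun w => a * f w - b) (fun y => Num.min 1 (Num.max 0 y))).
  apply: cvgB; last exact: cvg_cst.
  by apply: cvgM; [exact: cvg_cst|exact: cf].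
by apply: continuous_min; [exact: cvg_cst|apply: continuous_max; [exact: cvg_cst|exact: cvg_id]].
Qed.

Lemma functional_sum (J : (Om -> R) -> R) n (F : nat -> Om -> R) : linear_functional J ->
  (forall i, continuous (F i)) ->
  continuous (fun w => \sum_(i < n) F i w) /\ J (fun w => \sum_(i < n) F i w) = \sum_(i < n) J (F i).
Proof.
move=> [JD JZ] cF; elim: n => [|n [cIH IH]].
  have -> : (fun w => \sum_(i < 0) F i w) = (fun=> 0).
    by apply/funext => w; rewrite big_ord0.
  split; first exact: cont_cst.
  rewrite big_ord0; have := JZ 0 (fun=> 0) (@cont_cst R Om 0); rewrite mul0r => H; rewrite -[RHS]H.
  by congr J; apply/funext => w; rewrite /fscale mul0r.
have E : (fun w => \sum_(i < n.+1) F i w) = fadd (fun w => \sum_(i < n) F i w) (F n).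
  by apply/funext => w; rewrite big_ord_recr.
rewrite E big_ord_recr /= JD // IH; split => //.
exact: cont_fadd.
Qed.

Variables (J1 J2 : (Om -> R) -> R) (c : set Om -> R).
Hypothesis J1lin : linear_functional J1.
Hypothesis J2lin : linear_functional J2.
Hypothesis J2pos : forall f, continuous f -> (forall w, 0 <= f w) -> 0 <= J2 f.
Hypothesis c1 : forall K, closed K -> c K <= 1.
Hypothesis H1 : forall K f, closed K -> continuous f -> (forall w, 0 <= f w <= 1) ->
  (forall w, ~ K w -> f w = 0) -> J1 f <= c K.
Hypothesis H2 : forall K f, closed K -> continuous f -> (forall w, 0 <= f w <= 1) ->
  (forall w, K w -> 1 <= f w) -> c K <= J2 f.

Lemma layer_cake_le f : continuous f -> (forall w, 0 <= f w <= 1) -> J1 f <= J2 f.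
Proof.
move=> cf f01; apply/ler_addgt0Pr => e e0.
pose n := Num.truncn e^-1; pose N : R := n.+1%:R.
have N0 : 0 < N by rewrite ltr0n.
have eN : 1 <= e * N.
  rewrite -ler_pdivrMl // mulr1; apply: ltW; rewrite /N.
  by have /truncn_itv/andP[] : 0 <= e^-1 by rewrite invr_ge0 ltW.
pose F i w := clamp01 (N * f w - i%:R).
have cF i : continuous (F i) by exact: cont_clamp01.
have SF : (fun w => \sum_(i < n.+1) F i w) = fscale N f.
  apply/funext => w; have /andP[fw0 fw1] := f01 w.
  rewrite sum_clamp01; last by rewrite mulr_ge0 // ltW.
  by rewrite /fscale min_l // -[X in _ <= X]mulr1 ler_pM2l.
pose K (i : nat) := [set w | i%:R <= N * f w].
have cK i : closed (K i).
  have -> : K i = (fun w => N * f w) @^-1` [set x | i%:R <= x] by [].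
  apply: closed_comp => [w _|]; last exact: closed_ge.
  by apply: cvgM; [exact: cvg_cst|exact: cf].
have [_ E1] := functional_sum n.+1 J1lin cF.
have [_ E2] := functional_sum n.+1 J2lin cF.
move: E1 E2; rewrite SF; case: J1lin => _ ->//; case: J2lin => _ ->// E1 E2.
have B1 i : J1 (F i) <= c (K i).
  apply: H1 => // [w|w /negP]; first exact: clamp01_itv.
  by rewrite -ltNge => /ltW ?; rewrite /F clamp01_le0 // subr_le0.
have B2 i : c (K i.+1) <= J2 (F i).
  apply: H2 => // [w|w]; first exact: clamp01_itv.
  by rewrite /K /= -natr1 => ?; rewrite /F clamp01_ge1 //; lra.
have S : N * J1 f <= 1 + N * J2 f.
  rewrite E1 E2; apply: (@le_trans _ _ (\sum_(i < n.+1) c (K i))); first by apply: ler_sum.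
  rewrite big_ord_recl big_ord_recr /=; apply: lerD; first exact: c1.
  apply: (@le_trans _ _ (\sum_(i < n) J2 (F i))); first by apply: ler_sum.
  by rewrite lerDl; apply: J2pos => // w; case/andP: (clamp01_itv (N * f w - n%:R)).
rewrite -(ler_pM2l N0); apply: (le_trans S); rewrite mulrDr addrC lerD2l mulrC; lra.
Qed.

Lemma layer_cake_eq f : continuous f -> J1 (fun=> 1) = J2 (fun=> 1) -> J1 f = J2 f.
Proof.
move=> cf e1; have [C0 [C00 fC0]] := compact_bounded hcpt cf.
pose C := C0 + 1; have C_0 : 0 < 2 * C by rewrite /C; lra.
have fC w : - C <= f w <= C.
  by have := fC0 w; rewrite ler_norml /C => /andP[]; lra.
have c1' : continuous (fun _ : Om => 1 : R) by exact: cont_cst.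
pose f1 := fadd (fscale (2 * C)^-1 f) (fscale 2^-1 (fun=> 1)).
pose f2 := fadd (fscale (- (2 * C)^-1) f) (fscale 2^-1 (fun=> 1)).
have cf1 : continuous f1 by apply: cont_fadd; exact: cont_fscale.
have cf2 : continuous f2 by apply: cont_fadd; exact: cont_fscale.
have B w : - 2^-1 <= (2 * C)^-1 * f w <= 2^-1.
  rewrite ler_pdivlMl // ler_pdivrMl //; have := fC w; lra.
have A1 : J1 f1 <= J2 f1.
  by apply: layer_cake_le => // w; rewrite /f1 /fadd /fscale; have := B w; lra.
have A2 : J1 f2 <= J2 f2.
  by apply: layer_cake_le => // w; rewrite /f2 /fadd /fscale; have := B w; lra.
move: A1 A2; rewrite /f1 /f2.
case: J1lin => D1 Z1; case: J2lin => D2 Z2.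
rewrite D1 ?D2; try exact: cont_fscale.
rewrite D1 ?D2; try exact: cont_fscale.
rewrite !Z1 // !Z2 // e1 !lerD2r !mulNr lerN2 !ler_pM2l ?invr_gt0 // => A1 A2.
by apply/eqP; rewrite eq_le A1.
Qed.

End LayerCake.

Section BorelIntegral.
Context {R : realType} {Om : pseudoPMetricType R}.
Hypothesis hcpt : compact [set: Om].
Implicit Types (f h : Om -> R) (K : set Om) (A : set (Borel Om)).

Lemma open_borel (U : set Om) : open U -> measurable (U : set (Borel Om)).
Proof. by move=> oU; exact: sub_sigma_algebra. Qed.

Lemma closed_borel (K : set Om) : closed K -> measurable (K : set (Borel Om)).
Proof. by move=> cK; rewrite -[K]setCK; apply: measurableC; apply: open_borel; exact: closed_openC. Qed.

Lemma cont_measurable f : continuous f -> measurable_fun setT (f : Borel Om -> R).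
Proof.
move=> cf; apply: (measurability _ (measurable_realfun.RGenCInfty.measurableE R)).
move=> /= _ [_ [x ->] <-]; rewrite setTI; apply: closed_borel.
apply: closed_comp => [w _|]; first exact: cf.
by have := @closed_ge R x; congr closed; apply/seteqP; split=> y /=; rewrite in_itv /= andbT.
Qed.

Lemma cont_borel_map (s : Om -> Om) : continuous s -> forall A, measurable A ->
  measurable (s @^-1` A : set (Borel Om)).
Proof.
move=> cs A mA.
have : measurable_fun setT (s : Borel Om -> Borel Om).
  apply: (measurability _ (erefl : @measurable _ (Borel Om) = <<s @open Om>>)).
  move=> _ [U oU <-]; rewrite setTI; apply: open_borel.
  by apply: open_comp => // w _; exact: cs.
by move=> /(_ measurableT A mA); rewrite setTI.
Qed.

Variable m : probability (Borel Om) R.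

Lemma cont_integrable f A : continuous f -> measurable A ->
  m.-integrable A (EFin \o (f : Borel Om -> R)).
Proof.
move=> cf mA; apply: measurable_bounded_integrable => //.
- by rewrite -ge0_fin_numE // fin_num_measure.
- by apply: measurable_funS (cont_measurable cf).
- have [C [C0 fC]] := compact_bounded hcpt cf.
  exists C; split; first exact: num_real.
  by move=> M CM w _; apply: le_trans (fC w) (ltW CM).
Qed.

Definition mean A f : R := \int[m]_(w in A) (f : Borel Om -> R) w.

Lemma mean_linear A : measurable A -> linear_functional (mean A).
Proof.
move=> mA; split=> [f h cf ch|a f cf].
  by rewrite /mean RintegralD //; exact: cont_integrable.
by rewrite /mean RintegralZl //; exact: cont_integrable.
Qed.

Lemma mean_ge0 A f : (forall w, 0 <= f w) -> 0 <= mean A f.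
Proof. by move=> f0; apply: Rintegral_ge0. Qed.

Lemma mean_cst A : measurable A -> mean A (fun=> 1) = fine (m A).
Proof. by move=> mA; rewrite /mean Rintegral_cst // mul1r. Qed.

Lemma mean_indic A (K : set (Borel Om)) : measurable A -> measurable K ->
  \int[m]_(w in A) \1_K w = fine (m (K `&` A)).
Proof. by move=> mA mK; rewrite /Rintegral integral_indic. Qed.

Lemma indic_integrable A (K : set (Borel Om)) : measurable A -> measurable K ->
  m.-integrable A (EFin \o \1_K).
Proof.
move=> mA mK; apply: measurable_bounded_integrable => //.
- by rewrite -ge0_fin_numE // fin_num_measure.
- exists 1; split; first exact: num_real.
  move=> M M1 w _; apply: le_trans (ltW M1).
  by rewrite indicE ger0_norm ?ler0n // -[X in _ <= X]/(1%:R) ler_nat leq_b1.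
Qed.

Lemma mean_le_measure A (K : set (Borel Om)) f : measurable A -> measurable K -> continuous f ->
  (forall w, 0 <= f w <= 1) -> (forall w, ~ K w -> f w = 0) -> mean A f <= fine (m (K `&` A)).
Proof.
move=> mA mK cf f01 f0; rewrite -mean_indic //; apply: le_Rintegral => //.
- exact: cont_integrable.
- exact: indic_integrable.
- move=> w _; rewrite indicE; case: (pselect (K w)) => Kw.
    by rewrite mem_set //; case/andP: (f01 w).
  by rewrite f0 // ler0n.
Qed.

Lemma measure_le_mean A (K : set (Borel Om)) f : measurable A -> measurable K -> continuous f ->
  (forall w, 0 <= f w) -> (forall w, K w -> 1 <= f w) -> fine (m (K `&` A)) <= mean A f.
Proof.
move=> mA mK cf f0 f1; rewrite -mean_indic //; apply: le_Rintegral => //.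
- exact: indic_integrable.
- exact: cont_integrable.
- move=> w _; rewrite indicE; case: (pselect (K w)) => Kw.
    by rewrite mem_set //; exact: f1.
  by rewrite memNset.
Qed.

Lemma fine_measure_le1 A : measurable A -> fine (m A) <= 1.
Proof.
move=> mA; rewrite -lee_fin fineK ?fin_num_measure //; exact: probability_le1.
Qed.

Lemma integral_mean f : continuous f -> (\int[m]_w (f w)%:E)%E = (mean setT f)%:E.
Proof.
move=> cf; rewrite /mean /Rintegral fineK //.
by apply: integrable_fin_num => //; exact: (cont_integrable cf).
Qed.

End BorelIntegral.

Section ErgodicMeasure.
Context {R : realType} {Om : pseudoPMetricType R}.
Hypothesis hsep : hausdorff_space Om.
Hypothesis hcpt : compact [set: Om].
Variable sigma : R -> Om -> Om.
Hypothesis hsigma : is_cont_flow sigma.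
Implicit Types (f h : Om -> R) (K U : set Om) (L : (Om -> R) -> R).

Definition invariant_mean L := [/\ linear_functional L,
  forall f, continuous f -> (forall w, 0 <= f w) -> 0 <= L f, L (fun=> 1) = 1 &
  forall t f, continuous f -> L (fun w => f (sigma t w)) = L f].

Lemma dominated_invariant L : linear_functional L -> functional_le L (upper_mean sigma) ->
  invariant_mean L.
Proof.
move=> Llin Lp; case: (Llin) => LD LZ.
have cst1 : continuous (fun _ : Om => 1 : R) by exact: cont_cst.
have L1 : L (fun=> 1) = 1.
  apply/eqP; rewrite eq_le; apply/andP; split.
    by apply: (le_trans (Lp _ cst1)); apply: upper_mean_ub.
  have := Lp _ (cont_fscale (-1) cst1); rewrite LZ //.
  have : upper_mean sigma (fscale (-1) (fun _ : Om => 1)) <= -1.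
    by apply: upper_mean_ub => //; [exact: cont_fscale|move=> w; rewrite /fscale mulr1].
  lra.
have Linv_le t f : continuous f -> L (fun w => f (sigma t w)) <= L f.
  move=> cf; rewrite -subr_le0.
  have cft := cont_shift hsigma t cf.
  have -> : L (fun w => f (sigma t w)) - L f = L (fadd (fun w => f (sigma t w)) (fscale (-1) f)).
    by rewrite LD ?LZ ?mulN1r //; exact: cont_fscale.
  set h := fadd _ _; have ch : continuous h by apply: cont_fadd => //; exact: cont_fscale.
  apply: (le_trans (Lp h ch)).
  have [C [C0 fC]] := compact_bounded hcpt cf.
  apply/ler_addgt0Pr => e e0; rewrite add0r.
  pose n := Num.truncn ((2 * C) / e).
  have n0 : (0 : R) < n.+1%:R by rewrite ltr0n.
  have Hn : 2 * C <= e * n.+1%:R.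
    rewrite [e * _]mulrC -ler_pdivrMr //; apply: ltW.
    by have /truncn_itv/andP[] : 0 <= 2 * C / e by rewrite divr_ge0 ?mulr_ge0 // ltW.
  apply: (@upper_mean_le _ _ _ hcpt _ _ [seq i%:R * t | i <- iota 0 n.+1]) => //.
  move=> w; rewrite /avg size_map size_iota ler_pdivrMl // big_map.
  have -> : \sum_(i <- iota 0 n.+1) h (sigma (i%:R * t) w)
     = f (sigma (n.+1%:R * t) w) - f w.
    rewrite -[iota 0 n.+1]/(index_iota 0 n.+1).
    elim: {Hn n0} n.+1 => [|k IH].
      by rewrite big_nil mul0r sigma0 // subrr.
    rewrite big_nat_recr //= IH /h /fadd /fscale -sigmaD // -natr1 mulrDl mul1r.
    ring.
  rewrite [X in _ <= X]mulrC; apply: le_trans Hn.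
  have := fC (sigma (n.+1%:R * t) w); have := fC w.
  by rewrite !ler_norml => /andP[? ?] /andP[? ?]; lra.
split => //.
- move=> f cf f0; have := Lp _ (cont_fscale (-1) cf); rewrite LZ //.
  have : upper_mean sigma (fscale (-1) f) <= 0.
    by apply: upper_mean_ub => //; [exact: cont_fscale|move=> w; rewrite /fscale mulN1r oppr_le0].
  lra.
- move=> t f cf; apply/eqP; rewrite eq_le Linv_le //=.
  have := Linv_le (- t) _ (cont_shift hsigma t cf).
  by congr (L _ <= _); apply/funext => w; rewrite sigmaNK.
Qed.

Lemma invariant_dominated L : invariant_mean L -> functional_le L (upper_mean sigma).
Proof.
move=> [Llin Lpos L1 Linv] f cf; case: (Llin) => LD LZ.
apply: lb_le_inf; first by case: (upper_mean_has_inf sigma hcpt cf).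
move=> M [ts [ts0 HM]].
have [cS HS] : continuous (fun w => \sum_(t <- ts) f (sigma t w)) /\
    L (fun w => \sum_(t <- ts) f (sigma t w)) = (size ts)%:R * L f.
  elim: ts {ts0 HM} => [|t ts [cIH IH]].
    have -> : (fun w => \sum_(t <- [::]) f (sigma t w)) = fscale 0 f.
      by apply/funext => w; rewrite big_nil /fscale mul0r.
    by split; [exact: cont_fscale|rewrite LZ].
  have -> : (fun w => \sum_(t0 <- t :: ts) f (sigma t0 w)) =
    fadd (fun w => f (sigma t w)) (fun w => \sum_(t <- ts) f (sigma t w)).
    by apply/funext => w; rewrite big_cons.
  have ct := cont_shift hsigma t cf.
  split; first exact: cont_fadd.
  by rewrite LD // Linv // IH /= -natr1; ring.
have n0 : (0 : R) < (size ts)%:R by rewrite ltr0n.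
rewrite -(ler_pM2l n0) -HS.
have -> : (size ts)%:R * M = L (fscale ((size ts)%:R * M) (fun=> 1)).
  by rewrite LZ ?L1 ?mulr1 //; exact: cont_cst.
apply: functional_mono => //; first by apply: cont_fscale; exact: cont_cst.
by move=> w; rewrite /fscale mulr1 -ler_pdivrMl //; exact: HM.
Qed.

Lemma riesz_representation L : linear_functional L ->
  (forall f, continuous f -> (forall w, 0 <= f w) -> 0 <= L f) -> L (fun=> 1) = 1 ->
  exists m : probability (Borel Om) R,
    (forall A, m A = (riesz_outer L A)%:E) /\ (forall f, continuous f -> mean m setT f = L f).
Proof.
move=> Llin Lpos L1.
pose m := riesz_probability hsep hcpt Llin Lpos L1.
have mE A : m A = (riesz_outer L A)%:E by [].
exists m; split => // f cf; apply/esym.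
have mT : fine (m setT) = 1 by rewrite probability_setT.
apply: (layer_cake_eq hcpt (c := kappa L)) => //.
- exact: mean_linear.
- by move=> h _ h0; exact: mean_ge0.
- by move=> K _; apply: kappa_le1.
- move=> K h cK ch h01 h0; apply: kappa_lb => // u cu u0 u1.
  apply: functional_mono => // w; case: (pselect (K w)) => Kw.
    by apply: le_trans (u1 w Kw); case/andP: (h01 w).
  by rewrite h0.
- move=> K h cK ch h01 h1.
  have -> : kappa L K = fine (m (K `&` setT)).
    by rewrite setIT mE /= outer_closed.
  apply: measure_le_mean => //; try exact: closed_borel.
  by move=> w; case/andP: (h01 w).
- by rewrite L1 mean_cst // mT.
Qed.

Lemma kappa_shift L t K : invariant_mean L -> kappa L (sigma t @^-1` K) <= kappa L K.
Proof.
move=> [Llin Lpos L1 Linv]; apply: kappa_lb => // f cf f0 f1.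
rewrite -(Linv t f cf); apply: kappa_le => //; first exact: (cont_shift hsigma t cf).
by move=> w; exact: f1.
Qed.

Lemma outer_shift_le L t (A : set Om) : invariant_mean L ->
  riesz_outer L (sigma t @^-1` A) <= riesz_outer L A.
Proof.
move=> iL; case: (iL) => Llin Lpos L1 _; apply: outer_lb => // U oU AU.
apply: (@le_trans _ _ (inner_kappa L (sigma t @^-1` U))).
  apply: outer_le => //; last by move=> w /AU.
  by apply: open_comp => // w _; exact: sigma_cont_pt.
apply: inner_ub => // K cK KU.
apply: (@le_trans _ _ (kappa L (sigma (- t) @^-1` K))).
  apply: le_trans (kappa_shift t (sigma (- t) @^-1` K) iL).
  by apply: kappa_mono => // w Kw /=; rewrite sigmaKN.
apply: kappa_inner => //.
  by apply: closed_comp => // w _; exact: sigma_cont_pt.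
by move=> w /KU /=; rewrite sigmaNK.
Qed.

Lemma outer_shift L t (A : set Om) : invariant_mean L ->
  riesz_outer L (sigma t @^-1` A) = riesz_outer L A.
Proof.
move=> iL; apply/eqP; rewrite eq_le outer_shift_le //=.
have := outer_shift_le (- t) (sigma t @^-1` A) iL.
by congr (riesz_outer L _ <= _); apply/seteqP; split=> w /=; rewrite sigmaNK.
Qed.

Lemma mean_shift (m : probability (Borel Om) R) (A : set (Borel Om)) t f :
  (forall (t : R) (A : set (Borel Om)), measurable A -> m (sigma t @^-1` A) = m A) ->
  measurable A -> (forall t, sigma t @^-1` A = A) -> continuous f ->
  mean m A (fun w => f (sigma t w)) = mean m A f.
Proof.
move=> minv mA Ainv cf.
have [mD mZ] := mean_linear hcpt m mA.
apply: (@layer_cake_eq R Om hcpt (fun f => mean m A (fun w => f (sigma t w))) (mean m A)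
  (fun K => fine (m (K `&` A)))) => //.
- split=> [h1 h2 c1 c2|a h ch].
    by rewrite -(mD _ _ (cont_shift hsigma t c1) (cont_shift hsigma t c2)).
  by rewrite -(mZ a _ (cont_shift hsigma t ch)).
- by move=> h _ h0; exact: mean_ge0.
- move=> K cK; apply: fine_measure_le1; apply: measurableI => //; exact: closed_borel.
- move=> K h cK ch h01 h0.
  have mK : measurable (K : set (Borel Om)) by exact: closed_borel.
  have cs : continuous (sigma t) by exact: sigma_cont_pt.
  rewrite -(minv t (K `&` A)); last exact: measurableI.
  rewrite preimage_setI Ainv; apply: mean_le_measure => //.
  + exact: cont_borel_map.
  + exact: (cont_shift hsigma t ch).
  + by move=> w Kw; apply: h0.
- move=> K h cK ch h01 h1; apply: measure_le_mean => //; try exact: closed_borel.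
  by move=> w; case/andP: (h01 w).
Qed.

(* A nontrivial invariant set splits the mean into the two conditional means, contradicting
   extremality. *)
Lemma extreme_ergodic L : linear_functional L -> functional_le L (upper_mean sigma) ->
  dominated_face sigma L -> exists m : probability (Borel Om) R,
  ergodic sigma m /\ forall f, continuous f -> mean m setT f = L f.
Proof.
move=> Llin Lp Lface; have iL := dominated_invariant Llin Lp.
case: (iL) => _ Lpos L1 Linv.
have [m [mE mL]] := riesz_representation Llin Lpos L1.
exists m; split => //.
have minv (t : R) (A : set (Borel Om)) : measurable A -> m (sigma t @^-1` A) = m A.
  by move=> _; rewrite !mE outer_shift.
split => // A mA Ainv.
have mfin B : measurable B -> m B = (fine (m B))%:E by move=> mB; rewrite fineK // fin_num_measure.
have mC : measurable (~` A) by exact: measurableC.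
pose a := fine (m A).
have aE : m A = a%:E by rewrite /a -mfin.
have aC : m (~` A) = (1 - a)%:E by rewrite probability_setC // aE.
have a0 : 0 <= a by rewrite -lee_fin -aE.
have a1 : a <= 1 by exact: fine_measure_le1.
have AinvC t : sigma t @^-1` (~` A) = ~` A by rewrite -preimage_setC Ainv.
case: (ltgtP a 0) => [|apos|e0]; [by rewrite ltNge a0| |by left; rewrite aE e0].
case: (ltgtP a 1) => [alt1| |e1]; [|by rewrite ltNge a1|by right; rewrite aE e1].
exfalso.
have b0 : 0 < 1 - a by lra.
have cond (B : set (Borel Om)) (b : R) : measurable B -> (forall t, sigma t @^-1` B = B) ->
    0 < b -> m B = b%:E -> invariant_mean (fun f => b^-1 * mean m B f).
  move=> mB Binv bpos bE; have [mD mZ] := mean_linear hcpt m mB; split.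
  - split=> [f h cf ch|k f cf]; first by rewrite mD // mulrDr.
    by rewrite mZ // mulrCA.
  - by move=> f cf f0; rewrite mulr_ge0 ?mean_ge0 // invr_ge0 ltW.
  - by rewrite mean_cst // bE /= mulVf // gt_eqF.
  - by move=> t f cf; rewrite mean_shift.
have i1 := cond A a mA Ainv apos aE.
have i2 := cond (~` A) (1 - a) mC AinvC b0 aC.
have split_mean f : continuous f -> mean m A f + mean m (~` A) f = L f.
  move=> cf; rewrite -mL // /mean -(setUv A) Rintegral_setU //.
    by rewrite setUv; exact: (cont_integrable hcpt m cf).
  by apply/disj_set2P; rewrite setICr.
have KL : functional_le (fun f => a * (a^-1 * mean m A f) + (1 - a) * ((1 - a)^-1 * mean m (~` A) f)) L.
  by move=> f cf; rewrite !mulrA !divff ?gt_eqF // !mul1r split_mean.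
have a01 : 0 < a < 1 by rewrite apos alt1.
have [l1 _ _ _] := i1; have [l2 _ _ _] := i2.
have [F1 _] := Lface _ _ a a01 l1 l2 (invariant_dominated i1) (invariant_dominated i2) KL.
have eqL f : continuous f -> mean m A f = a * L f.
  move=> cf; have := F1 f cf; have := F1 _ (cont_fscale (-1) cf).
  have [_ mZ] := mean_linear hcpt m mA; case: Llin => _ LZ.
  rewrite mZ // LZ // !ler_pdivrMl // => *.
  by apply/eqP; rewrite eq_le; apply/andP; split; lra.
pose e := (a - a * a) / 4.
have e0 : 0 < e by rewrite /e divr_gt0 // subr_gt0 gtr_pMr.
have [U [oU AU HU]] := outer_approx Lpos L1 (~` A) e0.
pose K := ~` U; have cK : closed K by exact: open_closedC.
have mK : measurable (K : set (Borel Om)) by exact: closed_borel.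
have KA : K `<=` A by move=> w nU; apply: contrapT => nA; apply: nU; exact: AU.
have kK : a - e <= kappa L K.
  have E1 : m K = (1 - inner_kappa L U)%:E.
    by rewrite probability_setC ?mE ?outer_open //; exact: open_borel.
  have E2 : m K = (kappa L K)%:E by rewrite mE outer_closed.
  have : kappa L K = 1 - inner_kappa L U by apply: EFin_inj; rewrite -E1 -E2.
  have : riesz_outer L (~` A) = 1 - a by apply: EFin_inj; rewrite -mE aC.
  move: HU => /=; lra.
have [_ [f [cf f0 f1 ->]] Hf] := inf_adherent e0 (kappa_has_inf Lpos L1 K).
have kA : kappa L K <= a.
  have : (m K <= m A)%E by apply: le_measure => //; rewrite inE.
  by rewrite aE mE outer_closed // lee_fin.
have : fine (m (K `&` A)) <= mean m A f by apply: measure_le_mean.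
rewrite (_ : K `&` A = K); last by apply/setIidPl.
rewrite mE /= outer_closed // eqL //; move: Hf; rewrite -/(kappa L K) => Hf H.
have : a * L f <= a * (a + e) by rewrite ler_pM2l //; lra.
have : a * e <= e by rewrite ler_piMl // ltW.
have E : a - a * a = 4 * e by rewrite /e; field.
by move: H kK E e0; clearbody e; rewrite mulrDr; lra.
Qed.

Lemma uniform_average (u : Om -> R) : continuous u ->
  (forall m : probability (Borel Om) R, ergodic sigma m -> (0 < \int[m]_w (u w)%:E)%E) ->
  exists ts del, [/\ (0 < size ts)%N, 0 < del & forall w, del <= avg sigma ts u w].
Proof.
move=> cu Hu.
have cnu := cont_fscale (-1) cu.
have [L [Llin Lp Lface Lu]] := extreme_functional hsigma hcpt cnu.
have [m [em mL]] := extreme_ergodic Llin Lp Lface.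
have := Hu m em; rewrite (integral_mean hcpt m cu) lte_fin mL // => Lpos.
have neg : upper_mean sigma (fscale (-1) u) < 0.
  by apply: (le_lt_trans Lu); case: Llin => _ ->//; lra.
have [M [ts [ts0 HM]] M0] : exists2 M, (exists ts, (0 < size ts)%N /\
    forall w, avg sigma ts (fscale (-1) u) w <= M) & M < 0.
  have np : 0 < - upper_mean sigma (fscale (-1) u) by lra.
  have [M HM] := inf_adherent np (upper_mean_has_inf sigma hcpt cnu).
  by rewrite -/(upper_mean sigma _) subrr => M0; exists M.
exists ts, (- M); split => //; first by lra.
by move=> w; have := HM w; rewrite avgZ; lra.
Qed.

(* Averaging the primitive over the finitely many shifts makes the pointwise lower bound of
   the averages a lower bound of a derivative. *)
Lemma uniform_growth (u : Om -> R) : continuous u ->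
  (forall m : probability (Borel Om) R, ergodic sigma m -> (0 < \int[m]_w (u w)%:E)%E) ->
  exists del C, 0 < del /\ forall w (P : R -> R), 
    (forall t : R, is_derive t 1 P (u (sigma t w))) ->
    forall s t, s <= t -> del * (t - s) - C <= P t - P s.
Proof.
move=> cu Hu; have [ts [del [ts0 del0 Hdel]]] := uniform_average cu Hu.
have [B [B0 uB]] := compact_bounded hcpt cu.
pose T := \sum_(x <- ts) `|x|; pose n : R := (size ts)%:R.
have n0 : 0 < n by rewrite ltr0n.
exists del, (2 * B * T); split => // w P HP s t st.
pose Q r := n^-1 * \sum_(x <- ts) P (r + x).
have HQ (r : R) : is_derive r 1 Q (avg sigma ts u (sigma r w)).
  apply: derMl; rewrite /avg; elim: (ts) => [|x xs IH].
    rewrite big_nil (_ : (fun s0 => _) = fun=> 0); first exact: der_cst.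
    by apply/funext => y; rewrite big_nil.
  rewrite big_cons (_ : (fun s0 => _) = fun y => P (y + x) + \sum_(x <- xs) P (y + x)).
    apply: derD => //; apply: der_shift; rewrite -sigmaD //; exact: HP.
  by apply/funext => y; rewrite big_cons.
have gQ : del * (t - s) <= Q t - Q s.
  rewrite mulrBr; apply: (@der_le R (fun r => del * r) (fun=> del * 1) Q _ s t st) => //.
  by move=> r _; rewrite mulr1; exact: Hdel.
have dQ r : `|Q r - P r| <= B * T.
  have -> : Q r - P r = n^-1 * \sum_(x <- ts) (P (r + x) - P r).
    rewrite sumrB /Q mulrBr big_const_seq count_predT iter_addr_0 -[_ *+ size ts]mulr_natr.
    by rewrite mulrCA -/n mulVf ?mulr1 // gt_eqF.
  rewrite normrM gtr0_norm ?invr_gt0 // ler_pdivrMl //.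
  apply: (le_trans (ler_norm_sum _ _ _)).
  have BT : 0 <= B * T by rewrite mulr_ge0 // sumr_ge0.
  have n1 : 1 <= n by rewrite ler1n.
  apply: (@le_trans _ _ (B * T)); last by rewrite ler_peMl.
  rewrite /T mulr_sumr; apply: ler_sum => x _.
  have := @der_bound_abs R P _ r (r + x) B HP (fun t => uB _).
  by rewrite [r + x]addrC addrK.
have := dQ t; have := dQ s; rewrite !ler_norml => /andP[? ?] /andP[? ?]; lra.
Qed.

Lemma ae_zero_growth (D : Om -> R) (e : R) : continuous D -> 0 < e ->
  (forall m : probability (Borel Om) R, ergodic sigma m -> full_meas m [set w | D w = 0]) ->
  exists C, forall w (P : R -> R), (forall t : R, is_derive t 1 P (D (sigma t w))) ->
    forall s t, s <= t -> P t - P s <= e * (t - s) + C.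
Proof.
move=> cD e0 HD.
pose u w := e - D w.
have cu : continuous u by move=> w; apply: cvgB; [exact: cvg_cst|exact: cD].
have [|del [C [del0 H]]] := uniform_growth cu.
  move=> m em; have := HD m em => ae0.
  rewrite (@ae_eq_integral _ _ _ m setT (fun=> e%:E) (fun w => (u w)%:E)) //.
  - rewrite integral_cst // [X in (_ * X)%E](_ : _ = 1%E); last exact: probability_setT.
    by rewrite mule1 lte_fin.
  - apply/measurable_realfun.measurable_EFinP; exact: (cont_measurable cu).
  - case: ae0 => Z [mZ Z0 sZ]; exists Z; split => // w nw; apply: sZ => /= Dw.
    by apply: nw => _; rewrite /u Dw subr0.
exists C => w P HP s t st.
have := H w (fun r => e * r - P r) _ s t st.
have HQ (r : R) : is_derive r 1 (fun r => e * r - P r) (u (sigma r w)).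
  by apply: (is_derive_eq (derB (derMl e (der_id r)) (HP r))); rewrite mulr1.
move=> /(_ HQ); have : 0 <= del * (t - s) by rewrite mulr_ge0 ?(ltW del0) ?subr_ge0.
by lra.
Qed.

End ErgodicMeasure.

Section Subequilibria.
Context {R : realType} {Om : pseudoPMetricType R}.
Variables (sigma : R -> Om -> Om) (N : Om -> R -> R) (B L : R).
Hypothesis hsigma : is_cont_flow sigma.
Hypothesis HN : nice_field N B L.
Implicit Types (b db : Om -> R) (lam eta x T t s : R) (w : Om).

Local Notation phi := (phi sigma N).

Definition along b db := forall w (t : R), is_derive t 1 (fun s => b (sigma s w)) (db (sigma t w)).

Definition gain T : R := T * expR (- L * T).

Lemma gain_ge0 T : 0 <= T -> 0 <= gain T.
Proof. by move=> T0; rewrite /gain mulr_ge0 ?expR_ge0. Qed.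

Lemma gain1_gt0 : 0 < gain 1.
Proof. by rewrite /gain mulr_gt0 ?expR_gt0. Qed.

Lemma sub_fwd b db lam eta w x T : along b db -> 0 <= eta ->
  (forall w, db w + eta <= N w (b w) + lam) -> 0 <= T -> b w <= x ->
  b (sigma T w) + eta * gain T <= phi lam w x T.
Proof.
move=> Hb eta0 Hs T0 bx.
apply: (@compare_fwd _ _ sigma N B L HN w (fun t => b (sigma t w)) (fun t => db (sigma t w)) (phi lam w x)
  (fun t => N (sigma t w) (phi lam w x t) + lam) eta T T0 eta0 (Hb w)).
- by move=> t; exact: (phi_der hsigma HN).
- by move=> t _; have := Hs (sigma t w); lra.
- by rewrite (phi0 hsigma HN) sigma0.
Qed.

Lemma sub_bwd b db lam eta w x T : along b db -> 0 <= eta ->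
  (forall w, db w + eta <= N w (b w) + lam) -> 0 <= T -> x <= b w ->
  phi lam w x (- T) + eta * gain T <= b (sigma (- T) w).
Proof.
move=> Hb eta0 Hs T0 bx.
apply: (@compare_bwd _ _ sigma N B L HN w (phi lam w x)
  (fun t => N (sigma t w) (phi lam w x t) + lam) (fun t => b (sigma t w)) (fun t => db (sigma t w)) eta T T0 eta0).
- by move=> t; exact: (phi_der hsigma HN).
- exact: (Hb w).
- by move=> t _; have := Hs (sigma t w); lra.
- by rewrite (phi0 hsigma HN) sigma0.
Qed.

Lemma super_fwd b db lam eta w x T : along b db -> 0 <= eta ->
  (forall w, N w (b w) + lam + eta <= db w) -> 0 <= T -> x <= b w ->
  phi lam w x T + eta * gain T <= b (sigma T w).
Proof.
move=> Hb eta0 Hs T0 bx.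
apply: (@compare_fwd _ _ sigma N B L HN w (phi lam w x)
  (fun t => N (sigma t w) (phi lam w x t) + lam) (fun t => b (sigma t w)) (fun t => db (sigma t w)) eta T T0 eta0).
- by move=> t; exact: (phi_der hsigma HN).
- exact: (Hb w).
- by move=> t _; have := Hs (sigma t w); lra.
- by rewrite (phi0 hsigma HN) sigma0.
Qed.

Lemma super_bwd b db lam eta w x T : along b db -> 0 <= eta ->
  (forall w, N w (b w) + lam + eta <= db w) -> 0 <= T -> b w <= x ->
  b (sigma (- T) w) + eta * gain T <= phi lam w x (- T).
Proof.
move=> Hb eta0 Hs T0 bx.
apply: (@compare_bwd _ _ sigma N B L HN w (fun t => b (sigma t w)) (fun t => db (sigma t w)) (phi lam w x)
  (fun t => N (sigma t w) (phi lam w x t) + lam) eta T T0 eta0 (Hb w)).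
- by move=> t; exact: (phi_der hsigma HN).
- by move=> t _; have := Hs (sigma t w); lra.
- by rewrite (phi0 hsigma HN) sigma0.
Qed.

Definition fwd lam b t w := phi lam (sigma (- t) w) (b (sigma (- t) w)) t.
Definition bwd lam b t w := phi lam (sigma t w) (b (sigma t w)) (- t).

Definition subeq lam b := exists db, along b db /\ forall w, db w <= N w (b w) + lam.

Lemma subeq_fwd lam b w x T : subeq lam b -> 0 <= T -> b w <= x -> b (sigma T w) <= phi lam w x T.
Proof.
move=> [db [Hb Hs]] T0 bx; have := @sub_fwd b db lam 0 w x T Hb (lexx 0).
by rewrite mul0r addr0; apply => // v; rewrite addr0.
Qed.

Lemma subeq_bwd lam b w x T : subeq lam b -> 0 <= T -> x <= b w -> phi lam w x (- T) <= b (sigma (- T) w).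
Proof.
move=> [db [Hb Hs]] T0 bx; have := @sub_bwd b db lam 0 w x T Hb (lexx 0).
by rewrite mul0r addr0; apply => // v; rewrite addr0.
Qed.

Lemma fwd_mono lam b s t w : subeq lam b -> 0 <= s -> s <= t -> fwd lam b s w <= fwd lam b t w.
Proof.
move=> sb s0 st; rewrite /fwd.
have -> : phi lam (sigma (- t) w) (b (sigma (- t) w)) t =
  phi lam (sigma (- s) w) (phi lam (sigma (- t) w) (b (sigma (- t) w)) (t - s)) s.
  have -> : sigma (- s) w = sigma (t - s) (sigma (- t) w).
    by rewrite -sigmaD //; congr sigma; ring.
  by rewrite -(phiD hsigma HN) subrK.
apply: (phi_le hsigma HN).
have -> : b (sigma (- s) w) = b (sigma (t - s) (sigma (- t) w)).
  by rewrite -sigmaD //; congr (b (sigma _ _)); ring.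
by apply: subeq_fwd; rewrite ?subr_ge0.
Qed.

Lemma bwd_mono lam b s t w : subeq lam b -> 0 <= s -> s <= t -> bwd lam b t w <= bwd lam b s w.
Proof.
move=> sb s0 st; rewrite /bwd.
have -> : phi lam (sigma t w) (b (sigma t w)) (- t) =
  phi lam (sigma s w) (phi lam (sigma t w) (b (sigma t w)) (- (t - s))) (- s).
  have -> : sigma s w = sigma (- (t - s)) (sigma t w).
    by rewrite -sigmaD //; congr sigma; ring.
  by rewrite -(phiD hsigma HN); congr phi; ring.
apply: (phi_le hsigma HN).
have -> : b (sigma s w) = b (sigma (- (t - s)) (sigma t w)).
  by rewrite -sigmaD //; congr (b (sigma _ _)); ring.
by apply: subeq_bwd; rewrite ?subr_ge0.
Qed.

Definition low lam b w : R := sup [set x | exists2 t, 0 <= t & x = fwd lam b t w].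
Definition high lam b w : R := inf [set x | exists2 t, 0 <= t & x = bwd lam b t w].

Definition fwd_bounded lam b := exists C, forall t w, 0 <= t -> fwd lam b t w <= C.
Definition bwd_bounded lam b := exists C, forall t w, 0 <= t -> C <= bwd lam b t w.

Definition invariant lam (l : Om -> R) := forall w t, phi lam w (l w) t = l (sigma t w).

Lemma low_has_sup lam b w : fwd_bounded lam b ->
  has_sup [set x | exists2 t, 0 <= t & x = fwd lam b t w].
Proof.
move=> [C HC]; split; first by exists (fwd lam b 0 w); exists 0.
by exists C => _ [t t0 ->]; exact: HC.
Qed.

Lemma high_has_inf lam b w : bwd_bounded lam b ->
  has_inf [set x | exists2 t, 0 <= t & x = bwd lam b t w].
Proof.
move=> [C HC]; split; first by exists (bwd lam b 0 w); exists 0.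
by exists C => _ [t t0 ->]; exact: HC.
Qed.

Lemma fwd_low lam b t w : fwd_bounded lam b -> 0 <= t -> fwd lam b t w <= low lam b w.
Proof. by move=> fb t0; apply: ub_le_sup; [case: (low_has_sup w fb)|exists t]. Qed.

Lemma high_bwd lam b t w : bwd_bounded lam b -> 0 <= t -> high lam b w <= bwd lam b t w.
Proof. by move=> fb t0; apply: ge_inf; [case: (high_has_inf w fb)|exists t]. Qed.

Lemma low_ub lam b w x : fwd_bounded lam b -> (forall t, 0 <= t -> fwd lam b t w <= x) -> low lam b w <= x.
Proof.
move=> fb H; apply: ge_sup; first by case: (low_has_sup w fb).
by move=> _ [t t0 ->]; exact: H.
Qed.

Lemma high_lb lam b w x : bwd_bounded lam b -> (forall t, 0 <= t -> x <= bwd lam b t w) -> x <= high lam b w.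
Proof.
move=> fb H; apply: lb_le_inf; first by case: (high_has_inf w fb).
by move=> _ [t t0 ->]; exact: H.
Qed.

Lemma low_invariant lam b : subeq lam b -> fwd_bounded lam b -> invariant lam (low lam b).
Proof.
move=> sb fb.
have H w t : phi lam w (low lam b w) t <= low lam b (sigma t w).
  apply/ler_addgt0Pr => e e0.
  have [del [del0 Hdel]] := phi_cont_unif hsigma HN (normr_ge0 t) e0.
  have [_ [s s0 ->] Hs] := sup_adherent del0 (low_has_sup w fb).
  pose s' := Num.max s `|t|.
  have s'0 : 0 <= s' by rewrite le_max s0.
  have ss' : s <= s' by rewrite le_max lexx.
  have ts' : `|t| <= s' by rewrite le_max lexx orbT.
  have h1 := fwd_mono w sb s0 ss'.
  have h2 : fwd lam b s' w <= low lam b w by exact: fwd_low.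
  have h3 : `|low lam b w - fwd lam b s' w| <= del.
    by rewrite ger0_norm ?subr_ge0 //; move: Hs; rewrite -/(low lam b w); lra.
  have := Hdel lam lam w _ _ t (lexx _) h3; rewrite subrr normr0 => /(_ (ltW del0)).
  rewrite ler_norml => /andP[_ h4].
  have : phi lam w (fwd lam b s' w) t <= low lam b (sigma t w).
    have -> : phi lam w (fwd lam b s' w) t = fwd lam b (s' + t) (sigma t w).
      rewrite /fwd; have -> : sigma (- (s' + t)) (sigma t w) = sigma (- s') w.
        by rewrite -sigmaD //; congr (sigma _ w); ring.
      by rewrite (phiD hsigma HN) sigmaNK.
    by apply: fwd_low => //; move: ts'; rewrite ler_norml => /andP[]; lra.
  lra.
move=> w t; apply/eqP; rewrite eq_le H /=.
have := phi_le hsigma HN lam w t (H (sigma t w) (- t)).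
rewrite sigmaKN //.
by have := phiNK hsigma HN lam (sigma t w) (low lam b (sigma t w)) t; rewrite sigmaKN // => ->.
Qed.

Lemma high_invariant lam b : subeq lam b -> bwd_bounded lam b -> invariant lam (high lam b).
Proof.
move=> sb fb.
have H w t : high lam b (sigma t w) <= phi lam w (high lam b w) t.
  apply/ler_addgt0Pr => e e0.
  have [del [del0 Hdel]] := phi_cont_unif hsigma HN (normr_ge0 t) e0.
  have [_ [s s0 ->] Hs] := inf_adherent del0 (high_has_inf w fb).
  pose s' := Num.max s `|t|.
  have s'0 : 0 <= s' by rewrite le_max s0.
  have ss' : s <= s' by rewrite le_max lexx.
  have ts' : `|t| <= s' by rewrite le_max lexx orbT.
  have h1 := bwd_mono w sb s0 ss'.
  have h2 : high lam b w <= bwd lam b s' w by exact: high_bwd.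
  have h3 : `|bwd lam b s' w - high lam b w| <= del.
    by rewrite ger0_norm ?subr_ge0 //; move: Hs; rewrite -/(high lam b w); lra.
  have := Hdel lam lam w _ _ t (lexx _) h3; rewrite subrr normr0 => /(_ (ltW del0)).
  rewrite ler_norml => /andP[_ h4].
  have : high lam b (sigma t w) <= phi lam w (bwd lam b s' w) t.
    have -> : phi lam w (bwd lam b s' w) t = bwd lam b (s' - t) (sigma t w).
      rewrite /bwd; have -> : sigma (s' - t) (sigma t w) = sigma s' w.
        by rewrite -sigmaD //; congr (sigma _ w); ring.
      have -> : - (s' - t) = - s' + t by ring.
      by rewrite (phiD hsigma HN) sigmaKN.
    by apply: high_bwd => //; move: ts'; rewrite ler_norml => /andP[]; lra.
  lra.
move=> w t; apply/eqP; rewrite eq_le H andbT.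
have := phi_le hsigma HN lam w t (H (sigma t w) (- t)).
rewrite sigmaKN //.
by have := phiNK hsigma HN lam (sigma t w) (high lam b (sigma t w)) t; rewrite sigmaKN // => ->.
Qed.

Lemma invariant_along lam l : invariant lam l -> along l (fun w => N w (l w) + lam).
Proof.
move=> il w t; have -> : (fun s => l (sigma s w)) = phi lam w (l w).
  by apply/funext => s; rewrite il.
by rewrite -il; exact: (phi_der hsigma HN).
Qed.

Lemma uniform_limit_cont (h : nat -> Om -> R) (l : Om -> R) : (forall n, continuous (h n)) ->
  (forall e, 0 < e -> exists n, forall w, `|h n w - l w| <= e) -> continuous l.
Proof.
move=> ch Hl w0; apply/cvgrPdist_le => /= e e0.
have e3 : 0 < e / 3 by rewrite divr_gt0.
have [n Hn] := Hl _ e3.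
near=> w.
have h1 : `|h n w0 - h n w| <= e / 3.
  by near: w; have := ch n w0; move/cvgrPdist_le; exact.
have := ler_distD (h n w0) (l w0) (l w); have := ler_distD (h n w) (h n w0) (l w).
have := Hn w; have := Hn w0; rewrite (distrC (h n w0) (l w0)); lra.
Unshelve. all: by end_near. Qed.

Lemma exp_small (k beta e : R) : 0 < beta -> 0 < e -> exists n : nat, k * expR (- (beta * n.+1%:R)) <= e.
Proof.
move=> beta0 e0; pose n := Num.truncn (`|k| / (beta * e)).
exists n; set x := beta * _.
have x0 : 0 < x by rewrite mulr_gt0.
have kx : `|k| <= e * x.
  have be : 0 < beta * e by rewrite mulr_gt0.
  have : `|k| / (beta * e) < n.+1%:R.
    by have /truncn_itv/andP[] : 0 <= `|k| / (beta * e) by rewrite divr_ge0 // ltW.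
  by rewrite ltr_pdivrMr // /x => /ltW; rewrite mulrCA mulrA mulrC [beta * _]mulrC mulrA.
apply: (@le_trans _ _ (`|k| * expR (- x))).
  by rewrite ler_wpM2r ?expR_ge0 // ler_norm.
rewrite expRN ler_pdivrMr ?expR_gt0 //; apply: (le_trans kx).
by rewrite ler_pM2l //; have := expR_ge1Dx x; lra.
Qed.

End Subequilibria.

Section Contraction.
Context {R : realType} {Om : pseudoPMetricType R}.
Variables (sigma : R -> Om -> Om) (N : Om -> R -> R) (B L : R).
Hypothesis hsigma : is_cont_flow sigma.
Hypothesis HN : nice_field N B L.
Variables (b1 db1 rho drho D : Om -> R) (C0 lam1 lam2 : R).
Hypothesis Hb1 : along sigma b1 db1.
Hypothesis Hb1e : forall w, db1 w = N w (b1 w) + lam2.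
Hypothesis Hrho : along sigma rho drho.
Hypothesis Hrs : forall w, drho w <= N w (rho w) + lam1.
Hypothesis l12 : lam1 < lam2.
Hypothesis C00 : 0 < C0.
Hypothesis b1C : forall w, `|b1 w| <= C0.
Hypothesis rhoC : forall w, `|rho w| <= C0.
Hypothesis cD : continuous D.
Hypothesis DG : forall e, 0 < e -> exists C, forall w (P : R -> R),
  (forall t : R, is_derive t 1 P (D (sigma t w))) ->
  forall s t, s <= t -> P t - P s <= e * (t - s) + C.
Hypothesis Hdef : forall w y l m, b1 w <= y <= rho w -> b1 w <= l -> l < m -> m < rho w ->
  y != l -> y != m ->
  (N w y - N w l) / (y - l) + (N w (rho w) - N w m) / (rho w - m) <=
  (N w y - N w m) / (y - m) + (N w (rho w) - N w l) / (rho w - l) + 2 * D w.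
Implicit Types (lam x T t s gam : R) (l m : Om -> R) (w : Om).

Local Notation phi := (phi sigma N).
Local Notation invariant := (invariant sigma N).

Let W := 2 * C0.
Let W0 : 0 < W. Proof. by rewrite /W mulr_gt0. Qed.

Lemma subeq_b1 lam : lam2 <= lam -> subeq sigma N lam b1.
Proof. by move=> h; exists db1; split => // w; rewrite Hb1e lerD2l. Qed.

Lemma subeq_rho lam : lam2 <= lam -> subeq sigma N lam rho.
Proof. by move=> h; exists drho; split => // w; have := l12; have := Hrs w; lra. Qed.

Lemma band_width w x y : b1 w <= x <= rho w -> b1 w <= y <= rho w -> `|x - y| <= W.
Proof.
have := b1C w; have := rhoC w; rewrite !ler_norml /W => /andP[? ?] /andP[? ?] /andP[? ?] /andP[? ?].
by apply/andP; split; lra.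
Qed.

Lemma band_gap w x : b1 w <= x -> rho w - x <= W.
Proof.
by have := b1C w; have := rhoC w; rewrite !ler_norml /W => /andP[? ?] /andP[? ?]; lra.
Qed.

Lemma ln_sqr_le (a b c d z : R) : a != 0 -> b != 0 -> c != 0 -> d != 0 ->
  ln (a * a) + ln (b * b) <= ln (c * c) + ln (d * d) + 2 * z ->
  `|a| * `|b| <= expR z * (`|c| * `|d|).
Proof.
move=> a0 b0 c0 d0.
have sq (u : R) : u != 0 -> 0 < u * u by move=> u0; rewrite -expr2 exprn_even_gt0.
have sa := sq a a0; have sb := sq b b0; have sc := sq c c0; have sd := sq d d0.
rewrite -lnM ?posrE // -lnM ?posrE // => H.
have : ln (a * a * (b * b)) <= ln ((c * c * (d * d)) * expR (2 * z)).
  have p1 : c * c * (d * d) \is Num.pos by rewrite posrE; exact: mulr_gt0.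
  have p2 : expR (2 * z) \is Num.pos by rewrite posrE expR_gt0.
  by rewrite (lnM p1 p2) expRK.
have q1 : 0 < a * a * (b * b) by exact: mulr_gt0.
have q2 : 0 < c * c * (d * d) * expR (2 * z) by rewrite mulr_gt0 ?expR_gt0 // mulr_gt0.
rewrite ler_ln ?posrE // => {}H.
rewrite -(@ler_pXn2r R 2) ?nnegrE // ?mulr_ge0 ?expR_ge0 //.
have nsq (u : R) : `|u| ^+ 2 = u * u by rewrite real_normK ?num_real // expr2.
rewrite !exprMn !nsq; apply: (le_trans H).
by rewrite -expRM_natl -[X in expR (X * _)]/(2 : R) mulrC.
Qed.

(* [ln (|y - l| (rho - m) / (|y - m| (rho - l)))] is a Lyapunov function: d-concavity makes its
   derivative at most [2 D], and the strictness of the subequilibrium [rho] adds a negative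
   constant that does not depend on [y]. *)
Lemma cross_ratio_decay gam : 0 < gam -> exists k kap, [/\ 0 < k, 0 < kap &
  forall lam l m w x T, lam2 <= lam -> invariant lam l -> invariant lam m ->
  (forall w, b1 w <= l w) -> (forall w, l w + gam <= m w) -> (forall w, m w + gam <= rho w) ->
  0 <= T -> b1 w <= x -> phi lam w x T <= rho (sigma T w) ->
  `|phi lam w x T - l (sigma T w)| * `|x - m w| <=
  k * expR (- (kap * T)) * (`|x - l w| * `|phi lam w x T - m (sigma T w)|)].
Proof.
move=> gam0; pose eta := lam2 - lam1; have eta0 : 0 < eta by rewrite subr_gt0.
pose kap := eta * gam / (W * W).
have kap0 : 0 < kap by apply: divr_gt0; exact: mulr_gt0.
have k4 : 0 < kap / 4 by rewrite divr_gt0.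
have [C HC] := DG k4.
exists (expR (2 * ln W - 2 * ln gam + 2 * C)), (kap / 2); split; [exact: expR_gt0|exact: divr_gt0|].
move=> lam l m w x T lam2l il im b1l lm mrho T0 b1x yT.
case: (eqVneq x (l w)) => [->|xl].
  by rewrite il subrr normr0 mul0r !mulr_ge0 ?expR_ge0.
case: (eqVneq x (m w)) => [->|xm].
  by rewrite [X in _ * `|X|]subrr normr0 mulr0 !mulr_ge0 ?expR_ge0.
pose y := phi lam w x.
have yl t : y t != l (sigma t w).
  by apply: contraNneq xl; rewrite -il => /(phi_inj hsigma HN) ->.
have ym t : y t != m (sigma t w).
  by apply: contraNneq xm; rewrite -im => /(phi_inj hsigma HN) ->.
have band t : 0 <= t <= T -> b1 (sigma t w) <= y t <= rho (sigma t w).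
  move=> /andP[t0 tT]; apply/andP; split.
    exact: (subeq_fwd hsigma HN (subeq_b1 lam2l)).
  have Tt : 0 <= T - t by rewrite subr_ge0.
  have := subeq_bwd hsigma HN (subeq_rho lam2l) Tt yT.
  rewrite -(phiD hsigma HN) -sigmaD //.
  by have -> : T + - (T - t) = t by ring.
have [P [P0 HP]] : exists P : R -> R, P 0 = 0 /\ forall t : R, is_derive t 1 P (D (sigma t w)).
  apply: primitive_exists => t; apply: continuous_comp; last exact: cD.
  exact: (sigma_cont_time hsigma).
have dl := invariant_along hsigma HN il w.
have dm := invariant_along hsigma HN im w.
have dr := Hrho w.
have dy (t : R) : is_derive t 1 y (N (sigma t w) (y t) + lam) by exact: (phi_der hsigma HN).
pose E t := ln ((y t - l (sigma t w)) * (y t - l (sigma t w)))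
  - ln ((y t - m (sigma t w)) * (y t - m (sigma t w)))
  + (2 * ln (rho (sigma t w) - m (sigma t w)) - 2 * ln (rho (sigma t w) - l (sigma t w))).
pose dE t := 2 * (((N (sigma t w) (y t) + lam) - (N (sigma t w) (l (sigma t w)) + lam)) / (y t - l (sigma t w)))
  - 2 * (((N (sigma t w) (y t) + lam) - (N (sigma t w) (m (sigma t w)) + lam)) / (y t - m (sigma t w)))
  + (2 * ((drho (sigma t w) - (N (sigma t w) (m (sigma t w)) + lam)) / (rho (sigma t w) - m (sigma t w)))
   - 2 * ((drho (sigma t w) - (N (sigma t w) (l (sigma t w)) + lam)) / (rho (sigma t w) - l (sigma t w)))).
have HE (t : R) : is_derive t 1 E (dE t).
  have g1 : 0 < rho (sigma t w) - m (sigma t w) by have := mrho (sigma t w); lra.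
  have g2 : 0 < rho (sigma t w) - l (sigma t w).
    by have := mrho (sigma t w); have := lm (sigma t w); lra.
  have n1 : y t - l (sigma t w) != 0 by rewrite subr_eq0.
  have n2 : y t - m (sigma t w) != 0 by rewrite subr_eq0.
  have e1 := @der_lnsqr R (fun t => y t - l (sigma t w)) t _ n1 (derB (dy t) (dl t)).
  have e2 := @der_lnsqr R (fun t => y t - m (sigma t w)) t _ n2 (derB (dy t) (dm t)).
  have e3 := @der_ln R (fun t => rho (sigma t w) - m (sigma t w)) t _ g1 (derB (dr t) (dm t)).
  have e4 := @der_ln R (fun t => rho (sigma t w) - l (sigma t w)) t _ g2 (derB (dr t) (dl t)).
  exact: (derD (derB e1 e2) (derB (derMl 2 e3) (derMl 2 e4))).
pose G t := 4 * P t - 2 * kap * t.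
have HG (t : R) : is_derive t 1 G (4 * D (sigma t w) - 2 * kap * 1).
  exact: (derB (derMl 4 (HP t)) (derMl (2 * kap) (der_id t))).
have EG : E T - E 0 <= G T - G 0.
  apply: (@der_le R E dE G _ 0 T T0 (fun t _ => HE t) (fun t _ => HG t)).
  move=> t tT; rewrite /dE; set v := sigma t w.
  have g1 := mrho v; have g2 := lm v; have bd := band t tT.
  have h0 : l v < m v by lra.
  have h1 : m v < rho v by lra.
  have := Hdef bd (b1l v) h0 h1 (yl t) (ym t).
  have ineq : kap <= (N v (rho v) + lam - drho v) * ((rho v - m v)^-1 - (rho v - l v)^-1).
    have p1 : 0 < rho v - m v by lra.
    have p2 : 0 < rho v - l v by lra.
    have q1 : rho v - m v <= W by apply: band_gap; have := b1l v; lra.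
    have q2 : rho v - l v <= W by exact: band_gap.
    have -> : (rho v - m v)^-1 - (rho v - l v)^-1 = (m v - l v) / ((rho v - m v) * (rho v - l v)).
      by field; rewrite !gt_eqF.
    rewrite /kap -mulrA; apply: ler_pM.
    - exact: ltW.
    - by rewrite divr_ge0 ?ltW // mulr_gt0.
    - by rewrite /eta; have := Hrs v; lra.
    - apply: ler_pM.
      + exact: ltW.
      + by rewrite invr_ge0 mulr_ge0 // ltW.
      + lra.
      + by rewrite lef_pV2 ?posrE ?mulr_gt0 //; apply: ler_pM => //; exact: ltW.
  set Y := N v (y t); set A := (y t - l v)^-1; set A' := (y t - m v)^-1.
  set Z := (rho v - m v)^-1 in ineq *; set Z' := (rho v - l v)^-1 in ineq *.
  set r := N v (rho v) in ineq *; set dr' := drho v in ineq *.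
  set nl := N v (l v); set nm := N v (m v).
  move=> Hd; lra.
have PT := HC w P HP 0 T T0.
have bd0 : b1 w <= x <= rho w.
  have := band 0; rewrite /y (phi0 hsigma HN) sigma0 //; apply; by rewrite lexx.
have E0 : E 0 = ln ((x - l w) * (x - l w)) - ln ((x - m w) * (x - m w))
  + (2 * ln (rho w - m w) - 2 * ln (rho w - l w)).
  by rewrite /E /y (phi0 hsigma HN) sigma0.
have lnb v : [/\ ln (rho v - m v) <= ln W, ln gam <= ln (rho v - m v),
    ln (rho v - l v) <= ln W & ln gam <= ln (rho v - l v)].
  have g1 := mrho v; have g2 := lm v; have g3 := b1l v.
  have p1 : 0 < rho v - m v by lra.
  have p2 : 0 < rho v - l v by lra.
  have q1 : rho v - m v <= W by apply: band_gap; lra.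
  have q2 : rho v - l v <= W by exact: band_gap.
  by split; rewrite ler_ln ?posrE //; lra.
rewrite -expRD; apply: ln_sqr_le; [by rewrite subr_eq0; exact: yl|by rewrite subr_eq0
  |by rewrite subr_eq0|by rewrite subr_eq0; exact: ym|].
have := lnb w; have := lnb (sigma T w) => -[t1 t2 t3 t4] [s1 s2 s3 s4].
move: EG; rewrite E0 /E /G -/y P0 !mulr0; move: PT; rewrite P0 => PT; lra.
Qed.

Lemma attract gam : 0 < gam -> exists k kap, [/\ 1 <= k, 0 < kap &
  forall lam l m w x T, lam2 <= lam -> invariant lam l -> invariant lam m ->
  (forall w, b1 w <= l w) -> (forall w, l w + gam <= m w) -> (forall w, m w + gam <= rho w) ->
  0 <= T -> b1 w <= x -> x <= l w + gam / 2 ->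
  `|phi lam w x T - l (sigma T w)| <= k * expR (- (kap * T)) * `|x - l w|].
Proof.
move=> gam0; have [k [kap [k0 kap0 H]]] := cross_ratio_decay gam0.
pose k' := Num.max 1 (k * W * (2 / gam)).
exists k', kap; split; rewrite // ?le_max ?lexx //.
move=> lam l m w x T lam2l il im b1l lm mrho T0 b1x xl.
have xm : x <= m w by have := lm w; lra.
have ym : phi lam w x T <= m (sigma T w) by rewrite -im; exact: (phi_le hsigma HN).
have yr : phi lam w x T <= rho (sigma T w) by have := mrho (sigma T w); lra.
have yb : b1 (sigma T w) <= phi lam w x T by exact: (subeq_fwd hsigma HN (subeq_b1 lam2l)).
have := H lam l m w x T lam2l il im b1l lm mrho T0 b1x yr.
set a := `|phi lam w x T - l _|; set c := `|x - l w|.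
have g2 : gam / 2 <= `|x - m w| by rewrite distrC ger0_norm ?subr_ge0 //; have := lm w; lra.
have dW : `|phi lam w x T - m (sigma T w)| <= W.
  apply: band_width; apply/andP; split => //;
  by have := b1l (sigma T w); have := lm (sigma T w); have := mrho (sigma T w); lra.
have E0 : 0 < expR (- (kap * T)) by exact: expR_gt0.
have a0 : 0 <= a := normr_ge0 _. have c0 : 0 <= c := normr_ge0 _.
move=> HH.
have h1 : a * (gam / 2) <= k * expR (- (kap * T)) * (c * W).
  apply: (le_trans (ler_wpM2l a0 g2)); apply: (le_trans HH).
  by apply: ler_wpM2l; [rewrite mulr_ge0 ?ltW|apply: ler_wpM2l].
have h2 : a <= k * W * (2 / gam) * expR (- (kap * T)) * c.
  have -> : k * W * (2 / gam) * expR (- (kap * T)) * c = (k * expR (- (kap * T)) * (c * W)) / (gam / 2).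
    by field; rewrite gt_eqF.
  by rewrite ler_pdivlMr // divr_gt0.
apply: (le_trans h2); apply: ler_wpM2r => //; apply: ler_wpM2r; first exact: ltW.
by rewrite /k' le_max lexx orbT.
Qed.

Lemma repel gam : 0 < gam -> exists k kap, [/\ 1 <= k, 0 < kap &
  forall lam l m w x T, lam2 <= lam -> invariant lam l -> invariant lam m ->
  (forall w, b1 w <= l w) -> (forall w, l w + gam <= m w) -> (forall w, m w + gam <= rho w) ->
  0 <= T -> m w - gam / 2 <= x -> x <= rho w ->
  `|phi lam w x (- T) - m (sigma (- T) w)| <= k * expR (- (kap * T)) * `|x - m w|].
Proof.
move=> gam0; have [k [kap [k0 kap0 H]]] := cross_ratio_decay gam0.
pose k' := Num.max 1 (k * W * (2 / gam)).
exists k', kap; split; rewrite // ?le_max ?lexx //.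
move=> lam l m w x T lam2l il im b1l lm mrho T0 mx xr.
pose v := sigma (- T) w; pose y := phi lam w x (- T).
have yT : phi lam v y T = x by exact: (phiNK hsigma HN).
have vT : sigma T v = w by exact: sigmaNK.
have xl : l w <= x by have := lm w; lra.
have yl : l v <= y by rewrite /v -il; exact: (phi_le hsigma HN).
have yr : y <= rho v by exact: (subeq_bwd hsigma HN (subeq_rho lam2l)).
have yb : b1 v <= y by have := b1l v; lra.
have := H lam l m v y T lam2l il im b1l lm mrho T0 yb; rewrite yT vT => /(_ xr).
set a := `|y - m v|; set c := `|x - m w|.
have g2 : gam / 2 <= `|x - l w| by rewrite ger0_norm ?subr_ge0 //; have := lm w; lra.
have dW : `|y - l v| <= W.
  apply: band_width; apply/andP; split => //;
  by have := b1l v; have := lm v; have := mrho v; lra.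
have E0 : 0 < expR (- (kap * T)) by exact: expR_gt0.
have a0 : 0 <= a := normr_ge0 _. have c0 : 0 <= c := normr_ge0 _.
move=> HH.
have h1 : a * (gam / 2) <= k * expR (- (kap * T)) * (c * W).
  apply: (le_trans (ler_wpM2l a0 g2)); rewrite mulrC; apply: (le_trans HH).
  by apply: ler_wpM2l; [rewrite mulr_ge0 ?ltW|rewrite mulrC; apply: ler_wpM2l].
have h2 : a <= k * W * (2 / gam) * expR (- (kap * T)) * c.
  have -> : k * W * (2 / gam) * expR (- (kap * T)) * c = (k * expR (- (kap * T)) * (c * W)) / (gam / 2).
    by field; rewrite gt_eqF.
  by rewrite ler_pdivlMr // divr_gt0.
apply: (le_trans h2); apply: ler_wpM2r => //; apply: ler_wpM2r; first exact: ltW.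
by rewrite /k' le_max lexx orbT.
Qed.

End Contraction.

Section Continuation.
Context {R : realType} {Om : pseudoPMetricType R}.
Variables (sigma : R -> Om -> Om) (N : Om -> R -> R) (B L : R).
Hypothesis hsigma : is_cont_flow sigma.
Hypothesis HN : nice_field N B L.
Variables (b1 db1 rho drho D : Om -> R) (C0 lam1 lam2 lamp : R).
Hypothesis Hb1 : along sigma b1 db1.
Hypothesis Hb1e : forall w, db1 w = N w (b1 w) + lam2.
Hypothesis Hrho : along sigma rho drho.
Hypothesis Hrs : forall w, drho w <= N w (rho w) + lam1.
Hypothesis l12 : lam1 < lam2.
Hypothesis C00 : 0 < C0.
Hypothesis b1C : forall w, `|b1 w| <= C0.
Hypothesis rhoC : forall w, `|rho w| <= C0.
Hypothesis cD : continuous D.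
Hypothesis DG : forall e, 0 < e -> exists C, forall w (P : R -> R),
  (forall t : R, is_derive t 1 P (D (sigma t w))) ->
  forall s t, s <= t -> P t - P s <= e * (t - s) + C.
Hypothesis Hdef : forall w y l m, b1 w <= y <= rho w -> b1 w <= l -> l < m -> m < rho w ->
  y != l -> y != m ->
  (N w y - N w l) / (y - l) + (N w (rho w) - N w m) / (rho w - m) <=
  (N w y - N w m) / (y - m) + (N w (rho w) - N w l) / (rho w - l) + 2 * D w.
Hypothesis cb1 : continuous b1.
Hypothesis crho : continuous rho.
Implicit Types (lam x T t s gam l : R) (w : Om).

Local Notation phi := (phi sigma N).
Local Notation invariant := (invariant sigma N).
Local Notation fw lam := (fwd sigma N lam b1).
Local Notation bw lam := (bwd sigma N lam rho).
Local Notation lo lam := (low sigma N lam b1).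
Local Notation hi lam := (high sigma N lam rho).

Let W := 2 * C0.
Let g1 : R := gain L 1.
Let g1_gt0 : 0 < g1 := gain1_gt0 L.
Let sb1 := subeq_b1 Hb1 Hb1e.
Let srho := subeq_rho Hrho Hrs l12.
Let attract' := attract hsigma HN Hb1 Hb1e Hrho Hrs l12 C00 b1C rhoC cD DG Hdef.
Let repel' := repel hsigma HN Hb1 Hb1e Hrho Hrs l12 C00 b1C rhoC cD DG Hdef.

Definition separated lam gam := 0 < gam /\
  forall w s t, 0 <= s -> 0 <= t -> fw lam t w + gam <= bw lam s w.

Lemma fwd0 lam w : fw lam 0 w = b1 w.
Proof. by rewrite /fwd (phi0 hsigma HN) oppr0 sigma0. Qed.

Lemma bwd0 lam w : bw lam 0 w = rho w.
Proof. by rewrite /bwd oppr0 (phi0 hsigma HN) sigma0. Qed.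

Lemma separated_fwd_bounded lam gam : separated lam gam -> fwd_bounded sigma N lam b1.
Proof.
move=> [gam0 H]; exists C0 => t w t0; have := H w 0 t (lexx _) t0; rewrite bwd0.
by have := rhoC w; rewrite ler_norml => /andP[]; lra.
Qed.

Lemma separated_bwd_bounded lam gam : separated lam gam -> bwd_bounded sigma N lam rho.
Proof.
move=> [gam0 H]; exists (- C0) => t w t0; have := H w t 0 t0 (lexx _); rewrite fwd0.
by have := b1C w; rewrite ler_norml => /andP[]; lra.
Qed.

Lemma separated_mono lam mu gam : lam <= mu -> separated mu gam -> separated lam gam.
Proof.
move=> lm [gam0 H]; split => // w s t s0 t0; have := H w s t s0 t0.
have : fw lam t w <= fw mu t w by apply: (phi_le_fwd hsigma HN).
have : bw mu s w <= bw lam s w by apply: (phi_le_bwd hsigma HN) => //; rewrite oppr_le0.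
lra.
Qed.

Lemma separated_limits lam gam : lam2 <= lam -> separated lam gam ->
  [/\ invariant lam (lo lam), invariant lam (hi lam),
      forall w, b1 w + (lam - lam2) * g1 <= lo lam w,
      forall w, lo lam w + gam <= hi lam w &
      forall w, hi lam w + (lam2 - lam1) * g1 <= rho w].
Proof.
move=> l2l sep; have fb := separated_fwd_bounded sep; have bb := separated_bwd_bounded sep.
case: sep => gam0 H; split.
- by apply: (low_invariant hsigma HN) => //; exact: sb1.
- by apply: (high_invariant hsigma HN) => //; exact: srho.
- move=> w; apply: le_trans (fwd_low w fb ler01).
  have := @sub_fwd _ _ sigma N B L hsigma HN b1 db1 lam (lam - lam2) (sigma (- 1) w) (b1 (sigma (- 1) w)) 1 Hb1.
  rewrite sigmaNK //; apply => //; first by rewrite subr_ge0.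
  by move=> v; rewrite Hb1e; lra.
- move=> w; rewrite -lerBrDr; apply: low_ub => // t t0; rewrite lerBrDr.
  by apply: high_lb => // s s0; exact: H.
- move=> w; have := high_bwd w bb ler01.
  have := @sub_bwd _ _ sigma N B L hsigma HN rho drho lam (lam2 - lam1) (sigma 1 w) (rho (sigma 1 w)) 1 Hrho.
  rewrite sigmaKN // /bwd -/g1 => HH.
  have := HH; rewrite subr_ge0 ltW // => /(_ isT).
  have Hs v : drho v + (lam2 - lam1) <= N v (rho v) + lam by have := Hrs v; lra.
  by move=> /(_ Hs ler01 (lexx _)); lra.
Qed.

Let gmin gam := Num.min gam ((lam2 - lam1) * g1).

Let gmin_gt0 gam : 0 < gam -> 0 < gmin gam.
Proof. by move=> g0; rewrite /gmin lt_min g0 /= mulr_gt0 // subr_gt0. Qed.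

Lemma separated_attract gam : 0 < gam -> exists k kap, [/\ 1 <= k, 0 < kap &
  forall lam w x T, lam2 <= lam -> separated lam gam -> 0 <= T ->
  b1 w <= x -> x <= lo lam w + gmin gam / 2 ->
  `|phi lam w x T - lo lam (sigma T w)| <= k * expR (- (kap * T)) * `|x - lo lam w|].
Proof.
move=> gam0; have [k [kap [k1 kap0 H]]] := attract' (gmin_gt0 gam0).
exists k, kap; split => // lam w x T l2l sep T0 b1x xl.
have [il ih h1 h2 h3] := separated_limits l2l sep.
have m1 : gmin gam <= gam by rewrite ge_min lexx.
have m2 : gmin gam <= (lam2 - lam1) * g1 by rewrite ge_min lexx orbT.
apply: (H lam (lo lam) (hi lam)) => //.
- move=> v; apply: le_trans (h1 v); rewrite lerDl mulr_ge0 ?subr_ge0 //; exact: ltW.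
- by move=> v; have := h2 v; lra.
- by move=> v; have := h3 v; lra.
Qed.

Lemma separated_repel gam : 0 < gam -> exists k kap, [/\ 1 <= k, 0 < kap &
  forall lam w x T, lam2 <= lam -> separated lam gam -> 0 <= T ->
  hi lam w - gmin gam / 2 <= x -> x <= rho w ->
  `|phi lam w x (- T) - hi lam (sigma (- T) w)| <= k * expR (- (kap * T)) * `|x - hi lam w|].
Proof.
move=> gam0; have [k [kap [k1 kap0 H]]] := repel' (gmin_gt0 gam0).
exists k, kap; split => // lam w x T l2l sep T0 b1x xl.
have [il ih h1 h2 h3] := separated_limits l2l sep.
have m1 : gmin gam <= gam by rewrite ge_min lexx.
have m2 : gmin gam <= (lam2 - lam1) * g1 by rewrite ge_min lexx orbT.
apply: (H lam (lo lam) (hi lam)) => //.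
- move=> v; apply: le_trans (h1 v); rewrite lerDl mulr_ge0 ?subr_ge0 //; exact: ltW.
- by move=> v; have := h2 v; lra.
- by move=> v; have := h3 v; lra.
Qed.

Lemma low_band lam gam w : lam2 <= lam -> separated lam gam -> b1 w <= lo lam w <= rho w.
Proof.
move=> l2l sep; have [_ _ h1 h2 h3] := separated_limits l2l sep; case: sep => gam0 _.
have p1 : 0 <= (lam - lam2) * g1 by rewrite mulr_ge0 ?subr_ge0 //; exact: ltW.
have p2 : 0 <= (lam2 - lam1) * g1 by rewrite mulr_ge0 ?subr_ge0 //; exact: ltW.
by have := h1 w; have := h2 w; have := h3 w; lra.
Qed.

Lemma high_band lam gam w : lam2 <= lam -> separated lam gam -> b1 w <= hi lam w <= rho w.
Proof.
move=> l2l sep; have [_ _ h1 h2 h3] := separated_limits l2l sep; case: sep => gam0 _.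
have p1 : 0 <= (lam - lam2) * g1 by rewrite mulr_ge0 ?subr_ge0 //; exact: ltW.
have p2 : 0 <= (lam2 - lam1) * g1 by rewrite mulr_ge0 ?subr_ge0 //; exact: ltW.
by have := h1 w; have := h2 w; have := h3 w; lra.
Qed.

Lemma uniform_low gam e : 0 < gam -> 0 < e -> exists T, 0 < T /\
  forall lam w x, lam2 <= lam -> separated lam gam ->
  b1 w <= x -> x <= lo lam w + gmin gam / 2 -> x <= rho w ->
  `|phi lam w x T - lo lam (sigma T w)| <= e.
Proof.
move=> gam0 e0; have [k [kap [k1 kap0 H]]] := separated_attract gam0.
have [n Hn] := exp_small (k * W) kap0 e0.
exists n.+1%:R; split => // lam w x l2l sep b1x xl xr.
have n0 : (0 : R) <= n.+1%:R by [].
apply: (le_trans (H lam w x _ l2l sep n0 b1x xl)); apply: le_trans Hn.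
rewrite mulrAC; apply: ler_wpM2r; first exact: expR_ge0.
apply: ler_wpM2l; first by apply: le_trans k1.
by apply: (@band_width R Om b1 rho C0 b1C rhoC w); [rewrite b1x|exact: (low_band w l2l sep)].
Qed.

Lemma uniform_high gam e : 0 < gam -> 0 < e -> exists T, 0 < T /\
  forall lam w x, lam2 <= lam -> separated lam gam ->
  hi lam w - gmin gam / 2 <= x -> b1 w <= x -> x <= rho w ->
  `|phi lam w x (- T) - hi lam (sigma (- T) w)| <= e.
Proof.
move=> gam0 e0; have [k [kap [k1 kap0 H]]] := separated_repel gam0.
have [n Hn] := exp_small (k * W) kap0 e0.
exists n.+1%:R; split => // lam w x l2l sep xl b1x xr.
have n0 : (0 : R) <= n.+1%:R by [].
apply: (le_trans (H lam w x _ l2l sep n0 xl xr)); apply: le_trans Hn.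
rewrite mulrAC; apply: ler_wpM2r; first exact: expR_ge0.
apply: ler_wpM2l; first by apply: le_trans k1.
by apply: (@band_width R Om b1 rho C0 b1C rhoC w); [rewrite b1x|exact: (high_band w l2l sep)].
Qed.

Lemma uniform_fwd gam e : 0 < gam -> 0 < e -> exists T, 0 < T /\
  forall lam w, lam2 <= lam -> separated lam gam -> `|fw lam T w - lo lam w| <= e.
Proof.
move=> gam0 e0; have [T [T0 H]] := uniform_low gam0 e0; exists T; split => // lam w l2l sep.
have := H lam (sigma (- T) w) (b1 (sigma (- T) w)) l2l sep (lexx _); rewrite sigmaNK //.
have /andP[a1 a2] := low_band (sigma (- T) w) l2l sep.
have := gmin_gt0 gam0 => g0; apply; lra.
Qed.

Lemma uniform_bwd gam e : 0 < gam -> 0 < e -> exists T, 0 < T /\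
  forall lam w, lam2 <= lam -> separated lam gam -> `|bw lam T w - hi lam w| <= e.
Proof.
move=> gam0 e0; have [T [T0 H]] := uniform_high gam0 e0; exists T; split => // lam w l2l sep.
have := H lam (sigma T w) (rho (sigma T w)) l2l sep; rewrite sigmaKN //.
have /andP[a1 a2] := high_band (sigma T w) l2l sep.
have := gmin_gt0 gam0 => g0; apply; lra.
Qed.

Lemma low_cont lam gam : lam2 <= lam -> separated lam gam -> continuous (lo lam).
Proof.
move=> l2l sep; case: (sep) => gam0 _ w0; apply/cvgrPdist_le => /= e e0.
have e3 : 0 < e / 3 by rewrite divr_gt0.
have [T [T0 HT]] := uniform_fwd gam0 e3.
near=> w.
have h1 : `|fw lam T w0 - fw lam T w| <= e / 3.
  near: w; have := @phi_cont_along _ _ sigma N B L hsigma HN lam (- T) T b1 cb1 w0.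
  by move/cvgrPdist_le; exact.
have := ler_distD (fw lam T w0) (lo lam w0) (lo lam w).
have := ler_distD (fw lam T w) (fw lam T w0) (lo lam w).
have := HT lam w l2l sep; have := HT lam w0 l2l sep.
rewrite (distrC (fw lam T w0) (lo lam w0)); lra.
Unshelve. all: by end_near. Qed.

Lemma high_cont lam gam : lam2 <= lam -> separated lam gam -> continuous (hi lam).
Proof.
move=> l2l sep; case: (sep) => gam0 _ w0; apply/cvgrPdist_le => /= e e0.
have e3 : 0 < e / 3 by rewrite divr_gt0.
have [T [T0 HT]] := uniform_bwd gam0 e3.
near=> w.
have h1 : `|bw lam T w0 - bw lam T w| <= e / 3.
  near: w; have := @phi_cont_along _ _ sigma N B L hsigma HN lam T (- T) rho crho w0.
  by move/cvgrPdist_le; exact.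
have := ler_distD (bw lam T w0) (hi lam w0) (hi lam w).
have := ler_distD (bw lam T w) (bw lam T w0) (hi lam w).
have := HT lam w l2l sep; have := HT lam w0 l2l sep.
rewrite (distrC (bw lam T w0) (hi lam w0)); lra.
Unshelve. all: by end_near. Qed.

Lemma low_high_param_cont gam e : 0 < gam -> 0 < e -> exists del, 0 < del /\
  forall lam mu w, lam2 <= lam -> lam2 <= mu -> separated lam gam -> separated mu gam ->
  `|lam - mu| <= del -> `|lo lam w - lo mu w| <= e /\ `|hi lam w - hi mu w| <= e.
Proof.
move=> gam0 e0; have e3 : 0 < e / 3 by rewrite divr_gt0.
have [T [T0 HT]] := uniform_fwd gam0 e3; have [S [S0 HS]] := uniform_bwd gam0 e3.
have [d1 [d10 H1]] := phi_cont_unif hsigma HN (ltW T0) e3.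
have [d2 [d20 H2]] := phi_cont_unif hsigma HN (ltW S0) e3.
exists (Num.min d1 d2); split; first by rewrite lt_min d10.
move=> lam mu w l2l l2m sl sm; rewrite le_min => /andP[D1 D2]; split.
  have := H1 lam mu (sigma (- T) w) (b1 (sigma (- T) w)) (b1 (sigma (- T) w)) T.
  rewrite subrr normr0 gtr0_norm // lexx ltW // => /(_ isT isT D1).
  rewrite -!/(fw _ T w); have := HT lam w l2l sl; have := HT mu w l2m sm.
  have := ler_distD (fw lam T w) (lo lam w) (lo mu w).
  have := ler_distD (fw mu T w) (fw lam T w) (lo mu w).
  rewrite (distrC (fw lam T w) (lo lam w)); lra.
have := H2 lam mu (sigma S w) (rho (sigma S w)) (rho (sigma S w)) (- S).
rewrite subrr normr0 normrN gtr0_norm // lexx ltW // => /(_ isT isT D2).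
rewrite -!/(bw _ S w); have := HS lam w l2l sl; have := HS mu w l2m sm.
have := ler_distD (bw lam S w) (hi lam w) (hi mu w).
have := ler_distD (bw mu S w) (bw lam S w) (hi mu w).
rewrite (distrC (bw lam S w) (hi lam w)); lra.
Qed.

Lemma low_high_strict lam mu gam w : lam2 <= lam -> lam < mu -> separated mu gam ->
  lo lam w < lo mu w /\ hi mu w < hi lam w.
Proof.
move=> l2l lm sep; have l2m : lam2 <= mu by lra.
have sepl := separated_mono (ltW lm) sep.
have [il ih _ _ _] := separated_limits l2l sepl.
have [il' ih' _ _ _] := separated_limits l2m sep.
have fb := separated_fwd_bounded sep; have bb := separated_bwd_bounded sep.
have fbl := separated_fwd_bounded sepl; have bbl := separated_bwd_bounded sepl.
have lle v : lo lam v <= lo mu v.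
  apply: low_ub => // t t0; apply: le_trans (fwd_low v fb t0).
  by apply: (phi_le_fwd hsigma HN) => //; exact: ltW.
have hle v : hi mu v <= hi lam v.
  apply: high_lb => // t t0; apply: (le_trans (high_bwd v bb t0)).
  by apply: (phi_le_bwd hsigma HN) => //; [rewrite oppr_le0|exact: ltW].
have p : 0 < (mu - lam) * g1 by rewrite mulr_gt0 ?subr_gt0.
have ml : 0 <= mu - lam by rewrite subr_ge0 ltW.
split.
  have := @sub_fwd _ _ sigma N B L hsigma HN (lo lam) _ mu (mu - lam) (sigma (- 1) w) (lo mu (sigma (- 1) w)) 1
    (invariant_along hsigma HN il) ml.
  have Hs v : N v (lo lam v) + lam + (mu - lam) <= N v (lo lam v) + mu by lra.
  by rewrite il' sigmaNK // => /(_ Hs ler01 (lle _)); rewrite -/g1; lra.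
have := @sub_bwd _ _ sigma N B L hsigma HN (hi lam) _ mu (mu - lam) (sigma 1 w) (hi mu (sigma 1 w)) 1
    (invariant_along hsigma HN ih) ml.
have Hs v : N v (hi lam v) + lam + (mu - lam) <= N v (hi lam v) + mu by lra.
by rewrite ih' sigmaKN // => /(_ Hs ler01 (hle _)); rewrite -/g1; lra.
Qed.

Lemma separated_le_bound lam gam : lam2 <= lam -> separated lam gam -> lam <= B.
Proof.
move=> l2l sep; rewrite leNgt; apply/negP => Bl.
have [il _ _ _ _] := separated_limits l2l sep.
have dl := invariant_along hsigma HN il point.
pose T := (2 * C0 + 1) / (lam - B).
have lB : 0 < lam - B by lra.
have T0 : 0 <= T by rewrite divr_ge0 ?ltW //; have := C00; lra.
have : (lam - B) * T - (lam - B) * 0 <= lo lam (sigma T point) - lo lam (sigma 0 point).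
  apply: (@der_le R (fun t => (lam - B) * t) (fun=> (lam - B) * 1) _ _ 0 T T0 _ (fun t _ => dl t)).
  move=> t _; case: HN => _ /(_ (sigma t point) (lo lam (sigma t point))) + _ _.
  by rewrite ler_norml => /andP[]; lra.
have -> : (lam - B) * T = 2 * C0 + 1 by rewrite /T mulrC divfK // gt_eqF.
have := low_band (sigma T point) l2l sep; have := low_band (sigma 0 point) l2l sep.
have := b1C (sigma 0 point); have := rhoC (sigma T point).
rewrite !ler_norml mulr0 => /andP[? ?] /andP[? ?] /andP[? ?] /andP[? ?]; lra.
Qed.

(* The time-[T] maps at [lam] contract towards [lo lam] (forward) and [hi lam] (backward);
   a small change of the parameter cannot push the iterates of [b1] and [rho] out of the two tubes. *)
Lemma separated_persist gam : 0 < gam -> exists del, 0 < del /\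
  forall lam mu, lam2 <= lam -> lam2 <= mu -> separated lam gam -> `|lam - mu| <= del ->
  separated mu (gmin gam / 2).
Proof.
move=> gam0; set gm := gmin gam; have gm0 : 0 < gm by exact: gmin_gt0.
have e0 : 0 < gm / 8 by rewrite divr_gt0.
have [T [T0 HT]] := uniform_low gam0 e0; have [S [S0 HS]] := uniform_high gam0 e0.
have [d1 [d10 H1]] := phi_cont_unif hsigma HN (ltW T0) e0.
have [d2 [d20 H2]] := phi_cont_unif hsigma HN (ltW S0) e0.
exists (Num.min d1 d2); split; first by rewrite lt_min d10.
move=> lam mu l2l l2m sep; rewrite le_min => /andP[D1 D2].
have [il ih h1 h2 h3] := separated_limits l2l sep.
have m1 : gm <= gam by rewrite /gm ge_min lexx.
have m2 : gm <= (lam2 - lam1) * g1 by rewrite /gm ge_min lexx orbT.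
have F n w : fw mu (n%:R * T) w <= lo lam w + gm / 4.
  elim: n w => [|n IH] w.
    by rewrite mul0r fwd0; have /andP[] := low_band w l2l sep; lra.
  pose v := sigma (- T) w; pose x := fw mu (n%:R * T) v.
  have nT0 : 0 <= n%:R * T by rewrite mulr_ge0 // ltW.
  have -> : fw mu (n.+1%:R * T) w = phi mu v x T.
    rewrite /x /fwd /v -sigmaD // -natr1 mulrDl mul1r.
    rewrite (phiD hsigma HN) -sigmaD //.
    have -> : - T + - (n%:R * T) = - (n%:R * T + T) by ring.
    by have -> : - (n%:R * T + T) + n%:R * T = - T by ring.
  have xb : b1 v <= x.
    by rewrite -(fwd0 mu v); apply: (fwd_mono hsigma HN) => //; exact: sb1.
  have xl : x <= lo lam v + gm / 4 by exact: IH.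
  have xr : x <= rho v by have := h2 v; have := h3 v; lra.
  have := HT lam v x l2l sep xb; rewrite -/gm /v sigmaNK // -/v.
  have xl2 : x <= lo lam v + gm / 2 by lra.
  move=> /(_ xl2 xr).
  have := H1 lam mu v x x T; rewrite subrr normr0 gtr0_norm // lexx ltW // => /(_ isT isT D1).
  by rewrite !ler_norml => /andP[? ?] /andP[? ?]; lra.
have G n w : hi lam w - gm / 4 <= bw mu (n%:R * S) w.
  elim: n w => [|n IH] w.
    by rewrite mul0r bwd0; have /andP[] := high_band w l2l sep; lra.
  pose v := sigma S w; pose x := bw mu (n%:R * S) v.
  have nS0 : 0 <= n%:R * S by rewrite mulr_ge0 // ltW.
  have -> : bw mu (n.+1%:R * S) w = phi mu v x (- S).
    rewrite /x /bwd /v -sigmaD // -natr1 mulrDl mul1r opprD.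
    rewrite (phiD hsigma HN) -sigmaD //.
    have -> : S + n%:R * S = n%:R * S + S by ring.
    by have -> : n%:R * S + S + - (n%:R * S) = S by ring.
  have xr : x <= rho v.
    by rewrite -(bwd0 mu v); apply: (bwd_mono hsigma HN) => //; exact: srho.
  have xl : hi lam v - gm / 4 <= x by exact: IH.
  have xb : b1 v <= x.
    by have := h2 v; have /andP[] := low_band v l2l sep; lra.
  have xl2 : hi lam v - gm / 2 <= x by lra.
  have := HS lam v x l2l sep xl2 xb xr; rewrite /v sigmaKN // -/v.
  have := H2 lam mu v x x (- S); rewrite subrr normr0 normrN gtr0_norm // lexx ltW // => /(_ isT isT D2).
  by rewrite !ler_norml => /andP[? ?] /andP[? ?]; lra.
have cover (P : R) t : 0 < P -> exists n : nat, t <= n%:R * P.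
  move=> P0; exists (Num.truncn (`|t| / P)).+1; rewrite -ler_pdivrMr //.
  apply: (@le_trans _ _ (`|t| / P)); first by rewrite ler_pM2r ?invr_gt0 // ler_norm.
  by have /truncn_itv/andP[_ /ltW] : 0 <= `|t| / P by rewrite divr_ge0 // ltW.
split; first by rewrite divr_gt0.
move=> w s t s0 t0.
have [n Hn] := cover T t T0; have [k Hk] := cover S s S0.
have := fwd_mono hsigma HN w (sb1 l2m) t0 Hn.
have := bwd_mono hsigma HN w (srho l2m) s0 Hk.
have := F n w; have := G k w; have := h2 w; lra.
Qed.

Lemma low_hyperbolic lam gam : lam2 < lam -> separated lam gam -> exists k beta del : R,
  [/\ 1 <= k, 0 < beta, 0 < del & forall w x, `|x - lo lam w| < del -> forall t, 0 <= t ->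
    b1 (sigma t w) <= phi lam w x t <= rho (sigma t w) /\
    `|phi lam w x t - lo lam (sigma t w)| <= k * expR (- (beta * t)) * `|x - lo lam w|].
Proof.
move=> l2l sep; case: (sep) => gam0 _.
have [k [kap [k1 kap0 H]]] := separated_attract gam0.
have [il ih h1 h2 h3] := separated_limits (ltW l2l) sep.
have gm0 := gmin_gt0 gam0.
have m1 : gmin gam <= gam by rewrite ge_min lexx.
have p : 0 < (lam - lam2) * g1 by rewrite mulr_gt0 ?subr_gt0.
have p2 : 0 < (lam2 - lam1) * g1 by rewrite mulr_gt0 ?subr_gt0.
exists k, kap, (Num.min (gmin gam / 2) ((lam - lam2) * g1)); split => //.
  by rewrite lt_min p divr_gt0.
move=> w x; rewrite lt_min => /andP[x1 x2] t t0.
have b1x : b1 w <= x.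
  by move: x2; rewrite ltr_norml => /andP[]; have := h1 w; lra.
have xl : x <= lo lam w + gmin gam / 2.
  by move: x1; rewrite ltr_norml => /andP[]; lra.
split; last exact: (H lam w x t (ltW l2l) sep t0 b1x xl).
apply/andP; split; first by apply: (subeq_fwd hsigma HN (sb1 (ltW l2l))).
have : phi lam w x t <= hi lam (sigma t w).
  by rewrite -ih; apply: (phi_le hsigma HN); have := h2 w; lra.
by have := h3 (sigma t w); lra.
Qed.

Lemma high_hyperbolic lam gam : lam2 < lam -> separated lam gam -> exists k beta del : R,
  [/\ 1 <= k, 0 < beta, 0 < del & forall w x, `|x - hi lam w| < del -> forall t, t <= 0 ->
    b1 (sigma t w) <= phi lam w x t <= rho (sigma t w) /\
    `|phi lam w x t - hi lam (sigma t w)| <= k * expR (beta * t) * `|x - hi lam w|].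
Proof.
move=> l2l sep; case: (sep) => gam0 _.
have [k [kap [k1 kap0 H]]] := separated_repel gam0.
have [il ih h1 h2 h3] := separated_limits (ltW l2l) sep.
have gm0 := gmin_gt0 gam0.
have m1 : gmin gam <= gam by rewrite ge_min lexx.
have m2 : gmin gam <= (lam2 - lam1) * g1 by rewrite ge_min lexx orbT.
exists k, kap, (gmin gam / 2); split => //; first by rewrite divr_gt0.
move=> w x; rewrite ltr_norml => /andP[x1 x2] t t0.
have xr : x <= rho w by have := h3 w; lra.
have xm : hi lam w - gmin gam / 2 <= x by lra.
have t'0 : 0 <= - t by rewrite oppr_ge0.
have HH := H lam w x (- t) (ltW l2l) sep t'0 xm xr.
have e2 : - (kap * - t) = kap * t by ring.
rewrite opprK e2 in HH; split; last by [].
apply/andP; split; last first.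
  by have := subeq_bwd hsigma HN (srho (ltW l2l)) t'0 xr; rewrite opprK.
have : lo lam (sigma t w) <= phi lam w x t.
  by rewrite -il; apply: (phi_le hsigma HN); have := h2 w; lra.
by have /andP[] := low_band (sigma t w) (ltW l2l) sep; lra.
Qed.

Lemma mono_left_limit (F : R -> R) (a xi C : R) : a < xi ->
  (forall l1 l2, a < l1 -> l1 <= l2 -> l2 < xi -> F l1 <= F l2) ->
  (forall l, a < l < xi -> F l <= C) ->
  exists y, [/\ F @ xi^'- --> y, forall l, a < l < xi -> F l <= y &
    forall e, 0 < e -> exists l', a < l' < xi /\ forall l, l' <= l < xi -> y - e <= F l].
Proof.
move=> axi Fm FC; pose S := [set y | exists2 l, a < l < xi & y = F l].
have hS : has_sup S.
  split; last by exists C => _ [l al ->]; exact: FC.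
  by exists (F ((a + xi) / 2)); exists ((a + xi) / 2) => //; apply/andP; split; lra.
have ub l : a < l < xi -> F l <= sup S.
  by move=> al; apply: ub_le_sup; [case: hS|exists l].
have lb e : 0 < e -> exists l', a < l' < xi /\ forall l, l' <= l < xi -> sup S - e <= F l.
  move=> e0; have [_ [l' al' ->] Hl'] := sup_adherent e0 hS.
  exists l'; split => // l /andP[l'l lxi]; apply: (le_trans (ltW Hl')).
  by apply: Fm => //; case/andP: al'.
exists (sup S); split => //.
apply/cvgrPdist_le => /= e e0; have [l' [/andP[al' l'xi] Hl']] := lb e e0.
near=> l.
have h1 : l < xi by near: l; exact: nbhs_left_lt.
have h2 : l' < l by near: l; exact: nbhs_left_gt.
have := Hl' l; rewrite (ltW h2) h1 => /(_ isT) h3.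
have : F l <= sup S by apply: ub; rewrite h1 (lt_trans al' h2).
by move=> h4; rewrite ger0_norm ?subr_ge0 //; lra.
Unshelve. all: by end_near. Qed.

(* Equilibria depending on the parameter pass to the limit because the flow is continuous in
   the parameter, uniformly on bounded times. *)
Lemma limit_invariant (a : R -> Om -> R) (axi : Om -> R) (a0 xi : R) : a0 < xi ->
  (forall lam, a0 < lam < xi -> invariant lam (a lam)) ->
  (forall w e, 0 < e -> exists l', a0 < l' < xi /\ forall l, l' <= l < xi -> `|axi w - a l w| <= e) ->
  invariant xi axi.
Proof.
move=> a0xi ia Ha w t; apply/eqP; rewrite -subr_eq0 -normr_le0.
apply/ler_addgt0Pr => e e0; rewrite add0r.
have e2 : 0 < e / 2 by rewrite divr_gt0.
have [del [del0 Hdel]] := phi_cont_unif hsigma HN (normr_ge0 t) e2.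
have [l1 [/andP[p1 p2] H1]] := Ha w del del0.
have [l2 [/andP[q1 q2] H2]] := Ha (sigma t w) (e / 2) e2.
pose l := Num.max (Num.max l1 l2) (xi - del).
have lx : l < xi by rewrite /l !gt_max p2 q2 /= gtrBl.
have l1l : l1 <= l by rewrite /l !le_max lexx.
have l2l : l2 <= l by rewrite /l !le_max lexx orbT.
have dl : xi - del <= l by rewrite /l !le_max lexx !orbT.
have h1 := H1 l (introT andP (conj l1l lx)).
have h2 := H2 l (introT andP (conj l2l lx)).
have h3 : `|xi - l| <= del by rewrite ler_norml; apply/andP; split; lra.
have := Hdel xi l w (axi w) (a l w) t (lexx _) h1 h3.
rewrite ia; last by rewrite lx (lt_le_trans p1 l1l).
have := ler_distD (a l (sigma t w)) (phi xi w (axi w) t) (axi (sigma t w)).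
rewrite (distrC (a l (sigma t w)) (axi (sigma t w))); lra.
Qed.

Lemma continuation_core : lam2 < lamp ->
  (forall lam, lam2 < lam < lamp -> exists gam, separated lam gam) ->
  exists xi, [/\ lamp <= xi, forall lam, lam2 < lam < xi -> exists gam, separated lam gam &
   exists axi rxi : Om -> R, [/\
    forall w, (fun l => lo l w) @ xi^'- --> axi w /\ (fun l => hi l w) @ xi^'- --> rxi w,
    invariant xi axi /\ invariant xi rxi,
    forall w, b1 w <= axi w <= rho w, forall w, b1 w <= rxi w <= rho w &
    (forall w, axi w <= rxi w) /\ forall e, 0 < e -> exists w, rxi w - axi w < e]].
Proof.
move=> l2p Hs; pose S := [set lam | lam2 < lam /\ exists gam, separated lam gam].
have hS : has_sup S.
  split; last by exists B => lam [l2l [gam sep]]; exact: (separated_le_bound (ltW l2l) sep).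
  exists ((lam2 + lamp) / 2); split; first lra.
  by apply: Hs; apply/andP; split; lra.
pose xi := sup S.
have lpxi : lamp <= xi.
  rewrite leNgt; apply/negP => xp.
  pose l := (Num.max lam2 xi + lamp) / 2.
  have mx : Num.max lam2 xi < lamp by rewrite gt_max l2p.
  have m1 : lam2 <= Num.max lam2 xi by rewrite le_max lexx.
  have m2 : xi <= Num.max lam2 xi by rewrite le_max lexx orbT.
  have : S l by split; [rewrite /l; lra|apply: Hs; rewrite /l; lra].
  by move=> /(ub_le_sup (proj2 hS)); rewrite -/xi /l; lra.
have l2xi : lam2 < xi by lra.
have sepS lam : lam2 < lam < xi -> exists gam, separated lam gam.
  move=> /andP[l2l lx]; have d0 : 0 < xi - lam by lra.
  have [mu [l2m [gam sep]] Hmu] := sup_adherent d0 hS.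
  by exists gam; apply: (separated_mono _ sep); move: Hmu; rewrite -/xi; lra.
exists xi; split => //.
have strict l1 l2 w : lam2 < l1 -> l1 < l2 -> l2 < xi -> lo l1 w < lo l2 w /\ hi l2 w < hi l1 w.
  move=> h1 h2 h3; have [|gam sep] := sepS l2; first by rewrite h3 (lt_trans h1 h2).
  exact: (low_high_strict w (ltW h1) h2 sep).
have bandlo l w : lam2 < l < xi -> b1 w <= lo l w <= rho w.
  move=> lx; have [gam sep] := sepS l lx; case/andP: lx => h _.
  exact: (low_band w (ltW h) sep).
have bandhi l w : lam2 < l < xi -> b1 w <= hi l w <= rho w.
  move=> lx; have [gam sep] := sepS l lx; case/andP: lx => h _.
  exact: (high_band w (ltW h) sep).
have /choice[axi Ha] : forall w, exists y, [/\ (fun l => lo l w) @ xi^'- --> y,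
    forall l, lam2 < l < xi -> lo l w <= y &
    forall e, 0 < e -> exists l', lam2 < l' < xi /\ forall l, l' <= l < xi -> y - e <= lo l w].
  move=> w; apply: (@mono_left_limit (fun l => lo l w) lam2 xi (rho w)) => //.
    move=> l1 l2 h1; rewrite le_eqVlt => /orP[/eqP -> //|h2] h3.
    by apply: ltW; case: (strict l1 l2 w h1 h2 h3).
  by move=> l lx; case/andP: (bandlo l w lx).
have /choice[nrxi Hr] : forall w, exists y, [/\ (fun l => - hi l w) @ xi^'- --> y,
    forall l, lam2 < l < xi -> - hi l w <= y &
    forall e, 0 < e -> exists l', lam2 < l' < xi /\ forall l, l' <= l < xi -> y - e <= - hi l w].
  move=> w; apply: (@mono_left_limit (fun l => - hi l w) lam2 xi (- b1 w)) => //.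
    move=> l1 l2 h1; rewrite le_eqVlt => /orP[/eqP -> //|h2] h3.
    by rewrite lerN2; apply: ltW; case: (strict l1 l2 w h1 h2 h3).
  by move=> l lx; rewrite lerN2; case/andP: (bandhi l w lx).
pose rxi w := - nrxi w.
have mid : lam2 < (lam2 + xi) / 2 < xi by apply/andP; split; lra.
have axile w : axi w <= rxi w.
  apply/ler_addgt0Pr => e e0; have e2 : 0 < e / 2 by rewrite divr_gt0.
  have [_ _ /(_ _ e2)[l1 [/andP[p1 p2] H1]]] := Ha w.
  have [_ _ /(_ _ e2)[l2 [/andP[q1 q2] H2]]] := Hr w.
  have m1 : l1 <= Num.max l1 l2 by rewrite le_max lexx.
  have m2 : l2 <= Num.max l1 l2 by rewrite le_max lexx orbT.
  have m3 : Num.max l1 l2 < xi by rewrite gt_max p2.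
  have := H1 _ (introT andP (conj m1 m3)); have := H2 _ (introT andP (conj m2 m3)).
  have m4 : lam2 < Num.max l1 l2 by lra.
  have [gam sep] := sepS _ (introT andP (conj m4 m3)).
  have [_ _ _ h _] := separated_limits (ltW m4) sep; case: sep => g0 _.
  by have := h w; rewrite /rxi; lra.
have aub l w : lam2 < l < xi -> lo l w <= axi w by move=> lx; case: (Ha w) => _ + _; exact.
have rlb l w : lam2 < l < xi -> rxi w <= hi l w.
  by move=> lx; rewrite /rxi lerNl; case: (Hr w) => _ + _; exact.
exists axi, rxi; split.
- move=> w; split; first by case: (Ha w).
  have [+ _ _] := Hr w; move=> /cvgN; rewrite /rxi; apply: cvg_trans.
  by under eq_fun do rewrite -[hi _ w]opprK.
- split.
    apply: (@limit_invariant (fun lam => lo lam) axi lam2 xi) => //.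
      move=> lam lx; have [gam sep] := sepS lam lx; case/andP: lx => h _.
      by have [] := separated_limits (ltW h) sep.
    move=> w e e0; have [_ _ /(_ _ e0)[l' [lx' H]]] := Ha w; exists l'; split => // l lx.
    have lx2 : lam2 < l < xi by case/andP: lx lx' => a1 a2 /andP[a3 a4]; rewrite a2 (lt_le_trans a3 a1).
    by have := aub l w lx2 => h; rewrite ger0_norm ?subr_ge0 //; have := H l lx; lra.
  apply: (@limit_invariant (fun lam => hi lam) rxi lam2 xi) => //.
    move=> lam lx; have [gam sep] := sepS lam lx; case/andP: lx => h _.
    by have [] := separated_limits (ltW h) sep.
  move=> w e e0; have [_ _ /(_ _ e0)[l' [lx' H]]] := Hr w; exists l'; split => // l lx.
  have lx2 : lam2 < l < xi by case/andP: lx lx' => a1 a2 /andP[a3 a4]; rewrite a2 (lt_le_trans a3 a1).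
  by have := rlb l w lx2 => h; rewrite ler0_norm ?subr_le0 //; have := H l lx; rewrite /rxi; lra.
- move=> w; have := aub _ w mid; have /andP[? ?] := bandlo _ w mid; have := axile w.
  have := rlb _ w mid; have /andP[? ?] := bandhi _ w mid => *; apply/andP; split; lra.
- move=> w; have := aub _ w mid; have /andP[? ?] := bandlo _ w mid; have := axile w.
  have := rlb _ w mid; have /andP[? ?] := bandhi _ w mid => *; apply/andP; split; lra.
- split => // e e0; apply: contrapT => /forallNP Hne.
  have gap w : e <= rxi w - axi w by rewrite leNgt; apply/negP; exact: Hne.
  have sepe lam : lam2 < lam < xi -> separated lam e.
    move=> lx; split => // w s t s0 t0; have [gam sep] := sepS lam lx.
    have := fwd_low w (separated_fwd_bounded sep) t0.
    have := high_bwd w (separated_bwd_bounded sep) s0.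
    by have := gap w; have := aub lam w lx; have := rlb lam w lx; lra.
  have [del [del0 Hdel]] := separated_persist e0.
  pose lam := Num.max ((lam2 + xi) / 2) (xi - del / 2).
  have a1 : (lam2 + xi) / 2 <= lam by rewrite le_max lexx.
  have a2 : xi - del / 2 <= lam by rewrite le_max lexx orbT.
  have a3 : lam < xi by rewrite gt_max; apply/andP; split; lra.
  have lx : lam2 < lam < xi by apply/andP; split; lra.
  have : S (xi + del / 2).
    split; first lra.
    exists (gmin e / 2); apply: (Hdel lam); [lra|lra|exact: sepe|].
    by rewrite ler_norml; apply/andP; split; lra.
  by move=> /(ub_le_sup (proj2 hS)); rewrite -/xi; lra.
Qed.

End Continuation.

Section RealConcavity.
Context {R : realType}.
Implicit Types (f h : R -> R) (x y t : R).

Lemma cont_near f x e : continuous f -> 0 < e ->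
  exists d, 0 < d /\ forall y, `|y - x| <= d -> `|f y - f x| <= e.
Proof.
move=> cf e0; have /cvgrPdist_le/(_ _ e0) := cf x.
case/nbhs_ballP => d /= d0 H; exists (d / 2); split; first by rewrite divr_gt0.
move=> y yx; rewrite distrC; apply: H; rewrite /ball /= distrC; apply: le_lt_trans yx _.
by rewrite ltr_pdivrMr //; lra.
Qed.

Lemma convex_der_mono f h (I : set R) x y : (forall t : R, is_derive t 1 f (h t)) -> continuous h ->
  convex_on f I -> I x -> I y -> x <= y -> h x <= h y.
Proof.
move=> fh ch cvx Ix Iy; rewrite le_eqVlt => /orP[/eqP -> //|xy].
apply/ler_addgt0Pr => e e0; have e2 : 0 < e / 2 by rewrite divr_gt0.
have [d1 [d10 H1]] := cont_near x ch e2; have [d2 [d20 H2]] := cont_near y ch e2.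
pose d := Num.min (Num.min d1 d2) (y - x).
have d0 : 0 < d by rewrite /d !lt_min d10 d20 subr_gt0.
have dd1 : d <= d1 by rewrite /d !ge_min lexx.
have dd2 : d <= d2 by rewrite /d !ge_min lexx orbT.
have dxy : d <= y - x by rewrite /d !ge_min lexx !orbT.
have yx0 : 0 < y - x by lra.
pose tau := d / (y - x).
have tau01 : 0 <= tau <= 1 by apply/andP; split; [apply: divr_ge0; exact: ltW|rewrite ler_pdivrMr // mul1r].
have tauE : tau * (y - x) = d by rewrite divfK // gt_eqF.
have c1 := cvx _ _ tau Ix Iy tau01; have c2 := cvx _ _ tau Iy Ix tau01.
have e1 : tau * x + (1 - tau) * y = y - d by rewrite -tauE; ring.
have e2' : tau * y + (1 - tau) * x = x + d by rewrite -tauE; ring.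
rewrite e1 in c1; rewrite e2' in c2.
have xd : x <= x + d by lra. have yd : y - d <= y by lra.
have [u /andP[u1 u2] Hu] := MVT_der xd (fun t _ => fh t).
have [v /andP[v1 v2] Hv] := MVT_der yd (fun t _ => fh t).
have uv : h u * d <= h v * d.
  have -> : h u * d = f (x + d) - f x by rewrite Hu; ring.
  have -> : h v * d = f y - f (y - d) by rewrite Hv; ring.
  lra.
rewrite ler_pM2r // in uv.
have nu : `|u - x| <= d1 by rewrite ger0_norm ?subr_ge0 //; lra.
have nv : `|v - y| <= d2 by rewrite ler0_norm ?subr_le0 //; lra.
by have := H1 u nu; have := H2 v nv; rewrite !ler_norml => /andP[? ?] /andP[? ?]; lra.
Qed.

Lemma concave_der_mono f h (I : set R) x y : (forall t : R, is_derive t 1 f (h t)) -> continuous h ->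
  concave_on f I -> I x -> I y -> x <= y -> h y <= h x.
Proof.
move=> fh ch cvx Ix Iy xy; rewrite -lerN2.
apply: (@convex_der_mono (fun x => - f x) (fun x => - h x) I) => //.
- by move=> t; apply: continuousN; exact: ch.
- by move=> u v t Iu Iv t01; have := cvx u v t Iu Iv t01; lra.
Qed.

Lemma cont_ge0_at1 f : continuous f -> (forall t, 0 <= t < 1 -> 0 <= f t) -> 0 <= f 1.
Proof.
move=> cf H; rewrite leNgt; apply/negP => f1.
have e0 : 0 < - f 1 / 2 by rewrite divr_gt0 // oppr_gt0.
have [d [d0 Hd]] := cont_near 1 cf e0.
pose t := 1 - Num.min d 1 / 2.
have m0 : 0 < Num.min d 1 by rewrite lt_min d0 ltr01.
have m1 : Num.min d 1 <= d by rewrite ge_min lexx.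
have m2 : Num.min d 1 <= 1 by rewrite ge_min lexx orbT.
have : `|t - 1| <= d by rewrite /t addrAC subrr sub0r normrN ger0_norm; lra.
move=> /Hd; have : 0 <= f t by apply: H; rewrite /t; lra.
by rewrite ler_norml => ? /andP[? ?]; lra.
Qed.

(* Concavity on all smaller intervals passes to the closed interval by scaling towards 0. *)
Lemma concave_scale h (I : set R) : continuous h ->
  (forall x y t u, I x -> I y -> 0 <= t <= 1 -> 0 <= u < 1 ->
    t * h (u * x) + (1 - t) * h (u * y) <= h (t * (u * x) + (1 - t) * (u * y))) ->
  concave_on h I.
Proof.
move=> ch H x y t Ix Iy t01.
pose P (u : R) := h (u * (t * x + (1 - t) * y)) - (t * h (u * x) + (1 - t) * h (u * y)).
have cm (z : R) : continuous (fun u : R => h (u * z)).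
  move=> u; apply: (@continuous_comp R R R (fun u : R => u * z) h); last exact: ch.
  by apply: cvgM; [exact: cvg_id|exact: cvg_cst].
have cP : continuous P.
  move=> u; apply: cvgB; first exact: cm.
  exact: (cvgD (cvgM (cvg_cst t) (cm x u)) (cvgM (cvg_cst (1 - t)) (cm y u))).
have P1 : 0 <= P 1.
  apply: cont_ge0_at1 => // u u01; rewrite /P subr_ge0.
  have -> : u * (t * x + (1 - t) * y) = t * (u * x) + (1 - t) * (u * y) by ring.
  exact: H.
by move: P1; rewrite /P !mul1r subr_ge0.
Qed.

Variables (Om : Type) (g : Om -> R -> R) (w : Om).
Hypothesis ch : continuous (gx g w).

Lemma beta_concave x : 0 < x -> (x%:E <= beta g w)%E -> concave_on (gx g w) (cc 0 x).
Proof.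
move=> x0; rewrite /beta /beta_gen; case: pselect => [e|e xS].
  by rewrite lee_fin leNgt x0.
apply: (concave_scale ch) => u v t r /andP[u0 ux] /andP[v0 vx] t01 /andP[r0 r1].
have : ((r * x)%:E < ereal_sup [set y%:E | y in [set y | (0 < y)%R /\ concave_on (gx g w) (cc 0 y)]])%E.
  by apply: lt_le_trans xS; rewrite lte_fin gtr_pMl.
move=> /ereal_sup_gt[_ [y [y0 cy] <-]]; rewrite lte_fin => ry.
by apply: cy => //; rewrite /cc /= mulr_ge0 //=; apply: le_trans (ltW ry); apply: ler_wpM2l.
Qed.

Lemma alpha_concave x : x < 0 -> (alpha g w <= x%:E)%E -> concave_on (gx g w) (cc x 0).
Proof.
move=> x0; rewrite /alpha /alpha_gen; case: pselect => [e|e xS].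
  by rewrite lee_fin leNgt x0.
apply: (concave_scale ch) => u v t r /andP[ux u0] /andP[vx v0] t01 /andP[r0 r1].
have : (ereal_inf [set y%:E | y in [set y | (y < 0)%R /\ concave_on (gx g w) (cc y 0)]] < (r * x)%:E)%E.
  by apply: le_lt_trans xS _; rewrite lte_fin; nra.
move=> /ereal_inf_lt[_ [y [y0 cy] <-]]; rewrite lte_fin => ry.
by apply: cy => //; rewrite /cc /= mulr_ge0_le0 // andbT; apply: (le_trans (ltW ry)); apply: ler_wpM2l.
Qed.

(* Since [gx] is nonpositive and vanishes at 0, concavity on both sides of 0 glues at 0. *)
Lemma band_concave (p q : R) : p <= q -> gx g w 0 = 0 -> (forall x, gx g w x <= 0) ->
  cc p q `<=` Dg_fiber g w -> concave_on (gx g w) (cc p q).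
Proof.
move=> pq h0 hle sub x y t.
wlog xy : x y t / x <= y.
  move=> W Ix Iy /andP[t0 t1]; case: (leP x y) => xy; first by apply: W => //; rewrite t0.
  have t'01 : 0 <= 1 - t <= 1 by lra.
  have := W y x (1 - t) (ltW xy) Iy Ix t'01.
  have -> : 1 - (1 - t) = t by ring.
  have -> : (1 - t) * y + t * x = t * x + (1 - t) * y by ring.
  by lra.
move=> /andP[px xq] /andP[py yq] t01.
have /andP[a1 a2] : (alpha g w <= x%:E <= beta g w)%E by apply: sub; rewrite /cc /= px.
have /andP[b1 b2] : (alpha g w <= y%:E <= beta g w)%E by apply: sub; rewrite /cc /= py.
set h := gx g w in h0 hle *.
case/andP: (t01) => t0 t1.
case: (leP y 0) => y0.
  move: xy; rewrite le_eqVlt => /orP[/eqP ->|xy].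
    by rewrite -!mulrDl (addrC t) subrK !mul1r.
  have x0 : x < 0 by lra.
  by apply: (alpha_concave x0 a1) => //; rewrite /cc /=; apply/andP; split; lra.
case: (leP 0 x) => x0.
  by apply: (beta_concave y0 b2) => //; rewrite /cc /=; apply/andP; split; lra.
set z := t * x + (1 - t) * y.
have hx := hle x; have hy := hle y.
case: (leP 0 z) => z0.
  have zy : z <= (1 - t) * y by rewrite /z; nra.
  have c := beta_concave y0 b2; rewrite -/h in c.
  pose s := z / y.
  have s01 : 0 <= 1 - s <= 1.
    have : 0 <= s by rewrite divr_ge0 // ltW.
    have : s <= 1 - t by rewrite ler_pdivrMr.
    lra.
  have sE : s * y = z by rewrite divfK // gt_eqF.
  have i0 : cc 0 y 0 by rewrite /cc /= lexx ltW.
  have iy : cc 0 y y by rewrite /cc /= lexx ltW.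
  have := c 0 y (1 - s) i0 iy s01.
  rewrite h0 !mulr0 !add0r; have -> : 1 - (1 - s) = s by ring.
  rewrite sE; have : s <= 1 - t by rewrite ler_pdivrMr.
  nra.
have zx : t * x <= z by rewrite /z; nra.
have c := alpha_concave x0 a1; rewrite -/h in c.
pose s := z / x.
have s0 : 0 <= s by rewrite /s -mulrNN -invrN divr_ge0 // oppr_ge0 ltW.
have st : s <= t by rewrite /s ler_ndivrMr.
have sE : s * x = z by rewrite divfK // lt_eqF.
have s01 : 0 <= s <= 1 by lra.
have i0 : cc x 0 0 by rewrite /cc /= lexx ltW.
have ix : cc x 0 x by rewrite /cc /= lexx ltW.
have := c x 0 s ix i0 s01.
rewrite h0 !mulr0 !addr0 sE; nra.
Qed.

End RealConcavity.

Section FourPoint.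
Context {R : realType}.

Lemma four_point (f h : R -> R) (p q D : R) : (forall t : R, is_derive t 1 f (h t)) -> 0 <= D ->
  (forall x y t, p <= x <= q -> p <= y <= q -> 0 <= t <= 1 ->
     t * h x + (1 - t) * h y <= h (t * x + (1 - t) * y) + D) ->
  forall y l m r, p <= y <= r -> p <= l -> l < m -> m < r -> r <= q -> y != l -> y != m ->
  (f y - f l) / (y - l) + (f r - f m) / (r - m) <=
  (f y - f m) / (y - m) + (f r - f l) / (r - l) + 2 * D.
Proof.
move=> fh D0 H y l m r /andP[py yr] pl lm mr rq yl ym.
have n1 : y - l != 0 by rewrite subr_eq0.
have n2 : y - m != 0 by rewrite subr_eq0.
have n3 : r - m != 0 by rewrite subr_eq0 gt_eqF.
have n4 : r - l != 0 by rewrite subr_eq0 gt_eqF // (lt_trans lm).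
have daff (a b u : R) : b != 0 -> is_derive u 1 (fun u => b^-1 * f (a + u * b)) (h (a + u * b)).
  move=> b0; have d1 : is_derive u 1 (fun u : R => a + u * b) (0 + (1 * b + u * 0)).
    exact: (derD (der_cst a u) (derM (der_id u) (der_cst b u))).
  apply: (is_derive_eq (derMl b^-1 (@der_comp R f (fun u => a + u * b) u _ _ (fh _) d1))).
  by rewrite mulr0 addr0 add0r mul1r mulrCA mulVf // mulr1.
pose A u := l + u * (y - l); pose B u := m + u * (r - m).
pose C u := m + u * (y - m); pose E u := l + u * (r - l).
pose H1 u := ((y - l)^-1 * f (A u) + (r - m)^-1 * f (B u)) - ((y - m)^-1 * f (C u) + (r - l)^-1 * f (E u)).
have HH (u : R) : is_derive u 1 H1 ((h (A u) + h (B u)) - (h (C u) + h (E u))).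
  exact: (derB (derD (daff l _ u n1) (daff m _ u n3)) (derD (daff m _ u n2) (daff l _ u n4))).
have [u u01 Hu] := MVT_der ler01 (fun t _ => HH t).
case/andP: u01 => u0 u1.
have pos : (h (A u) + h (B u)) - (h (C u) + h (E u)) <= 2 * D.
  have AC : A u <= C u by rewrite /A /C; nra.
  have AE : A u <= E u by rewrite /A /E; nra.
  have sm : A u + B u = C u + E u by rewrite /A /B /C /E; ring.
  have pA : p <= A u by rewrite /A; nra.
  have Bq : B u <= q by rewrite /B; nra.
  case: (eqVneq (A u) (B u)) => AB.
    have e1 : C u = A u by lra.
    have e2 : E u = A u by lra.
    by rewrite e1 e2 -AB; lra.
  have AB' : 0 < B u - A u.
    by rewrite subr_gt0 lt_neqAle AB /=; lra.
  pose s := (B u - C u) / (B u - A u).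
  have s01 : 0 <= s <= 1.
    by apply/andP; split; [apply: divr_ge0; lra|rewrite ler_pdivrMr //; lra].
  have s01' : 0 <= 1 - s <= 1 by lra.
  have sE : s * (B u - A u) = B u - C u by rewrite divfK // gt_eqF.
  have bA : p <= A u <= q by lra.
  have bB : p <= B u <= q by lra.
  have := H (A u) (B u) s bA bB s01; have := H (A u) (B u) (1 - s) bA bB s01'.
  have -> : s * A u + (1 - s) * B u = C u by have := sE; lra.
  have -> : (1 - s) * A u + (1 - (1 - s)) * B u = E u by have := sE; lra.
  lra.
have E1 : H1 1 - H1 0 = (f y - f l) / (y - l) + (f r - f m) / (r - m)
   - ((f y - f m) / (y - m) + (f r - f l) / (r - l)).
  rewrite /H1 /A /B /C /E !mul1r !mul0r !addr0 !subrKC.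
  by field; rewrite n1 n2 n3 n4.
by move: Hu; rewrite E1 subr0 mulr1; lra.
Qed.

End FourPoint.

Section Defects.
Context {R : realType} {Om : pseudoPMetricType R}.
Hypothesis hcpt : compact [set: Om].

Lemma cont_sup (P : Type) (p0 : P) (q : Om -> P -> R) (C : R) : (forall w p, q w p <= C) ->
  (forall w0 e, 0 < e -> \forall w \near w0, forall p, `|q w p - q w0 p| <= e) ->
  continuous (fun w => sup [set q w p | p in setT]).
Proof.
move=> qC equi w0; apply/cvgrPdist_le => /= e e0.
have hs w : has_sup [set q w p | p in setT].
  by split; [exists (q w p0); exists p0|exists C => _ [p _ <-]].
have ub w p : q w p <= sup [set q w p | p in setT].
  by apply: ub_le_sup; [case: (hs w)|exists p].
have close w w' : (forall p, `|q w p - q w' p| <= e) ->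
    sup [set q w p | p in setT] <= sup [set q w' p | p in setT] + e.
  move=> H; apply: ge_sup; first by case: (hs w).
  by move=> _ [p _ <-]; have := H p; rewrite ler_norml => /andP[_]; have := ub w' p; lra.
near=> w.
have H : forall p, `|q w p - q w0 p| <= e by near: w; exact: equi.
have H' : forall p, `|q w0 p - q w p| <= e by move=> p; rewrite distrC.
have := close _ _ H; have := close _ _ H'.
by rewrite ler_norml => *; apply/andP; split; lra.
Unshelve. all: by end_near. Qed.

Definition clampI (a b x : R) : R := Num.max a (Num.min b x).

Lemma clampI_itv a b x : a <= b -> a <= clampI a b x <= b.
Proof. by move=> ab; rewrite /clampI le_max lexx /= ge_max ab ge_min lexx. Qed.

Lemma clampI_id a b x : a <= x <= b -> clampI a b x = x.
Proof. by move=> /andP[ax xb]; rewrite /clampI min_r // max_r. Qed.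

Lemma clampI_lip a b x y : `|clampI a b x - clampI a b y| <= `|x - y|.
Proof.
wlog xy : x y / y <= x.
  by move=> H; case: (leP y x) => [/H//|/ltW/H]; rewrite distrC (distrC y).
have H1 : Num.min b y <= Num.min b x by rewrite le_min !ge_min lexx xy orbT.
have H2 : Num.min b x - Num.min b y <= x - y.
  by case: (leP b x) => ?; case: (leP b y) => ?; lra.
have H3 : clampI a b y <= clampI a b x.
  by rewrite /clampI ge_max !le_max lexx /= H1 orbT.
rewrite !ger0_norm ?subr_ge0 //; apply: le_trans H2; rewrite /clampI.
by case: (leP a (Num.min b x)) => ?; case: (leP a (Num.min b y)) => ?; lra.
Qed.

Lemma clampI_cont a b : continuous (clampI a b).
Proof.
move=> x; apply/cvgrPdist_le => /= e e0; near=> y.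
by apply: (le_trans (clampI_lip _ _ _ _)); near: y; exact: cvgr_dist_le.
Unshelve. all: by end_near. Qed.

Variable h : Om -> R -> R.
Hypothesis ch : continuous (fun p : Om * R => h p.1 p.2).

Lemma near_h w0 K e : 0 < e -> \forall w \near w0, forall x, - K <= x <= K -> `|h w x - h w0 x| <= e.
Proof.
move=> e0; have := @near_uniform R Om R (fun p => h p.1 p.2) `[- K, K]%classic w0 e (@segment_compact _ _ _) ch e0.
by apply: filterS => w H x xK; apply: (H x); rewrite /= in_itv.
Qed.

Section Concave.
Variables (b1 b2 : Om -> R).
Hypothesis (cb1 : continuous b1) (cb2 : continuous b2).

Let G w s := h w (b1 w + s * (b2 w - b1 w)).

Let cG : continuous (fun p : Om * R => G p.1 p.2).
Proof.
apply: (@cont_comp2 _ _ (Om * R)%type h (fun p => p.1) (fun p => b1 p.1 + p.2 * (b2 p.1 - b1 p.1)) ch).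
  by move=> p; exact: cvg_fst.
have c1 : continuous (fun p : Om * R => b1 p.1).
  by move=> p; apply: continuous_comp; [exact: cvg_fst|exact: cb1].
have c2 : continuous (fun p : Om * R => b2 p.1).
  by move=> p; apply: continuous_comp; [exact: cvg_fst|exact: cb2].
move=> p; apply: cvgD; first exact: c1.
by apply: cvgM; [exact: cvg_snd|apply: cvgB; [exact: c2|exact: c1]].
Qed.

Definition concave_gap w (p : R * R * R) : R :=
  let t := clamp01 p.2 in let s1 := clamp01 p.1.1 in let s2 := clamp01 p.1.2 in
  t * G w s1 + (1 - t) * G w s2 - G w (t * s1 + (1 - t) * s2).

Definition concave_defect w : R := sup [set concave_gap w p | p in setT].

Let comb01 (t s1 s2 : R) : 0 <= t <= 1 -> 0 <= s1 <= 1 -> 0 <= s2 <= 1 ->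
  0 <= t * s1 + (1 - t) * s2 <= 1.
Proof. by move=> /andP[? ?] /andP[? ?] /andP[? ?]; apply/andP; split; nra. Qed.

Let GC : exists C, 0 <= C /\ forall w s, 0 <= s <= 1 -> `|G w s| <= C.
Proof.
have [C [C0 H]] := @compact_bounded2 R Om (fun p => G p.1 p.2) 1 hcpt cG.
exists C; split => // w s s01; apply: (H w s); case/andP: s01 => *; apply/andP; split; lra.
Qed.

Let gap_ub : exists C, forall w p, concave_gap w p <= C.
Proof.
have [C [C0 HC]] := GC; exists (3 * C) => w p; rewrite /concave_gap /=.
have t01 := clamp01_itv p.2; have s1 := clamp01_itv p.1.1; have s2 := clamp01_itv p.1.2.
have := HC w _ s1; have := HC w _ s2; have := HC w _ (comb01 t01 s1 s2).
rewrite !ler_norml => /andP[? ?] /andP[? ?] /andP[? ?].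
by move: t01 => /andP[? ?]; nra.
Qed.

Lemma concave_defect_cont : continuous concave_defect.
Proof.
have [C HC] := gap_ub.
apply: (@cont_sup (R * R * R)%type (0, 0, 0) concave_gap C HC) => w0 e e0.
have e3 : 0 < e / 2 by rewrite divr_gt0.
have := @near_uniform R Om R (fun p => G p.1 p.2) `[0, 1]%classic w0 (e / 2) (@segment_compact _ _ _) cG e3.
apply: filterS => w /= H p.
have {}H s : 0 <= s <= 1 -> `|G w s - G w0 s| <= e / 2 by move=> s01; apply: (H s); rewrite in_itv.
rewrite /concave_gap /=.
have t01 := clamp01_itv p.2; have s1 := clamp01_itv p.1.1; have s2 := clamp01_itv p.1.2.
have := H _ s1; have := H _ s2; have := H _ (comb01 t01 s1 s2).
rewrite !ler_norml => /andP[? ?] /andP[? ?] /andP[? ?].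
by move: t01 => /andP[? ?]; apply/andP; split; nra.
Qed.

Let gap_le w p : concave_gap w p <= concave_defect w.
Proof.
have [C HC] := gap_ub; apply: ub_le_sup; last by exists p.
by exists C => _ [p' _ <-].
Qed.

Lemma concave_defect_ge0 w : 0 <= concave_defect w.
Proof.
apply: le_trans (gap_le w (0, 0, 0)); rewrite /concave_gap /= clamp01_le0 //.
by rewrite !mul0r !add0r subr0 mul1r mulr0 subrr.
Qed.

Lemma concave_defectP w x y t : b1 w < b2 w -> b1 w <= x <= b2 w -> b1 w <= y <= b2 w -> 0 <= t <= 1 ->
  t * h w x + (1 - t) * h w y <= h w (t * x + (1 - t) * y) + concave_defect w.
Proof.
move=> b12 xb yb t01; have b0 : 0 < b2 w - b1 w by lra.
pose s z := (z - b1 w) / (b2 w - b1 w).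
have s01 z : b1 w <= z <= b2 w -> 0 <= s z <= 1.
  move=> zb; apply/andP; split; first by apply: divr_ge0; lra.
  by rewrite ler_pdivrMr //; lra.
have sE z : b1 w + s z * (b2 w - b1 w) = z by rewrite divfK ?gt_eqF //; ring.
have := gap_le w (s x, s y, t); rewrite /concave_gap /= !clamp01_id ?s01 // /G !sE.
have -> : b1 w + (t * s x + (1 - t) * s y) * (b2 w - b1 w) = t * x + (1 - t) * y.
  by rewrite -{2}(sE x) -{2}(sE y); ring.
lra.
Qed.

Lemma concave_defect_eq0 w : b1 w <= b2 w -> concave_on (h w) (cc (b1 w) (b2 w)) -> concave_defect w = 0.
Proof.
move=> b12 cv; apply/eqP; rewrite eq_le concave_defect_ge0 andbT.
apply: ge_sup; first by exists (concave_gap w (0, 0, 0)); exists (0, 0, 0).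
move=> _ [p _ <-]; rewrite /concave_gap /=.
have t01 := clamp01_itv p.2; have s1 := clamp01_itv p.1.1; have s2 := clamp01_itv p.1.2.
have I s : 0 <= s <= 1 -> cc (b1 w) (b2 w) (b1 w + s * (b2 w - b1 w)).
  by move=> /andP[? ?]; rewrite /cc /=; apply/andP; split; nra.
have := cv _ _ _ (I _ s1) (I _ s2) t01; rewrite /G.
set t := clamp01 p.2; set x1 := clamp01 p.1.1; set x2 := clamp01 p.1.2.
have -> : t * (b1 w + x1 * (b2 w - b1 w)) + (1 - t) * (b1 w + x2 * (b2 w - b1 w)) =
  b1 w + (t * x1 + (1 - t) * x2) * (b2 w - b1 w) by ring.
lra.
Qed.

End Concave.

Section Monotone.
Variable K : R.
Hypothesis K0 : 0 < K.
Hypothesis h0 : forall w, h w 0 = 0.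

Let nK0 : - K <= 0. Proof. by rewrite oppr_le0 ltW. Qed.

Let neg x := clampI (- K) 0 x.
Let neg_itv x : - K <= neg x <= K.
Proof.
by have := clampI_itv x nK0; rewrite -/(neg x) => /andP[? ?]; have := K0; move=> *; apply/andP; split; lra.
Qed.

Definition mono_gap w (p : R * R) : R := h w (Num.min (neg p.1) (neg p.2)) - h w (neg p.2).
Definition sign_gap w (x : R) : R := h w (clampI 0 K x).

Definition mono_defect w : R := sup [set mono_gap w p | p in setT] + sup [set sign_gap w x | x in setT].

Let hC : exists C, 0 <= C /\ forall w x, - K <= x <= K -> `|h w x| <= C.
Proof.
have [C [C0 H]] := @compact_bounded2 R Om (fun p => h p.1 p.2) K hcpt ch.
by exists C; split => // w x xK; exact: (H w x).
Qed.

Let min_itv x y : - K <= Num.min (neg x) (neg y) <= K.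
Proof. by case: (leP (neg x) (neg y)) => _; exact: neg_itv. Qed.

Let pos_itv x : - K <= clampI 0 K x <= K.
Proof. by have := K0; have := clampI_itv x (ltW K0) => /andP[? ?] ?; apply/andP; split; lra. Qed.

Let mono_ub : exists C, forall w p, mono_gap w p <= C.
Proof.
have [C [C0 HC]] := hC; exists (2 * C) => w p; rewrite /mono_gap.
have := HC w _ (min_itv p.1 p.2); have := HC w _ (neg_itv p.2).
by rewrite !ler_norml => /andP[? ?] /andP[? ?]; lra.
Qed.

Let sign_ub : exists C, forall w x, sign_gap w x <= C.
Proof.
have [C [C0 HC]] := hC; exists C => w x; rewrite /sign_gap.
by have := HC w _ (pos_itv x); rewrite !ler_norml => /andP[? ?].
Qed.

Lemma mono_defect_cont : continuous mono_defect.
Proof.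
have [C HC] := mono_ub; have [C' HC'] := sign_ub; move=> w; apply: cvgD.
  apply: (@cont_sup (R * R)%type (0, 0) mono_gap C HC) => w0 e e0.
  have e2 : 0 < e / 2 by rewrite divr_gt0.
  have := near_h w0 K e2; apply: filterS => v H p; rewrite /mono_gap.
  have := H _ (min_itv p.1 p.2); have := H _ (neg_itv p.2).
  by rewrite !ler_norml => /andP[? ?] /andP[? ?]; apply/andP; split; lra.
apply: (@cont_sup R 0 sign_gap C' HC') => w0 e e0.
by have := near_h w0 K e0; apply: filterS => v H p; exact: (H _ (pos_itv p)).
Qed.

Let mono_le w p : mono_gap w p <= sup [set mono_gap w p | p in setT].
Proof.
have [C HC] := mono_ub; apply: ub_le_sup; last by exists p.
by exists C => _ [p' _ <-].
Qed.

Let sign_le w x : sign_gap w x <= sup [set sign_gap w p | p in setT].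
Proof.
have [C HC] := sign_ub; apply: ub_le_sup; last by exists x.
by exists C => _ [p' _ <-].
Qed.

Let mono_ge0 w : 0 <= sup [set mono_gap w p | p in setT].
Proof. by apply: le_trans (mono_le w (0, 0)); rewrite /mono_gap /= minxx subrr. Qed.

Let sign_ge0 w : 0 <= sup [set sign_gap w p | p in setT].
Proof. by apply: le_trans (sign_le w 0); rewrite /sign_gap clampI_id ?h0 // lexx ltW. Qed.

Lemma mono_defect_neg w x y : - K <= x -> x <= y -> y <= 0 -> h w x <= h w y + mono_defect w.
Proof.
move=> Kx xy y0; have := mono_le w (x, y); rewrite /mono_gap /= /neg !clampI_id; try lra.
by rewrite min_l //; have := sign_ge0 w; rewrite /mono_defect; lra.
Qed.

Lemma mono_defect_pos w x : 0 <= x -> x <= K -> h w x <= mono_defect w.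
Proof.
move=> x0 xK; have := sign_le w x; rewrite /sign_gap clampI_id ?x0 //.
by have := mono_ge0 w; rewrite /mono_defect; lra.
Qed.

Lemma mono_defect_eq0 w : (forall x y, x <= y -> y <= 0 -> h w x <= h w y) ->
  (forall x, 0 <= x -> h w x <= 0) -> mono_defect w = 0.
Proof.
move=> H1 H2.
have e1 : sup [set mono_gap w p | p in setT] = 0.
  apply/eqP; rewrite eq_le mono_ge0 andbT.
  apply: ge_sup; first by exists (mono_gap w (0, 0)); exists (0, 0).
  move=> _ [p _ <-]; rewrite /mono_gap subr_le0; apply: H1.
    by rewrite ge_min lexx orbT.
  by have /andP[] := clampI_itv p.2 nK0.
have e2 : sup [set sign_gap w p | p in setT] = 0.
  apply/eqP; rewrite eq_le sign_ge0 andbT.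
  apply: ge_sup; first by exists (sign_gap w 0); exists 0.
  move=> _ [p _ <-]; apply: H2.
  by have /andP[] := clampI_itv p (ltW K0).
by rewrite /mono_defect e1 e2 addr0.
Qed.

End Monotone.
End Defects.

Section Model.
Context {R : realType} {Om : pseudoPMetricType R}.
Hypothesis hsep : hausdorff_space Om.
Hypothesis hcpt : compact [set: Om].
Variable sigma : R -> Om -> Om.
Hypothesis hsigma : is_cont_flow sigma.
Variables (c d : Om -> R) (g : Om -> R -> R).
Hypothesis hc : continuous c.
Hypothesis hd : continuous d.
Hypothesis hg : continuous (fun p : Om * R => g p.1 p.2).
Hypothesis hg1 : forall w x, derivable (g w) x 1.
Hypothesis hgx : continuous (fun p : Om * R => derive1 (g p.1) p.2).
Hypothesis cc3 : forall M : R, exists K : R, forall w x,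
  (K <= x -> d w * x + g w x <= - M) /\ (x <= - K -> M <= d w * x + g w x).
Hypothesis cc4a : forall w, g w 0 = 0 /\ derive1 (g w) 0 = 0.
Hypothesis cc4b : forall w x, 0 <= x -> g w x <= 0.
Hypothesis cc4c : forall w x, x <= 0 -> 0 <= g w x.
Hypothesis cc5 : forall m : probability (Borel Om) R, ergodic sigma m ->
  full_meas m [set w | concave_on (g w) [set x | 0 <= x] /\ convex_on (g w) [set x | x <= 0]].

Definition field (w : Om) (x : R) : R := c w + d w * x + g w x.
Definition trunc (K : R) (w : Om) (x : R) : R := field w (clampI (- K) K x).

Let hgx' : continuous (fun p : Om * R => gx g p.1 p.2) := hgx.

Lemma trunc_in K w x : - K <= x <= K -> trunc K w x = field w x.
Proof. by move=> xK; rewrite /trunc clampI_id. Qed.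

Lemma g_der w (x : R) : is_derive x 1 (g w) (gx g w x).
Proof. exact: der_derive1. Qed.

Lemma gx_cont w : continuous (gx g w).
Proof.
move=> x; apply: (@cont_comp2 R Om R (gx g) (fun=> w) (fun x => x) hgx).
  by move=> y; exact: cvg_cst.
by move=> y; exact: cvg_id.
Qed.

Lemma field_der w (x : R) : is_derive x 1 (field w) (d w + gx g w x).
Proof.
apply: (is_derive_eq (derD (derD (der_cst (c w) x) (derMl (d w) (der_id x))) (g_der w x))).
by rewrite add0r mulr1.
Qed.

Lemma field_cont : continuous (fun p : Om * R => field p.1 p.2).
Proof.
move=> p; apply: cvgD; last exact: hg.
apply: cvgD; first by apply: (@continuous_comp _ _ _ fst c); [exact: cvg_fst|exact: hc].
apply: cvgM; last exact: cvg_snd.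
by apply: (@continuous_comp _ _ _ fst d); [exact: cvg_fst|exact: hd].
Qed.

Lemma nice_trunc K : 0 < K -> exists B L, nice_field (trunc K) B L.
Proof.
move=> K0; have KK : - K <= K by lra.
have [B [B0 HB]] := @compact_bounded2 R Om (fun p => field p.1 p.2) K hcpt field_cont.
have cfx : continuous (fun p : Om * R => d p.1 + gx g p.1 p.2).
  move=> p; apply: cvgD; last exact: hgx.
  by apply: (@continuous_comp _ _ _ fst d); [exact: cvg_fst|exact: hd].
have [L [L0 HL]] := @compact_bounded2 R Om (fun p => d p.1 + gx g p.1 p.2) K hcpt cfx.
exists B, (L + 1); split.
- apply: (@cont_comp2 R Om (Om * R)%type field fst (fun p => clampI (- K) K p.2) field_cont).
    by move=> p; exact: cvg_fst.
  by move=> p; apply: (@continuous_comp _ _ _ snd (clampI (- K) K)); [exact: cvg_snd|exact: clampI_cont].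
- by move=> w x; apply: (HB w); exact: clampI_itv.
- lra.
- move=> w x y; apply: (@le_trans _ _ (L * `|x - y|)); last by apply: ler_wpM2r => //; lra.
  apply: (@le_trans _ _ (L * `|clampI (- K) K x - clampI (- K) K y|)); last first.
    by apply: ler_wpM2l => //; exact: clampI_lip.
  rewrite /trunc; have := clampI_itv x KK; have := clampI_itv y KK.
  move: (clampI _ _ x) (clampI _ _ y) => {}x {}y yK xK.
  wlog xy : x y xK yK / y <= x.
    by move=> H; case: (leP y x) => [/H|/ltW/H]; [exact|rewrite distrC (distrC y); exact].
  rewrite (ger0_norm (_ : 0 <= x - y)) ?subr_ge0 //.
  apply: (@der_bound R (field w) (fun x => d w + gx g w x)) => //.
    by move=> t _; exact: field_der.
  by move=> t /andP[? ?]; apply: (HL w t); apply/andP; split; lra.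
Qed.

Lemma equilibrium_along F b : equilibrium sigma F b -> along sigma b (fun w => F w (b w)).
Proof. by move=> H w t; exact: H. Qed.

Lemma full_meas2 (m : probability (Borel Om) R) (A B C : set Om) : full_meas m A -> full_meas m B ->
  A `&` B `<=` C -> full_meas m C.
Proof.
move=> HA HB ABC.
have HU : m.-negligible (~` (A : set (Borel Om)) `|` ~` (B : set (Borel Om))) := negligibleU HA HB.
apply: (negligibleS _ HU) => w nC; case: (pselect (A w)) => Aw; last by left.
by case: (pselect (B w)) => Bw; [exfalso; apply: nC; apply: ABC|right].
Qed.

Lemma gx_props w : concave_on (g w) [set x | 0 <= x] /\ convex_on (g w) [set x | x <= 0] ->
  (forall x y, x <= y -> y <= 0 -> gx g w x <= gx g w y) /\ (forall x, gx g w x <= 0).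
Proof.
move=> [cv cx].
have H1 x y : x <= y -> y <= 0 -> gx g w x <= gx g w y.
  move=> xy y0; apply: (convex_der_mono (g_der w) (@gx_cont w) cx) => //=; exact: le_trans y0.
have g0 : gx g w 0 = 0 by case: (cc4a w).
split => // x; rewrite -[X in _ <= X]g0; case: (leP 0 x) => x0.
  by apply: (concave_der_mono (g_der w) (@gx_cont w) cv) => /=.
by apply: H1 => //; exact: ltW.
Qed.

Section Slope.
Variable K : R.
Hypothesis K0 : 0 < K.
Let D2 := mono_defect (gx g) K.

Let gx0 w : gx g w 0 = 0. Proof. by case: (cc4a w). Qed.

Let D2_ge0 w : 0 <= D2 w.
Proof. by have := mono_defect_pos hcpt hgx' K0 w (lexx 0) (ltW K0); rewrite gx0. Qed.

Let slope_neg w y1 y2 r : - K <= y1 -> y1 < y2 -> y2 <= r -> r <= 0 ->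
  (g w y2 - g w y1) / (y2 - y1) <= (g w r - g w y1) / (r - y1) + D2 w.
Proof.
move=> Ky y12 y2r r0.
have n1 : y2 - y1 != 0 by rewrite subr_eq0 gt_eqF.
have n2 : r - y1 != 0 by rewrite subr_eq0 gt_eqF // (lt_le_trans y12).
have daff (b u : R) : b != 0 -> is_derive u 1 (fun u => b^-1 * g w (y1 + u * b)) (gx g w (y1 + u * b)).
  move=> b0; have d1 : is_derive u 1 (fun u : R => y1 + u * b) (0 + (1 * b + u * 0)).
    exact: (derD (der_cst y1 u) (derM (der_id u) (der_cst b u))).
  apply: (is_derive_eq (derMl b^-1 (@der_comp R (g w) (fun u => y1 + u * b) u _ _ (g_der w _) d1))).
  by rewrite mulr0 addr0 add0r mul1r mulrCA mulVf // mulr1.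
have [u /andP[u0 u1]] := MVT_der ler01 (fun u _ => derB (daff _ u n1) (daff _ u n2)).
rewrite /= !mul1r !mul0r !addr0 !subrKC subr0 mulr1 => E.
have h1 : y1 + u * (y2 - y1) <= y1 + u * (r - y1) by nra.
have h2 : y1 + u * (r - y1) <= 0 by nra.
have h3 : - K <= y1 + u * (y2 - y1) by nra.
have := mono_defect_neg hcpt hgx' K0 gx0 w h3 h1 h2; rewrite -/D2.
have -> : (g w y2 - g w y1) / (y2 - y1) = (y2 - y1)^-1 * g w y2 - (y2 - y1)^-1 * g w y1 by ring.
have -> : (g w r - g w y1) / (r - y1) = (r - y1)^-1 * g w r - (r - y1)^-1 * g w y1 by ring.
lra.
Qed.

Lemma slope_le w y1 y2 r : - K <= y1 -> y1 < y2 -> y2 <= r -> r <= K ->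
  (g w y2 - g w y1) / (y2 - y1) <= (gplus g w r - g w y1) / (r - y1) + D2 w.
Proof.
move=> Ky y12 y2r rK; have p1 : 0 < y2 - y1 by lra. have p2 : 0 < r - y1 by lra.
case: (leP 0 y1) => y10.
  have -> : gplus g w r = 0 by rewrite /gplus max_l // cc4b //; lra.
  have [z /andP[z1 z2] ->] := MVT_der (ltW y12) (fun t _ => g_der w t).
  rewrite mulfK ?gt_eqF //.
  have : gx g w z <= D2 w by apply: (mono_defect_pos hcpt hgx' K0); lra.
  have : 0 <= (0 - g w y1) / (r - y1).
    by apply: divr_ge0; [rewrite sub0r oppr_ge0 cc4b|exact: ltW].
  lra.
case: (leP r 0) => r0.
  have -> : gplus g w r = g w r by rewrite /gplus max_r // cc4c.
  exact: slope_neg.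
have -> : gplus g w r = 0 by rewrite /gplus max_l // cc4b // ltW.
have gy : 0 <= g w y1 by rewrite cc4c // ltW.
have inc (s : R) : 0 < s -> s <= r - y1 -> (0 - g w y1) / s <= (0 - g w y1) / (r - y1).
  move=> s0 sr; rewrite !sub0r !mulNr lerN2; apply: ler_wpM2l => //.
  by rewrite lef_pV2 ?posrE.
case: (leP y2 0) => y20.
  have := slope_neg w Ky y12 y20 (lexx 0); have [-> _] := cc4a w.
  have q1 : 0 < 0 - y1 by lra. have q2 : 0 - y1 <= r - y1 by lra.
  by have := inc _ q1 q2; lra.
have q2 : y2 - y1 <= r - y1 by lra.
have := inc _ p1 q2; have := D2_ge0 w.
have : (g w y2 - g w y1) / (y2 - y1) <= (0 - g w y1) / (y2 - y1).
  by rewrite ler_pM2r ?invr_gt0 // lerD2r cc4b // ltW.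
lra.
Qed.

Lemma mono_growth e : 0 < e -> exists C, forall w (P : R -> R),
  (forall t : R, is_derive t 1 P (D2 (sigma t w))) ->
  forall s t, s <= t -> P t - P s <= e * (t - s) + C.
Proof.
move=> e0; apply: (ae_zero_growth hsep hcpt hsigma) => //.
  exact: (mono_defect_cont hcpt hgx' K0).
move=> m em; have H := cc5 em; apply: (full_meas2 H H) => w [/gx_props[h1 h2] _] /=.
by apply: (mono_defect_eq0 hcpt hgx' K0 gx0) => // x _; exact: h2.
Qed.

End Slope.

Lemma R_le_rho (cc2 : forall m : probability (Borel Om) R, ergodic sigma m -> (0 < \int[m]_w (d w)%:E)%E)
  (lam1 lam' : R) (R0 rho : Om -> R) : lam1 <= lam' ->
  continuous R0 -> equilibrium sigma (vf c d (gplus g) lam') R0 ->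
  continuous rho -> equilibrium sigma (vf c d (gminus g) lam1) rho -> forall w, R0 w <= rho w.
Proof.
move=> ll cR eR cr er w.
have [del [C [del0 HG]]] := uniform_growth hsep hcpt hsigma hd cc2.
have [A [A0 HA]] : exists A : R -> R, A 0 = 0 /\ forall t : R, is_derive t 1 A (d (sigma t w)).
  apply: primitive_exists => t; apply: continuous_comp; last exact: hd.
  exact: (sigma_cont_time hsigma).
have [C1 [C10 HC1]] := compact_bounded hcpt cR.
have [C2 [C20 HC2]] := compact_bounded hcpt cr.
pose q t := rho (sigma t w) - R0 (sigma t w).
pose dq t := vf c d (gminus g) lam1 (sigma t w) (rho (sigma t w))
  - vf c d (gplus g) lam' (sigma t w) (R0 (sigma t w)).
have Hq (t : R) : is_derive t 1 q (dq t) by exact: (derB (er w t I) (eR w t I)).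
have HE (t : R) : is_derive t 1 (fun t => expR (- A t)) (expR (- A t) * - d (sigma t w)).
  have HN (s : R) : is_derive s 1 (fun t => - A t) (- d (sigma s w)).
    by apply: is_deriveN; exact: HA.
  exact: (@der_comp R expR (fun t => - A t) t _ _ (is_derive_expR _) (HN t)).
have key t : 0 <= t -> - (C1 + C2) * expR (C - del * t) <= q 0.
  move=> t0.
  have := @der_nondecr R (fun s => - (q s * expR (- A s)))
    (fun s => - (dq s * expR (- A s) + q s * (expR (- A s) * - d (sigma s w)))) 0 t t0.
  have h1 s : 0 <= s <= t -> is_derive s 1 (fun s => - (q s * expR (- A s)))
    (- (dq s * expR (- A s) + q s * (expR (- A s) * - d (sigma s w)))).
    by move=> _; apply: is_deriveN; exact: (derM (Hq s) (HE s)).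
  have h2 s : 0 <= s <= t -> 0 <= - (dq s * expR (- A s) + q s * (expR (- A s) * - d (sigma s w))).
    move=> _; have -> : dq s * expR (- A s) + q s * (expR (- A s) * - d (sigma s w)) =
      (dq s - d (sigma s w) * q s) * expR (- A s) by ring.
    rewrite oppr_ge0; apply: mulr_le0_ge0; last exact: expR_ge0.
    rewrite /dq /q /vf; set v := sigma s w.
    have : gminus g v (rho v) <= 0 by rewrite /gminus ge_min lexx.
    have : 0 <= gplus g v (R0 v) by rewrite /gplus le_max lexx.
    lra.
  move=> /(_ h1 h2); rewrite A0 oppr0 expR0 mulr1 lerN2; apply: le_trans.
  have := HG w A HA 0 t t0; rewrite A0 !subr0 => At.
  have qb : - (C1 + C2) <= q t.
    by rewrite /q; have := HC1 (sigma t w); have := HC2 (sigma t w);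
      rewrite !ler_norml => /andP[? ?] /andP[? ?]; lra.
  have Ee : expR (- A t) <= expR (C - del * t) by rewrite ler_expR; lra.
  have := expR_ge0 (- A t); have : 0 <= C1 + C2 by lra.
  nra.
rewrite -subr_ge0 -(sigma0 hsigma w) -/(q 0) leNgt; apply/negP => q0.
have nq0 : 0 < - q 0 / 2 by rewrite divr_gt0 // oppr_gt0.
have [n Hn] := exp_small ((C1 + C2) * expR C) del0 nq0.
have := key n.+1%:R (ler0n _ _); rewrite expRD; lra.
Qed.

Lemma entire_in_box (lam K : R) w (y : R -> R) : 0 < K ->
  (forall w x, K <= x -> field w x + lam <= -1) -> (forall w x, x <= - K -> 1 <= field w x + lam) ->
  (forall t : R, is_derive t 1 y (field (sigma t w) (y t) + lam)) ->
  (exists M, forall t, `|y t| <= M) -> forall t, - K <= y t <= K.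
Proof.
move=> K0 fneg fpos Hy [M HM] t0.
pose K' := Num.max K M.
have KK' : K <= K' by rewrite le_max lexx.
have MK' : M <= K' by rewrite le_max lexx orbT.
have K'0 : 0 < K' by lra.
have [B [L HN]] := nice_trunc K'0.
have yK t : - K' <= y t <= K' by have := HM t; rewrite ler_norml => /andP[? ?]; apply/andP; split; lra.
pose w0 := sigma t0 w; pose z t := y (t + t0).
have Hz (t : R) : is_derive t 1 z (field (sigma t w0) (z t) + lam).
  by apply: der_shift; rewrite /z /w0 -sigmaD // [t0 + t]addrC; exact: Hy.
have oz : is_orbit sigma (trunc K') lam w0 z.
  by move=> t; rewrite trunc_in //; exact: yK.
have z0 : z 0 = y t0 by rewrite /z add0r.
have zphi t := orbit_phi hsigma HN oz t.
have M0 : 0 <= M by exact: le_trans (HM 0).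
pose T := 2 * M + 1; have T0 : 0 <= T by rewrite /T; lra.
have nT : - T <= 0 by lra.
have := HM t0; have := HM (- T + t0); rewrite -/(z (- T)) -z0 !ler_norml => /andP[a1 a2] /andP[a3 a4].
apply/andP; split; rewrite leNgt; apply/negP => yt.
  have alongK : along sigma (fun=> - K) (fun=> 0) by move=> v s; exact: der_cst.
  have low_z s : 0 <= s -> z (- s) <= - K.
    move=> s0; rewrite zphi.
    apply: (@subeq_bwd _ _ sigma (trunc K') B L hsigma HN lam (fun=> - K) w0 (z 0) s) => //; last exact: ltW.
    exists (fun=> 0); split => // v; rewrite trunc_in; last by apply/andP; split; lra.
    by have := fpos v (- K) (lexx _); lra.
  have : 1 * 0 - 1 * - T <= z 0 - z (- T).
    apply: (@der_le R (fun s => 1 * s) (fun=> 1 * 1) z _ (- T) 0 nT _ (fun s _ => Hz s)).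
    move=> s /andP[s1 s2]; rewrite mulr1; apply: fpos.
    by have := low_z (- s); rewrite opprK oppr_ge0; exact.
  by rewrite /T; lra.
have alongK : along sigma (fun=> K) (fun=> 0) by move=> v s; exact: der_cst.
have high_z s : 0 <= s -> K <= z (- s).
  move=> s0; rewrite zphi.
  have := @super_bwd _ _ sigma (trunc K') B L hsigma HN (fun=> K) (fun=> 0) lam 0 w0 (z 0) s alongK (lexx 0).
  rewrite mul0r addr0; apply => //; last exact: ltW.
  move=> v; rewrite trunc_in; last by apply/andP; split; lra.
  by have := fneg v K (lexx _); lra.
have : z 0 - z (- T) <= (-1) * 0 - (-1) * - T.
  apply: (@der_le R z _ (fun s => (-1) * s) (fun=> (-1) * 1) (- T) 0 nT (fun s _ => Hz s)).
  move=> s /andP[s1 s2]; rewrite mulr1; apply: fneg.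
  by have := high_z (- s); rewrite opprK oppr_ge0; exact.
by rewrite /T; lra.
Qed.

Lemma att_low_facts (lam2 lam' : R) (R0 : Om -> R) : lam2 < lam' -> continuous R0 ->
  equilibrium sigma (vf c d (gplus g) lam') R0 ->
  [/\ continuous (att_low sigma (vf c d g lam2)),
      equilibrium sigma (vf c d g lam2) (att_low sigma (vf c d g lam2)) &
      forall w, att_low sigma (vf c d g lam2) w <= R0 w].
Proof.
move=> ll cR eR.
have [Cc [Cc0 HCc]] := compact_bounded hcpt hc.
have [CR [CR0 HCR]] := compact_bounded hcpt cR.
have [K3 HK3] := cc3 (Cc + `|lam2| + 1).
pose K := Num.max (Num.max K3 (CR + 1)) 1.
have K3K : K3 <= K by rewrite /K !le_max lexx.
have CRK : CR + 1 <= K by rewrite /K !le_max lexx orbT.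
have K1 : 1 <= K by rewrite /K !le_max lexx orbT.
have K0 : 0 < K by lra.
have lamb := ler_norm lam2; have lamb' : - `|lam2| <= lam2 by rewrite lerNl -normrN ler_norm.
have fneg w x : K <= x -> field w x + lam2 <= -1.
  move=> Kx; have [/(_ (le_trans K3K Kx)) h _] := HK3 w x.
  by have := HCc w; rewrite ler_norml => /andP[? ?]; rewrite /field; lra.
have fpos w x : x <= - K -> 1 <= field w x + lam2.
  move=> Kx; have x3 : x <= - K3 by lra.
  have [_ /(_ x3) h] := HK3 w x.
  by have := HCc w; rewrite ler_norml => /andP[? ?]; rewrite /field; lra.
have [B [L HN]] := nice_trunc K0.
have RK w : - K < R0 w < K.
  by have := HCR w; rewrite ler_norml => /andP[? ?]; apply/andP; split; lra.
have RKw w : - K <= R0 w <= K by case/andP: (RK w) => /ltW -> /ltW ->.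
pose N := trunc K; pose eta := lam' - lam2; have eta0 : 0 < eta by rewrite subr_gt0.
have aR := equilibrium_along eR.
have sR w : N w (R0 w) + lam2 + eta <= vf c d (gplus g) lam' w (R0 w).
  rewrite /N trunc_in // /vf /field /eta.
  have : g w (R0 w) <= gplus g w (R0 w) by rewrite /gplus le_max lexx orbT.
  lra.
pose b0 : Om -> R := fun=> - K.
have a0 : along sigma b0 (fun=> 0) by move=> v s; exact: der_cst.
have NK w : 1 <= N w (- K) + lam2.
  by rewrite /N trunc_in; [exact: fpos|apply/andP; split; lra].
have s0 : subeq sigma N lam2 b0 by exists (fun=> 0); split => // v; have := NK v; rewrite /b0; lra.
have fwdR t w : 0 <= t -> fwd sigma N lam2 b0 t w <= R0 w.
  move=> t0; have := @super_fwd _ _ sigma N B L hsigma HN R0 _ lam2 eta (sigma (- t) w) (b0 (sigma (- t) w)) t aR (ltW eta0) sR t0.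
  rewrite sigmaNK // -/(fwd sigma N lam2 b0 t w).
  have : b0 (sigma (- t) w) <= R0 (sigma (- t) w) by have /andP[] := RKw (sigma (- t) w).
  move=> h /(_ h); have : 0 <= eta * gain L t by rewrite mulr_ge0 ?gain_ge0 // ltW.
  lra.
have fb : fwd_bounded sigma N lam2 b0.
  by exists K => t w t0; apply: (le_trans (fwdR t w t0)); case/andP: (RKw w).
pose l := low sigma N lam2 b0.
have il : invariant sigma N lam2 l by exact: (low_invariant hsigma HN).
have lR w : l w <= R0 w by apply: low_ub => // t t0; exact: fwdR.
pose g1 := gain L 1; have g10 : 0 < g1 by exact: gain1_gt0.
have lgap w : l w + eta * g1 <= R0 w.
  have := @super_fwd _ _ sigma N B L hsigma HN R0 _ lam2 eta (sigma (- 1) w) (l (sigma (- 1) w)) 1 aR (ltW eta0) sR ler01.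
  by rewrite il sigmaNK //; apply.
have lK w : - K < l w.
  apply: (@lt_le_trans _ _ (fwd sigma N lam2 b0 1 w)); last exact: fwd_low.
  have := @sub_fwd _ _ sigma N B L hsigma HN b0 (fun=> 0) lam2 1 (sigma (- 1) w) (b0 (sigma (- 1) w)) 1 a0 ler01.
  rewrite sigmaNK // -/(fwd sigma N lam2 b0 1 w) -/g1 mul1r => H.
  have h1 v : 0 + 1 <= N v (b0 v) + lam2 by rewrite add0r; exact: NK.
  by have := H h1 ler01 (lexx _); rewrite /b0; lra.
have lKw w : - K <= l w <= K by have := lK w; have := lR w; have /andP[] := RKw w; move=> *; apply/andP; split; lra.
pose kap := eta / (2 * K); have kap0 : 0 < kap by apply: divr_gt0 => //; lra.
have kap2 : 0 < kap / 2 by rewrite divr_gt0.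
have [C HC] := mono_growth K0 kap2.
pose k := expR (2 * ln (2 * K) - ln (eta * g1) + C).
have eg0 : 0 < eta * g1 by exact: mulr_gt0.
have contr T w : 0 <= T -> `|fwd sigma N lam2 b0 T w - l w| <= k * expR (- (kap / 2 * T)).
  move=> T0; pose v := sigma (- T) w; pose y := phi sigma N lam2 v (- K).
  have vT : sigma T v = w by exact: sigmaNK.
  have yl t : y t < l (sigma t v) by rewrite -il; apply: (phi_lt hsigma HN).
  have yK t : 0 <= t -> - K <= y t by move=> t0; exact: (@subeq_fwd _ _ sigma N B L hsigma HN lam2 b0 v (- K) t s0 t0).
  have [P [P0 HP]] : exists P : R -> R, P 0 = 0 /\ forall t : R, is_derive t 1 P (mono_defect (gx g) K (sigma t v)).
    apply: primitive_exists => t.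
    apply: (@continuous_comp R Om R (fun t => sigma t v) (mono_defect (gx g) K)).
      exact: (sigma_cont_time hsigma).
    exact: (mono_defect_cont hcpt hgx' K0).
  have dl := invariant_along hsigma HN il v.
  have dr := aR v.
  have dy (t : R) : is_derive t 1 y (N (sigma t v) (y t) + lam2) by exact: (phi_der hsigma HN).
  pose E t := ln (l (sigma t v) - y t) - ln (R0 (sigma t v) - y t).
  pose dE t := ((N (sigma t v) (l (sigma t v)) + lam2) - (N (sigma t v) (y t) + lam2)) / (l (sigma t v) - y t)
    - (vf c d (gplus g) lam' (sigma t v) (R0 (sigma t v)) - (N (sigma t v) (y t) + lam2)) / (R0 (sigma t v) - y t).
  have p1 t : 0 < l (sigma t v) - y t by rewrite subr_gt0.
  have p2 t : eta * g1 < R0 (sigma t v) - y t by have := lgap (sigma t v); have := yl t; lra.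
  have p3 t : 0 < R0 (sigma t v) - y t by have := p2 t; lra.
  have HE (t : R) : is_derive t 1 E (dE t).
    have e1 := @der_ln R (fun t => l (sigma t v) - y t) t _ (p1 t) (derB (dl t) (dy t)).
    have e2 := @der_ln R (fun t => R0 (sigma t v) - y t) t _ (p3 t) (derB (dr t) (dy t)).
    exact: (derB e1 e2).
  pose G t := P t - kap * t.
  have HG (t : R) : is_derive t 1 G (mono_defect (gx g) K (sigma t v) - kap * 1).
    exact: (derB (HP t) (derMl kap (der_id t))).
  have EG : E T - E 0 <= G T - G 0.
    apply: (@der_le R E dE G _ 0 T T0 (fun t _ => HE t) (fun t _ => HG t)).
    move=> t /andP[t0 tT]; rewrite /dE; have := p1 t; have := p3 t; have := yK t t0.
    set u := sigma t v; set yt := y t => Ky q3 q1.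
    have yKw : - K <= yt <= K by have /andP[_ h] := RKw u; apply/andP; split; lra.
    have /andP[_ RKu] := RKw u.
    have q1' : yt < l u by lra.
    have := slope_le K0 u Ky q1' (lR u) RKu.
    rewrite /N !trunc_in //.
    have -> : (field u (l u) + lam2 - (field u yt + lam2)) / (l u - yt) =
      d u + (g u (l u) - g u yt) / (l u - yt).
      by rewrite /field; field; rewrite gt_eqF.
    have -> : (vf c d (gplus g) lam' u (R0 u) - (field u yt + lam2)) / (R0 u - yt) =
      d u + (gplus g u (R0 u) - g u yt) / (R0 u - yt) + eta / (R0 u - yt).
      by rewrite /field /vf /eta; field; rewrite gt_eqF.
    have : kap <= eta / (R0 u - yt).
      rewrite /kap; apply: ler_wpM2l; first exact: ltW.
      by rewrite lef_pV2 ?posrE //; lra.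
    lra.
  have PT := HC v P HP 0 T T0.
  have l1 : ln (R0 w - y T) <= ln (2 * K).
    have := p3 T; rewrite vT => h; rewrite ler_ln ?posrE //; last by lra.
    by have := yK T T0; have /andP[_] := RKw w; lra.
  have y0 : y 0 = - K by exact: (phi0 hsigma HN).
  have l2 : ln (l v - y 0) <= ln (2 * K).
    have := p1 0; rewrite sigma0 // => h; rewrite ler_ln ?posrE //; last by lra.
    by rewrite y0; have /andP[_] := lKw v; lra.
  have l3 : ln (eta * g1) <= ln (R0 v - y 0).
    have := p2 0; have := p3 0; rewrite sigma0 // => h h'.
    by rewrite ler_ln ?posrE //; lra.
  move: EG; rewrite /E /G P0 sigma0 // vT; move: PT; rewrite P0 => PT EG.
  have q1 : 0 < l w - y T by have := p1 T; rewrite vT.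
  have -> : fwd sigma N lam2 b0 T w = y T by [].
  rewrite distrC gtr0_norm // -expRD -[X in X <= _]lnK ?posrE // ler_expR.
  lra.
have cl : continuous l.
  apply: (@uniform_limit_cont R Om (fun n => fwd sigma N lam2 b0 n.+1%:R) l).
    by move=> n; apply: (@phi_cont_along _ _ sigma N B L hsigma HN lam2 (- n.+1%:R) n.+1%:R b0) => w; exact: cvg_cst.
  move=> e e0; have [n Hn] := exp_small k kap2 e0; exists n => w.
  by apply: le_trans Hn; apply: contr.
have ael (w : Om) (t : R) : is_derive t 1 (fun t => l (sigma t w)) (vf c d g lam2 (sigma t w) (l (sigma t w))).
  by have := invariant_along hsigma HN il w t; rewrite /N trunc_in.
have attE : att_low sigma (vf c d g lam2) = l.
  apply/funext => w; rewrite /att_low; set X := [set x | _].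
  have Xl : X (l w).
    exists (fun t => l (sigma t w)); split; first by rewrite sigma0.
      by move=> t _; exact: ael.
    by exists K => t; rewrite ler_norml; exact: lKw.
  have lbX x : X x -> l w <= x.
    move=> [y [y0 ysol yM]].
    have Hy (t : R) : is_derive t 1 y (field (sigma t w) (y t) + lam2) by exact: ysol.
    have yK := entire_in_box K0 fneg fpos Hy yM.
    have oy : is_orbit sigma N lam2 w y by move=> t; rewrite /N trunc_in //; exact: Hy.
    apply: low_ub => // T T0; rewrite /fwd.
    have xE : x = phi sigma N lam2 (sigma (- T) w) (y (- T)) T.
      rewrite (orbit_phi hsigma HN oy (- T)) y0.
      by rewrite (phiNK hsigma HN).
    by rewrite xE; apply: (phi_le hsigma HN); case/andP: (yK (- T)).
  apply/eqP; rewrite eq_le; apply/andP; split.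
    by apply: ge_inf => //; exists (l w) => x /lbX.
  by apply: lb_le_inf => //; exists (l w).
by rewrite attE; split => // w t _; exact: ael.
Qed.

End Model.

Section SaddleNode.
Context {R : realType} {Om : pseudoPMetricType R}.
Hypothesis hsep : hausdorff_space Om.
Hypothesis hcpt : compact [set: Om].
Variable sigma : R -> Om -> Om.
Hypothesis hsigma : is_cont_flow sigma.

Lemma saddle_node_up_of_band (c d : Om -> R) (g : Om -> R -> R)
  (hc : continuous c) (hd : continuous d)
  (hg : continuous (fun p : Om * R => g p.1 p.2))
  (hg1 : forall w x, derivable (g w) x 1)
  (hgx : continuous (fun p : Om * R => derive1 (g p.1) p.2))
  (cc2 : forall m : probability (Borel Om) R, ergodic sigma m ->
           (0 < \int[m]_w (d w)%:E)%E)
  (cc3 : forall M : R, exists K : R, forall w x,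
           (K <= x -> d w * x + g w x <= - M) /\ (x <= - K -> M <= d w * x + g w x))
  (cc4a : forall w, g w 0 = 0 /\ derive1 (g w) 0 = 0)
  (cc4b : forall w x, 0 <= x -> g w x <= 0)
  (cc4c : forall w x, x <= 0 -> 0 <= g w x)
  (cc5 : forall m : probability (Borel Om) R, ergodic sigma m ->
           full_meas m [set w | concave_on (g w) [set x | 0 <= x] /\
                                convex_on (g w) [set x | x <= 0]])
  (lam1 lam2 lamp : R) (rho : Om -> R) :
  lam1 < lam2 -> lam2 < lamp ->
  continuous rho -> equilibrium sigma (vf c d (gminus g) lam1) rho ->
  (forall lam, lam < lamp -> exists R0, continuous R0 /\ equilibrium sigma (vf c d (gplus g) lam) R0) ->
  (forall w, att_low sigma (vf c d g lam2) w < rho w) ->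
  (forall m : probability (Borel Om) R, ergodic sigma m ->
    full_meas m [set w | concave_on (gx g w) (cc (att_low sigma (vf c d g lam2) w) (rho w))]) ->
  exists xi, lamp <= xi /\ saddle_node_up sigma (vf c d g) xi.
Proof.
move=> l12 l2p cr er HR b1lt hband.
have alow lam' R0 : lam2 < lam' -> continuous R0 -> equilibrium sigma (vf c d (gplus g) lam') R0 -> _ :=
  fun h1 h2 h3 => att_low_facts hsep hcpt hsigma hc hd hg hg1 hgx cc3 cc4a cc4b cc4c cc5 h1 h2 h3.
move: b1lt hband alow; set b1 := att_low sigma (vf c d g lam2) => b1lt hband alow.
have [cb1 eb1] : continuous b1 /\ equilibrium sigma (vf c d g lam2) b1.
  have mid : (lam2 + lamp) / 2 < lamp by lra.
  have mid' : lam2 < (lam2 + lamp) / 2 by lra.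
  have [R0 [cR eR]] := HR _ mid; by have [] := alow _ _ mid' cR eR.
have [C1 [C10 HC1]] := compact_bounded hcpt cb1.
have [C2 [C20 HC2]] := compact_bounded hcpt cr.
pose C0 := C1 + C2 + 1; have C00 : 0 < C0 by rewrite /C0; lra.
have b1C w : `|b1 w| <= C0 by have := HC1 w; rewrite /C0; lra.
have rhoC w : `|rho w| <= C0 by have := HC2 w; rewrite /C0; lra.
pose K := C0 + 1; have K0 : 0 < K by rewrite /K; lra.
have [B [L HN]] := nice_trunc hcpt hc hd hg hg1 hgx K0.
pose N := trunc c d g K; have {}HN : nice_field N B L := HN.
have bandK w x : b1 w <= x <= rho w -> - C0 <= x <= C0.
  by move=> /andP[? ?]; have := b1C w; have := rhoC w;
    rewrite !ler_norml => /andP[? ?] /andP[? ?]; apply/andP; split; lra.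
have bandN w x : b1 w <= x <= rho w -> N w x = field c d g w x.
  by move=> /bandK/andP[? ?]; apply: trunc_in; rewrite /K; apply/andP; split; lra.
have b1b w : b1 w <= b1 w <= rho w by rewrite lexx ltW.
have rhob w : b1 w <= rho w <= rho w by rewrite lexx ltW.
have hgx' : continuous (fun p : Om * R => gx g p.1 p.2) := hgx.
pose D := concave_defect (gx g) b1 rho.
have cD : continuous D by exact: (concave_defect_cont hcpt hgx' cb1 cr).
have DG e : 0 < e -> exists C, forall w (P : R -> R),
    (forall t : R, is_derive t 1 P (D (sigma t w))) ->
    forall s t, s <= t -> P t - P s <= e * (t - s) + C.
  move=> e0; apply: (ae_zero_growth hsep hcpt hsigma cD e0) => m em.
  apply: (full_meas2 (hband m em) (hband m em)) => w [cv _].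
  by apply: (concave_defect_eq0 hcpt hgx' cb1 cr) => //; exact: ltW.
have Hdef w y l m : b1 w <= y <= rho w -> b1 w <= l -> l < m -> m < rho w -> y != l -> y != m ->
  (N w y - N w l) / (y - l) + (N w (rho w) - N w m) / (rho w - m) <=
  (N w y - N w m) / (y - m) + (N w (rho w) - N w l) / (rho w - l) + 2 * D w.
  move=> yb bl lm mr yl ym.
  rewrite !bandN //; try (by apply/andP; split; lra).
  apply: (@four_point R (field c d g w) (fun x => d w + gx g w x) (b1 w) (rho w) (D w)) => //.
  - by move=> t; exact: (field_der c d hg1 w t).
  - exact: (concave_defect_ge0 hcpt hgx' cb1 cr).
  - move=> x z t xb zb t01.
    have := concave_defectP hcpt hgx' cb1 cr (b1lt w) xb zb t01; rewrite -/D; lra.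
pose db1 w := vf c d g lam2 w (b1 w).
have Hb1 : along sigma b1 db1 by exact: (equilibrium_along eb1).
have Hb1e w : db1 w = N w (b1 w) + lam2 by rewrite bandN.
pose drho w := vf c d (gminus g) lam1 w (rho w).
have Hrho : along sigma rho drho by exact: (equilibrium_along er).
have Hrs w : drho w <= N w (rho w) + lam1.
  rewrite bandN // /drho /vf /field.
  have : gminus g w (rho w) <= g w (rho w) by rewrite /gminus ge_min lexx orbT.
  lra.
have sepI lam : lam2 < lam < lamp -> exists gam, separated sigma N b1 rho lam gam.
  move=> /andP[l2l llp].
  pose lam' := (lam + lamp) / 2.
  have l1 : lam < lam' by rewrite /lam'; lra. have l2 : lam' < lamp by rewrite /lam'; lra.
  have l3 : lam2 < lam' by lra. have l4 : lam1 <= lam' by lra.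
  have [R0 [cR eR]] := HR _ l2.
  have [_ _ b1R] := alow _ _ l3 cR eR.
  have Rr := R_le_rho hsep hcpt hsigma hd cc2 l4 cR eR cr er.
  pose eta := lam' - lam; have eta0 : 0 < eta by rewrite subr_gt0.
  have aR := equilibrium_along eR.
  have sR w : N w (R0 w) + lam + eta <= vf c d (gplus g) lam' w (R0 w).
    rewrite bandN; last by rewrite b1R Rr.
    rewrite /vf /field /eta.
    have : g w (R0 w) <= gplus g w (R0 w) by rewrite /gplus le_max lexx orbT.
    lra.
  have sb1 := subeq_b1 Hb1 Hb1e (ltW l2l).
  have fwdR t w : 0 <= t -> fwd sigma N lam b1 t w <= R0 w.
    move=> t0; have := @super_fwd _ _ sigma N B L hsigma HN R0 _ lam eta (sigma (- t) w) (b1 (sigma (- t) w)) t aR (ltW eta0) sR t0 (b1R _).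
    rewrite sigmaNK // -/(fwd sigma N lam b1 t w).
    have : 0 <= eta * gain L t by rewrite mulr_ge0 ?gain_ge0 // ltW.
    lra.
  exists (eta * gain L 1); split; first by rewrite mulr_gt0 // gain1_gt0.
  move=> w s t s0 t0.
  have t1 : t <= t + 1 by lra.
  have := fwd_mono hsigma HN w sb1 t0 t1.
  have := @super_fwd _ _ sigma N B L hsigma HN R0 _ lam eta (sigma (- 1) w) (fwd sigma N lam b1 t (sigma (- 1) w)) 1 aR (ltW eta0) sR ler01 (fwdR t _ t0).
  have -> : phi sigma N lam (sigma (- 1) w) (fwd sigma N lam b1 t (sigma (- 1) w)) 1 = fwd sigma N lam b1 (t + 1) w.
    rewrite /fwd (phiD hsigma HN) -!sigmaD //.
    have -> : - (t + 1) + t = - 1 by ring.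
    by have -> : - 1 + - t = - (t + 1) by ring.
  rewrite sigmaNK //.
  have := @super_bwd _ _ sigma N B L hsigma HN R0 _ lam eta (sigma s w) (rho (sigma s w)) s aR (ltW eta0) sR s0 (Rr _).
  rewrite sigmaKN // -/(bwd sigma N lam rho s w).
  have : 0 <= eta * gain L s by rewrite mulr_ge0 ?gain_ge0 // ltW.
  lra.
have [xi [lpxi sepx [axi [rxi [lims [inva invr] banda bandr [ale gapx]]]]]] :=
  continuation_core hsigma HN Hb1 Hb1e Hrho Hrs l12 C00 b1C rhoC cD DG Hdef l2p sepI.
exists xi; split => //.
have l2xi : lam2 < xi by lra.
have inv_eq lam l : invariant sigma N lam l -> (forall w, b1 w <= l w <= rho w) ->
    equilibrium sigma (vf c d g lam) l.
  move=> il lb w t _; have := invariant_along hsigma HN il w t.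
  by rewrite /= bandN.
exists (xi - lam2); split; first by lra.
have -> : xi - (xi - lam2) = lam2 by ring.
exists (fun lam => low sigma N lam b1), (fun lam => high sigma N lam rho); split.
- move=> lam lx; have [gam sep] := sepx lam lx; case/andP: (lx) => l2l lxi.
  have [il ih h1 h2 h3] := separated_limits hsigma HN Hb1 Hb1e Hrho Hrs l12 b1C rhoC (ltW l2l) sep.
  have lb w := low_band hsigma HN Hb1 Hb1e Hrho Hrs l12 b1C rhoC w (ltW l2l) sep.
  have hb w := high_band hsigma HN Hb1 Hb1e Hrho Hrs l12 b1C rhoC w (ltW l2l) sep.
  have near0 w x : - C0 <= x <= C0 -> exists eps, 0 < eps /\
      forall t, `|t| < eps -> N (sigma t w) (phi sigma N lam w x t) = field c d g (sigma t w) (phi sigma N lam w x t).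
    move=> xC; have cp := der_contT (phi_der hsigma HN lam w x).
    have [eps [eps0 Heps]] := cont_near 0 cp ltr01.
    exists eps; split => // t te; apply: trunc_in.
    have := Heps t; rewrite subr0 (phi0 hsigma HN) => /(_ (ltW te)).
    by rewrite ler_norml /K => /andP[? ?]; case/andP: xC => ? ?; apply/andP; split; lra.
  split.
  + split; first exact: (low_cont hsigma HN Hb1 Hb1e Hrho Hrs l12 C00 b1C rhoC cD DG Hdef cb1 (ltW l2l) sep).
    split; first exact: inv_eq.
    have [k [beta [del [k1 beta0 del0 H]]]] := low_hyperbolic hsigma HN Hb1 Hb1e Hrho Hrs l12 C00 b1C rhoC cD DG Hdef l2l sep.
    exists k, beta, del; split => // w x xd; exists (phi sigma N lam w x).
    have HH := H w x xd; split; first exact: (phi0 hsigma HN).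
      have [bx _] := HH 0 (lexx _); rewrite sigma0 // (phi0 hsigma HN) in bx.
      have [eps [eps0 Heps]] := near0 w x (bandK w x bx).
      exists eps; split => // t /= te; have := phi_der hsigma HN lam w x t.
      case: (leP 0 t) => t0; first by have [bt _] := HH t t0; rewrite bandN.
      by rewrite Heps // ltr0_norm //; lra.
    by move=> t t0; have [_] := HH t t0.
  + split; first exact: (high_cont hsigma HN Hb1 Hb1e Hrho Hrs l12 C00 b1C rhoC cD DG Hdef cr (ltW l2l) sep).
    split; first exact: inv_eq.
    have [k [beta [del [k1 beta0 del0 H]]]] := high_hyperbolic hsigma HN Hb1 Hb1e Hrho Hrs l12 C00 b1C rhoC cD DG Hdef l2l sep.
    exists k, beta, del; split => // w x xd; exists (phi sigma N lam w x).
    have HH := H w x xd; split; first exact: (phi0 hsigma HN).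
      have [bx _] := HH 0 (lexx _); rewrite sigma0 // (phi0 hsigma HN) in bx.
      have [eps [eps0 Heps]] := near0 w x (bandK w x bx).
      exists eps; split => // t /= te; have := phi_der hsigma HN lam w x t.
      case: (leP t 0) => t0; first by have [bt _] := HH t t0; rewrite bandN.
      by rewrite Heps // gtr0_norm.
    by move=> t t0; have [_] := HH t t0.
  + by move=> w; case: sep => g0 _; have := h2 w; lra.
- move=> lam0 /andP[l0 l0x] e e0.
  pose mu := (lam0 + xi) / 2.
  have mx : lam2 < mu < xi by rewrite /mu; apply/andP; split; lra.
  have [gam sep] := sepx mu mx; have gam0 : 0 < gam by case: sep.
  have [del [del0 H]] := low_high_param_cont hsigma HN Hb1 Hb1e Hrho Hrs l12 C00 b1C rhoC cD DG Hdef gam0 e0.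
  have lmu : lam0 < mu by rewrite /mu; lra.
  exists (Num.min del (mu - lam0)); split; first by rewrite lt_min del0 subr_gt0.
  move=> lam /andP[q1 q2]; rewrite lt_min => /andP[d1 d2] w.
  apply: H => //; [exact: ltW|exact: ltW| | |exact: ltW].
    apply: (separated_mono hsigma HN _ sep).
    by move: d2; rewrite ltr_norml => /andP[]; lra.
  by apply: (separated_mono hsigma HN _ sep); exact: ltW.
- move=> m1 m2 h1 h2 h3 w.
  have mx : lam2 < m2 < xi by rewrite h3 (lt_trans h1 h2).
  have [gam sep] := sepx m2 mx.
  exact: (low_high_strict hsigma HN Hb1 Hb1e Hrho Hrs l12 b1C rhoC w (ltW h1) h2 sep).
- exists axi, rxi; split => //; exact: inv_eq.
Qed.

End SaddleNode.

Section Reflection.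
Context {R : realType} {Om : pseudoPMetricType R}.
Variable sigma : R -> Om -> Om.
Implicit Types (F : Om -> R -> R) (b : Om -> R).

Definition reflect_field F : Om -> R -> R := fun w x => - F w (- x).

Lemma is_derN (f : R -> R) (t a : R) : is_derive t 1 f a -> is_derive t 1 (fun s => - f s) (- a).
Proof. by move=> h; apply: is_deriveN. Qed.

Lemma is_sol_reflect F w I y : is_sol sigma F w I y ->
  is_sol sigma (reflect_field F) w I (fun t => - y t).
Proof. by move=> H t It; rewrite /reflect_field opprK; apply: is_derN; exact: H. Qed.

Lemma is_sol_unreflect F w I y : is_sol sigma (reflect_field F) w I y ->
  is_sol sigma F w I (fun t => - y t).
Proof.
by move=> H t It; apply: (is_derive_eq (is_derN (H t It))); rewrite /reflect_field opprK.
Qed.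

Lemma equilibrium_reflect F b : equilibrium sigma F b ->
  equilibrium sigma (reflect_field F) (fun w => - b w).
Proof. by move=> H w; exact: (is_sol_reflect (H w)). Qed.

Lemma equilibrium_unreflect F b : equilibrium sigma (reflect_field F) b ->
  equilibrium sigma F (fun w => - b w).
Proof. by move=> H w; exact: (is_sol_unreflect (H w)). Qed.

Let distN (x y : R) : `|x - - y| = `|- x - y|.
Proof. by rewrite -normrN; congr (`|_|); ring. Qed.

Lemma attr_unreflect F b : attr_hyp_copy sigma (reflect_field F) b ->
  attr_hyp_copy sigma F (fun w => - b w).
Proof.
move=> [cb [eb [k [beta [del [k1 beta0 del0 H]]]]]]; split; first by move=> w; apply: cvgN; exact: cb.
split; first exact: equilibrium_unreflect.
exists k, beta, del; split => // w x xb.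
have [|y [y0 [eps [eps0 ys]] Hy]] := H w (- x); first by rewrite -distN.
exists (fun t => - y t); split; first by rewrite y0 opprK.
  by exists eps; split => //; exact: is_sol_unreflect.
by move=> t t0; rewrite !distN opprK; exact: Hy.
Qed.

Lemma rep_unreflect F b : rep_hyp_copy sigma (reflect_field F) b ->
  rep_hyp_copy sigma F (fun w => - b w).
Proof.
move=> [cb [eb [k [beta [del [k1 beta0 del0 H]]]]]]; split; first by move=> w; apply: cvgN; exact: cb.
split; first exact: equilibrium_unreflect.
exists k, beta, del; split => // w x xb.
have [|y [y0 [eps [eps0 ys]] Hy]] := H w (- x); first by rewrite -distN.
exists (fun t => - y t); split; first by rewrite y0 opprK.
  by exists eps; split => //; exact: is_sol_unreflect.
by move=> t t0; rewrite !distN opprK; exact: Hy.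
Qed.

Lemma att_low_reflect F w : att_low sigma (reflect_field F) w = - att_up sigma F w.
Proof.
rewrite /att_low /att_up /inf; congr (- sup _); apply/seteqP; split => x /=.
  move=> [z [y [y0 ys [M HM]]] <-]; exists (fun t => - y t); split; first by rewrite y0.
    exact: is_sol_unreflect.
  by exists M => t; rewrite normrN.
move=> [y [y0 ys [M HM]]]; exists (- x); last by rewrite opprK.
exists (fun t => - y t); split; first by rewrite y0.
  exact: is_sol_reflect.
by exists M => t; rewrite normrN.
Qed.

Lemma saddle_node_reflect (F : R -> Om -> R -> R) xi :
  saddle_node_up sigma (fun lam => reflect_field (F (- lam))) xi -> saddle_node_down sigma F (- xi).
Proof.
move=> [del [del0 [a [r [H1 H2 H3 [axi [rxi [L1 L2 L3 L4 L5]]]]]]]].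
exists del; split => //; exists (fun l w => - a (- l) w), (fun l w => - r (- l) w).
have itv l : - xi < l < - xi + del -> xi - del < - l < xi by move=> ?; lra.
split.
- move=> lam /itv lx; have [h1 h2 h3] := H1 _ lx; rewrite opprK in h1 h2; split.
  + exact: attr_unreflect.
  + exact: rep_unreflect.
  + by move=> w; rewrite ltrN2.
- move=> lam0 /itv lx e e0; have [eta [eta0 H]] := H2 _ lx e e0; exists eta; split => //.
  move=> lam /itv lx' ll w.
  have ll' : `|- lam - - lam0| < eta by rewrite -opprD normrN.
  by have [h1 h2] := H _ lx' ll' w; rewrite -!opprD !normrN.
- move=> l1 l2 h1 h2 h3 w; have [|||h4 h5] := H3 (- l2) (- l1) _ _ _ w; rewrite ?ltrN2 //; lra.
- have cvo (f : R -> R) (y : R) : f @ xi^'- --> y -> (fun l => - f (- l)) @ (- xi)^'+ --> - y.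
    move=> H; apply: cvgN; apply: (@cvg_comp _ _ _ -%R f _ (xi^'-)) => //.
    have -> : -%R @ (- xi)^'+ = xi^'- by rewrite -at_leftN opprK.
    exact: cvg_id.
  exists (fun w => - axi w), (fun w => - rxi w); split.
  + by move=> w; have [h1 h2] := L1 w; split; [exact: (cvo (a^~ w)) | exact: (cvo (r^~ w))].
  + exact: (equilibrium_unreflect L2).
  + exact: (equilibrium_unreflect L3).
  + by move=> w; rewrite lerN2.
  + by move=> e e0; have [w hw] := L5 e e0; exists w; lra.
Qed.

Lemma gplusN (g : Om -> R -> R) lam c d :
  vf (fun w => - c w) d (gminus (reflect_field g)) lam = reflect_field (vf c d (gplus g) (- lam)).
Proof.
apply/funext => w; apply/funext => x; rewrite /vf /gminus /gplus /reflect_field.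
have -> : Num.min 0 (- g w (- x)) = - Num.max 0 (g w (- x)) by rewrite oppr_max oppr0.
ring.
Qed.

Lemma gminusN (g : Om -> R -> R) lam c d :
  vf (fun w => - c w) d (gplus (reflect_field g)) lam = reflect_field (vf c d (gminus g) (- lam)).
Proof.
apply/funext => w; apply/funext => x; rewrite /vf /gminus /gplus /reflect_field.
have -> : Num.max 0 (- g w (- x)) = - Num.min 0 (g w (- x)) by rewrite oppr_min oppr0.
ring.
Qed.

Lemma vfN (g : Om -> R -> R) lam c d :
  vf (fun w => - c w) d (reflect_field g) lam = reflect_field (vf c d g (- lam)).
Proof. by apply/funext => w; apply/funext => x; rewrite /vf /reflect_field; ring. Qed.

Lemma reflect_der (g : Om -> R -> R) w x : derivable (g w) (- x) 1 ->
  is_derive x 1 (reflect_field g w) (gx g w (- x)).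
Proof.
move=> H; have D : is_derive (- x) 1 (g w) (gx g w (- x)) by exact: der_derive1.
by apply: (is_derive_eq (is_derN (der_opp D))); rewrite opprK.
Qed.

Lemma concave_comp_opp (f : R -> R) (I J : set R) : concave_on f I -> (forall x, J x -> I (- x)) ->
  concave_on (fun x => f (- x)) J.
Proof.
move=> H JI x y t Jx Jy t01.
have -> : - (t * x + (1 - t) * y) = t * - x + (1 - t) * - y by ring.
by apply: H => //; exact: JI.
Qed.

End Reflection.

Lemma jointly_included_concave (R : realType) (Om : pseudoPMetricType R) (sigma : R -> Om -> Om)
  (g : Om -> R -> R)
  (hg1 : forall w x, derivable (g w) x 1)
  (hgx : continuous (fun p : Om * R => derive1 (g p.1) p.2))
  (cc4a : forall w, g w 0 = 0 /\ derive1 (g w) 0 = 0)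
  (cc5 : forall m : probability (Borel Om) R, ergodic sigma m ->
           full_meas m [set w | concave_on (g w) [set x | 0 <= x] /\
                                convex_on (g w) [set x | x <= 0]])
  (b1 b2 : Om -> R) : jointly_included sigma g b1 b2 ->
  forall m : probability (Borel Om) R, ergodic sigma m ->
    full_meas m [set w | concave_on (gx g w) (cc (b1 w) (b2 w))].
Proof.
move=> [lt hj] m em; apply: (full_meas2 (cc5 m em) (proj1 (hj m em))) => w [/= c5 sub].
have [_ hle] := gx_props hg1 hgx cc4a c5.
exact: (band_concave (@gx_cont R Om g hgx w) (ltW (lt w)) (proj2 (cc4a w)) hle sub).
Qed.

Theorem mainTheorem10
  (R : realType) (Om : pseudoPMetricType R)
  (* Om is a compact metric space *)
  (hOm_sep : hausdorff_space Om) (hOm_cpt : compact [set: Om])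
  (* (Om, sigma) continuous global flow, w.t = sigma t w *)
  (sigma : R -> Om -> Om) (hsigma : is_cont_flow sigma)
  (c d : Om -> R) (g : Om -> R -> R)
  (* (cc1) and g in C^{0,2}(Om x R, R) *)
  (hc : continuous c) (hd : continuous d)
  (hg : continuous (fun p : Om * R => g p.1 p.2))
  (hg1 : forall w x, derivable (g w) x 1)
  (hgx : continuous (fun p : Om * R => derive1 (g p.1) p.2))
  (hg2 : forall w x, derivable (derive1 (g w)) x 1)
  (hgxx : continuous (fun p : Om * R => derive1 (derive1 (g p.1)) p.2))
  (* (cc2) *)
  (cc2 : forall m : probability (Borel Om) R, ergodic sigma m ->
           (0 < \int[m]_w (d w)%:E)%E)
  (* (cc3) *)
  (cc3 : forall M : R, exists K : R, forall w x,
           (K <= x -> d w * x + g w x <= - M) /\ (x <= - K -> M <= d w * x + g w x))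
  (* (cc4) *)
  (cc4a : forall w, g w 0 = 0 /\ derive1 (g w) 0 = 0)
  (cc4b : forall w x, 0 <= x -> g w x <= 0)
  (cc4c : forall w x, x <= 0 -> 0 <= g w x)
  (cc4d : forall m : probability (Borel Om) R, ergodic sigma m ->
           full_meas m [set w | (forall x, 0 < x -> g w x < 0) /\
                                (forall x, x < 0 -> 0 < g w x)])
  (* (cc5) *)
  (cc5 : forall m : probability (Borel Om) R, ergodic sigma m ->
           full_meas m [set w | concave_on (g w) [set x | 0 <= x] /\
                                convex_on (g w) [set x | x <= 0]])
  (* (cc6): J = [a, b] a compact interval of [0, +oo) *)
  (cc6 : forall a b : R, 0 <= a -> a <= b ->
         forall m : probability (Borel Om) R, ergodic sigma m ->
           pos_meas m [set w | strictly_decreasing_on (derive1 (g w)) (cc a b) /\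
                               strictly_increasing_on (derive1 (g w)) (cc (- b) (- a))])
  (* lambda_- and the hyperbolic pairs (a^-_lam, r^-_lam) of tau^-_lam *)
  (lam_m : R) (am rm : R -> Om -> R)
  (hlam_m : forall lam, lam_m < lam <->
     exists a r, [/\ attr_hyp_copy sigma (vf c d (gminus g) lam) a,
                     rep_hyp_copy sigma (vf c d (gminus g) lam) r &
                     forall w, r w < a w])
  (hamrm : forall lam, lam_m < lam ->
     [/\ attr_hyp_copy sigma (vf c d (gminus g) lam) (am lam),
         rep_hyp_copy sigma (vf c d (gminus g) lam) (rm lam) &
         forall w, rm lam w < am lam w])
  (* lambda^+ and the hyperbolic pairs (a^+_lam, r^+_lam) of tau^+_lam *)
  (lam_p : R) (ap rp : R -> Om -> R)
  (hlam_p : forall lam, lam < lam_p <->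
     exists a r, [/\ attr_hyp_copy sigma (vf c d (gplus g) lam) a,
                     rep_hyp_copy sigma (vf c d (gplus g) lam) r &
                     forall w, a w < r w])
  (haprp : forall lam, lam < lam_p ->
     [/\ attr_hyp_copy sigma (vf c d (gplus g) lam) (ap lam),
         rep_hyp_copy sigma (vf c d (gplus g) lam) (rp lam) &
         forall w, ap lam w < rp lam w])
  (hlam : lam_m < lam_p)
  (lam1 lam2 : R) (h1 : lam_m < lam1) (h12 : lam1 < lam2) (h2 : lam2 < lam_p) :
  (jointly_included sigma g (att_low sigma (vf c d g lam2)) (rm lam1) ->
     exists xi_p, lam_p <= xi_p /\ saddle_node_up sigma (vf c d g) xi_p) /\
  (jointly_included sigma g (rp lam2) (att_up sigma (vf c d g lam1)) ->
     exists xi_m, xi_m <= lam_m /\ saddle_node_down sigma (vf c d g) xi_m).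
Proof.
split=> hj.
  have [_ [crm [erm _]] _] := hamrm _ h1.
  apply: (saddle_node_up_of_band hOm_sep hOm_cpt hsigma hc hd hg hg1 hgx cc2 cc3 cc4a cc4b cc4c cc5
    h12 h2 crm erm).
  - by move=> lam hl; have [_ [cr [er _]] _] := haprp _ hl; exists (rp lam).
  - by case: hj.
  - exact: (jointly_included_concave hg1 hgx cc4a cc5 hj).
have [_ [crp [erp _]] _] := haprp _ h2.
pose g' := reflect_field g.
have der' w (x : R) : is_derive x 1 (g' w) (gx g w (- x)) by exact: reflect_der.
have gx' w : gx g' w = fun x => gx g w (- x) by apply/funext => x; rewrite /gx derive1E; exact: derive_val.
have fstc : continuous (fun p : Om * R => p.1) by move=> p; exact: cvg_fst.
have sndc : continuous (fun p : Om * R => - p.2) by move=> p; apply: cvgN; exact: cvg_snd.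
have hc' : continuous (fun w => - c w) by move=> w; apply: cvgN; exact: hc.
have hg' : continuous (fun p : Om * R => g' p.1 p.2).
  by move=> p; apply: cvgN; exact: (cont_comp2 hg fstc sndc).
have hgx' : continuous (fun p : Om * R => derive1 (g' p.1) p.2).
  have -> : (fun p : Om * R => derive1 (g' p.1) p.2) = fun p => derive1 (g p.1) (- p.2).
    by apply/funext => p; exact: (congr1 (fun f => f p.2) (gx' p.1)).
  exact: (@cont_comp2 R Om _ (gx g) _ _ hgx fstc sndc).
have hg1' w (x : R) : derivable (g' w) x 1 by case: (der' w x).
have cc3' M : exists K : R, forall w x,
    (K <= x -> d w * x + g' w x <= - M) /\ (x <= - K -> M <= d w * x + g' w x).
  have [K HK] := cc3 M; exists K => w x; have [k1 k2] := HK w (- x).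
  by rewrite /g' /reflect_field; split => xK; [have := k2 | have := k1]; lra.
have cc4a' w : g' w 0 = 0 /\ derive1 (g' w) 0 = 0.
  have [z1 z2] := cc4a w; split; first by rewrite /g' /reflect_field oppr0 z1 oppr0.
  by have := congr1 (fun f => f 0) (gx' w); rewrite /gx /= oppr0 z2.
have cc4b' w x : 0 <= x -> g' w x <= 0.
  by move=> x0; rewrite /g' /reflect_field oppr_le0; apply: cc4c; rewrite oppr_le0.
have cc4c' w x : x <= 0 -> 0 <= g' w x.
  by move=> x0; rewrite /g' /reflect_field oppr_ge0; apply: cc4b; rewrite oppr_ge0.
have cc5' (m : probability (Borel Om) R) : ergodic sigma m ->
    full_meas m [set w | concave_on (g' w) [set x | 0 <= x] /\ convex_on (g' w) [set x | x <= 0]].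
  move=> em; apply: (full_meas2 (cc5 m em) (cc5 m em)) => w [[cv cx] _]; split => x y t /= x0 y0 t01;
    rewrite /g' /reflect_field.
    have := cx (- x) (- y) t; rewrite /= !oppr_le0 => /(_ x0 y0 t01).
    have -> : t * - x + (1 - t) * - y = - (t * x + (1 - t) * y) by ring.
    by rewrite -lerN2 => H; apply: le_trans H; rewrite le_eqVlt; apply/orP; left; apply/eqP; ring.
  have := cv (- x) (- y) t; rewrite /= !oppr_ge0 => /(_ x0 y0 t01).
  have -> : t * - x + (1 - t) * - y = - (t * x + (1 - t) * y) by ring.
  by rewrite -lerN2 => H; apply: (le_trans H); rewrite le_eqVlt; apply/orP; left; apply/eqP; ring.
have l12' : - lam2 < - lam1 by rewrite ltrN2.
have l1m' : - lam1 < - lam_m by rewrite ltrN2.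
have crp' : continuous (fun w => - rp lam2 w) by move=> w; apply: cvgN; exact: crp.
have erp' : equilibrium sigma (vf (fun w => - c w) d (gminus g') (- lam2)) (fun w => - rp lam2 w).
  by rewrite gplusN opprK; exact: equilibrium_reflect.
have HR lam : lam < - lam_m -> exists R0, continuous R0 /\
    equilibrium sigma (vf (fun w => - c w) d (gplus g') lam) R0.
  move=> hl; have hl' : lam_m < - lam by lra.
  have [_ [cr [er _]] _] := hamrm _ hl'; exists (fun w => - rm (- lam) w); split.
    by move=> w; apply: cvgN; exact: cr.
  by rewrite gminusN; exact: equilibrium_reflect.
have low w : att_low sigma (vf (fun w => - c w) d g' (- lam1)) w = - att_up sigma (vf c d g lam1) w.
  by rewrite vfN opprK att_low_reflect.
have lt' w : att_low sigma (vf (fun w => - c w) d g' (- lam1)) w < - rp lam2 w.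
  by rewrite low ltrN2; case: hj.
have band' (m : probability (Borel Om) R) : ergodic sigma m -> full_meas m
    [set w | concave_on (gx g' w) (cc (att_low sigma (vf (fun w => - c w) d g' (- lam1)) w)
                                      (- rp lam2 w))].
  move=> em; have H := jointly_included_concave hg1 hgx cc4a cc5 hj em.
  apply: (full_meas2 H H) => w [/= cv _]; rewrite gx' low.
  by apply: (concave_comp_opp cv) => x; rewrite /cc /= lerNr lerNl andbC.
have [xi [xim sn]] := saddle_node_up_of_band hOm_sep hOm_cpt hsigma hc' hd hg' hg1' hgx' cc2 cc3'
  cc4a' cc4b' cc4c' cc5' l12' l1m' crp' erp' HR lt' band'.
exists (- xi); split; first by rewrite lerNl.
apply: saddle_node_reflect; move: sn; congr (saddle_node_up sigma _ xi).
by apply/funext => lam; exact: vfN.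
Qed.
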